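(* Let $G=(V,E)$ be any $n$-vertex weighted undirected graph with polynomially bounded (positive) weights, let $0<r<1$, $0<\epsilon<1$, and let $S\subseteq V$ be a set of $n^r$ sources. Let $r'$ be the solution to the equation $r'=1-(1-r)\cdot\omega(r')$. Then there is a deterministic algorithm in the Congested Clique model that computes $(1+\epsilon)$-approximate shortest path distances for $S\times V$ within $\tilde{O}(n^{1-2/\omega(r')}/\epsilon)$ rounds.
   Context: Congested Clique model: the $n$ vertices of $G$ are processors, each initially knowing its incident edges and their weights; they communicate in synchronous rounds, in each of which every pair of vertices may exchange a message of $O(\log n)$ bits; local computation is free; complexity is the number of rounds. For $0\le r\le 1$, $\omega(r)$ denotes the exponent such that the product of an $n^r\times n$ matrix by an $n\times n$ matrix can be computed with $n^{\omega(r)}$ algebraic operations (best known rectangular matrix multiplication). $(1+\epsilon)$-approximate distances for $S\times V$ means estimates $\delta(u,v)$ for all $u\in S,v\in V$ with $d_G(u,v)\le\delta(u,v)\le(1+\epsilon)d_G(u,v)$. $\tilde O$ hides polylogarithmic factors in $n$. *)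

(* Defs.v *)
From HB Require Import structures.
From mathcomp Require Import all_boot all_order all_algebra.
From mathcomp Require Import all_classical all_reals all_analysis.

Set Implicit Arguments.
Unset Strict Implicit.
Unset Printing Implicit Defensive.

Import Order.TTheory GRing.Theory Num.Theory.
Local Open Scope ring_scope.

Definition ceil_pow (R : realType) (n : nat) (s : R) : nat :=
  `|Num.ceil (n%:R `^ s)|%N.

(* Division-free straight-line programs whose only constants are integers, so
   that the same program makes sense over every commutative ring.  An
   instruction appends its value to the list of registers; reading an input
   entry, a constant or an earlier register is free. *)
Inductive ring_op := OpAdd | OpSub | OpMul.

Inductive operand (m k l : nat) :=
  | InA of 'I_m & 'I_k
  | InB of 'I_k & 'I_l
  | Cst of int
  | Reg of nat.

Definition instr (m k l : nat) : Type :=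
  (ring_op * operand m k l * operand m k l)%type.

Definition op_val (T : comNzRingType) (o : ring_op) (x y : T) : T :=
  match o with OpAdd => x + y | OpSub => x - y | OpMul => x * y end.

Definition operand_val (m k l : nat) (T : comNzRingType)
    (A : 'M[T]_(m, k)) (B : 'M[T]_(k, l)) (regs : seq T)
    (o : operand m k l) : T :=
  match o with
  | InA i j => A i j
  | InB i j => B i j
  | Cst z => z%:~R
  | Reg q => nth 0 regs q
  end.

Definition slp_regs (m k l : nat) (T : comNzRingType)
    (A : 'M[T]_(m, k)) (B : 'M[T]_(k, l)) (p : seq (instr m k l)) : seq T :=
  foldl (fun regs (c : instr m k l) =>
           let: (o, x, y) := c in
           rcons regs
             (op_val o (operand_val A B regs x) (operand_val A B regs y)))
        [::] p.

Definition computes_mulmx (m k l : nat) (p : seq (instr m k l))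
    (out : 'I_m -> 'I_l -> operand m k l) : Prop :=
  forall (T : comNzRingType) (A : 'M[T]_(m, k)) (B : 'M[T]_(k, l)) i j,
    operand_val A B (slp_regs A B p) (out i j) = (A *m B) i j.

(* The product of an n^s x n matrix by an n x n matrix can be computed with
   O(n^w) algebraic operations. *)
Definition mulmx_exponent (R : realType) (s w : R) : Prop :=
  exists C : R, forall n : nat,
    exists (p : seq (instr (ceil_pow n s) n n)) out,
      computes_mulmx p out /\ (size p)%:R <= C * n%:R `^ w.

(* [wadj u v] is [None] when uv is not an edge, else the weight of uv. *)
Record wgraph (n : nat) := WGraph {
  wadj : 'I_n -> 'I_n -> option nat;
  wadj_sym : forall u v, wadj u v = wadj v u;
  wadj_irrefl : forall u, wadj u u = None;
  wadj_pos : forall u v w, wadj u v = Some w -> (0 < w)%N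
}.

Definition weights_le (n : nat) (G : wgraph n) (M : nat) : Prop :=
  forall u v w, wadj G u v = Some w -> (w <= M)%N.

Definition edge (n : nat) (G : wgraph n) : rel 'I_n :=
  fun u v => wadj G u v != None.

(* The walk visits u and then the vertices listed in p. *)
Fixpoint walk_weight (n : nat) (G : wgraph n) (u : 'I_n) (p : seq 'I_n) : nat :=
  if p is v :: q then (odflt 0 (wadj G u v) + walk_weight G v q)%N else 0%N.

(* Equal to +oo when u and v are not connected (infimum of the empty set). *)
Definition dist (R : realType) (n : nat) (G : wgraph n) (u v : 'I_n) : \bar R :=
  ereal_inf [set ((walk_weight G u p)%:R : R)%:E |
             p in [set p : seq 'I_n | path (edge G) u p /\ last u p = v]].

(* Deterministic algorithm on n processors for the Congested Clique with b-bit
   messages, with local inputs in I and local outputs in O.  Local computation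
   is free, so the transition functions are arbitrary. *)
Record cc_algorithm (n b : nat) (I O : Type) := CCAlgorithm {
  cc_state : Type;
  cc_init : 'I_n -> I -> cc_state;
  cc_send : 'I_n -> cc_state -> 'I_n -> {bseq b of bool};
  cc_recv : 'I_n -> cc_state -> ('I_n -> {bseq b of bool}) -> cc_state;
  cc_out : 'I_n -> cc_state -> O
}.

Fixpoint cc_config (n b : nat) (I O : Type) (A : cc_algorithm n b I O)
    (input : 'I_n -> I) (t : nat) : 'I_n -> cc_state A :=
  if t is t'.+1 then
    let c := cc_config A input t' in
    fun v => cc_recv v (c v) (fun u => cc_send u (c u) v)
  else fun v => cc_init A v (input v).

Definition cc_run (n b : nat) (I O : Type) (A : cc_algorithm n b I O)
    (input : 'I_n -> I) (t : nat) (v : 'I_n) : O :=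
  cc_out v (cc_config A input t v).

(* A vertex initially knows whether it is a source, and its incident edges
   with their weights. *)
Definition local_input (n : nat) : Type := (bool * ('I_n -> option nat))%type.

Definition graph_input (n : nat) (G : wgraph n) (S : {set 'I_n}) (v : 'I_n) :
    local_input n :=
  (v \in S, wadj G v).

Definition bandwidth (K n : nat) : nat := (K * (trunc_log 2 n).+1)%N.

(* At the end, the vertex v outputs the function u |-> delta(u, v), which is
   only relevant for sources u. *)
Definition mssp_algorithm (R : realType) (K n : nat) : Type :=
  cc_algorithm n (bandwidth K n) (local_input n) ('I_n -> \bar R).

Definition approx_distances (R : realType) (n : nat) (G : wgraph n)
    (S : {set 'I_n}) (eps : R) (delta : 'I_n -> 'I_n -> \bar R) : Prop :=
  forall u v, u \in S ->
    (dist R G u v <= delta u v)%E /\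
    (delta u v <= (1 + eps)%:E * dist R G u v)%E.

(* T = O~(f), uniformly in eps; 1 + ln n replaces ln n to include n <= 1. *)
Definition soft_O (R : realType) (T : nat -> R -> nat) (f : nat -> R -> R) :
    Prop :=
  exists (C : R) (k : nat), forall (n : nat) (eps : R), 0 < eps < 1 ->
    (T n eps)%:R <= C * (1 + ln n%:R) ^+ k * f n eps.

(* Main.v *)
(* Write w for omega(r').  The rank of the identity bilinear map gives w >= 2,
   and the equation for r' becomes r = 1 - (1 - r') / w.

   Products.  The bidegree (1,1) part of a straight-line program for d^r' x d
   by d x d products, with d = n^(1/w), is a bilinear algorithm with O(n)
   products, one per vertex.  Applied to blocks it multiplies a K x n matrix by
   an n x n matrix over a prime field, and, one layer per value, it computes
   min-plus products with entries bounded by W, in about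
   W (1 + K / d^r') / d rounds; the right factor is prepared once.

   Short cuts.  Every vertex learns its n^(1-r) <= n^(1/2) nearest vertices,
   and a set of O~(n^r) hubs hits all these balls.  The sources and the hubs
   together form a set of O~(n^r) roots.

   Sweeps.  Suppose that distances up to D are known up to a factor 1 + e/M.  A
   sweep in M time windows of length D/M propagates estimates up to 3D/2 from
   all roots: an edge of length about 2^j windows is relaxed every 2^j steps
   with a rounding unit proportional to 2^j, which costs a relative error
   O(1/M).  A shortest path is followed by ball hops as long as it does not
   come within one window of a hub; when it does, the distances to and from
   that hub are combined.  If the distances are already known up to a factor
   1 + O(1/M) from the previous precision, only the roots whose current window
   is near are relevant to a vertex; random delays of the roots make their
   number about n^r 2^j / M, so that all the sweeps together cost
   O~(M n^(1-2/w)).  The precision M is doubled until it exceeds 1/eps.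

   All random choices are made from families of polynomial size and are
   derandomised by conditional expectations.  When 1/eps > n^(1-1/w) the exact
   distances, obtained by repeated min-plus squaring in O~(n^(1/2)) rounds, are
   cheap enough. *)
Require Import Defs.
From mathcomp Require Import all_boot all_order all_algebra.
From mathcomp Require Import all_classical all_reals all_analysis.
From mathcomp Require Import zify ring lra.
From mathcomp Require Import fintype.

Set Implicit Arguments.
Unset Strict Implicit.
Unset Printing Implicit Defensive.

Import Order.TTheory GRing.Theory Num.Theory.
Local Open Scope ring_scope.

(** * Protocols as Hoare triples *)

(** Two obstacles shape the proof. First, the roots relevant at a given moment differ from vertex to
    vertex, so no common choice of rows makes a product small. The rows are therefore mixed into [K]
    Vandermonde combinations, from which each vertex recovers its own [K] rows by free local
    computation. Second, a min-plus product costs as much as its entries are large. A relaxation of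
    class [j] therefore only handles estimates within [O(2 ^ j)] windows of the front, measured from
    an origin that moves with time; a bound proportional to the precision (up to logarithms) then
    serves all entries, in all classes and at all scales. A scale extends the range only by [3 / 2]
    because the leg from a hub to the target must lie in the range already known. Each scale adds
    [8 / M] to the relative error, so [M] carries a factor proportional to the number of scales.
    Polynomially many candidates suffice for every random choice: there are [2 ^ poly(n)] situations
    to serve, a random candidate fails each of them with inverse polynomial probability, and the
    number of failing candidates is exponentially concentrated. *)

Section Protocols.
Local Open Scope nat_scope.
Variable n : nat.

(* The auxiliary variable of type [G] links the two assertions; the algorithm
   does not depend on it. *)
Definition solves (G X Y : Type) (t : nat) (P : G -> ('I_n -> X) -> Prop)
    (Q : G -> ('I_n -> Y) -> Prop) : Prop :=
  exists A : cc_algorithm n (bandwidth 1 n) X Y,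
    forall g c, P g c -> Q g (cc_run A c t).

(** Frame rule: every vertex keeps its input beside the state of the inner algorithm, so [h] can
    combine both at the end. The auxiliary [g] may depend on the actual inputs, since the algorithm
    never sees it. *)
Lemma solves_lift (G G' X X' Y Y' : Type) t
    (P : G -> ('I_n -> X) -> Prop) (Q : G -> ('I_n -> Y) -> Prop)
    (P' : G' -> ('I_n -> X') -> Prop) (Q' : G' -> ('I_n -> Y') -> Prop)
    (f : 'I_n -> X' -> X) (h : 'I_n -> X' -> Y -> Y') :
  solves t P Q ->
  (forall g' c, P' g' c -> exists g, P g (fun v => f v (c v)) /\
     forall d, Q g d -> Q' g' (fun v => h v (c v) (d v))) ->
  solves t P' Q'.
Proof.
move=> [A HA] H.
pose A' := @CCAlgorithm n (bandwidth 1 n) X' Y' (X' * cc_state A)%type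
  (fun v x => (x, cc_init A v (f v x)))
  (fun v s u => cc_send v s.2 u)
  (fun v s r => (s.1, cc_recv v s.2 r))
  (fun v s => h v s.1 (cc_out v s.2)).
exists A' => g' c /H [g [Pg Hd]].
have E k v : cc_config A' c k v = (c v, cc_config A (fun v => f v (c v)) k v).
  elim: k v => [//|k IH] v /=; rewrite IH /=; congr (_, cc_recv _ _ _).
  by apply/funext => u; rewrite IH.
have -> : cc_run A' c t =
    (fun v => h v (c v) (cc_run A (fun v => f v (c v)) t v)).
  by apply/funext => v; rewrite /cc_run E.
exact/Hd/HA.
Qed.

Lemma solves_conseq (G X Y : Type) t
    (P P' : G -> ('I_n -> X) -> Prop) (Q Q' : G -> ('I_n -> Y) -> Prop) :
  solves t P Q -> (forall g c, P' g c -> P g c) ->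
  (forall g c, Q g c -> Q' g c) -> solves t P' Q'.
Proof.
move=> [A HA] HP HQ; exists A => g c /HP /HA; exact: HQ.
Qed.

Lemma solves_idle (G X Y : Type) t (P : G -> ('I_n -> X) -> Prop)
    (Q : G -> ('I_n -> Y) -> Prop) (f : 'I_n -> X -> Y) :
  (forall g c, P g c -> Q g (fun v => f v (c v))) -> solves t P Q.
Proof.
move=> H.
exists (@CCAlgorithm n (bandwidth 1 n) X Y X (fun _ x => x)
  (fun _ _ _ => [bseq]) (fun _ x _ => x) f) => g c /H; congr (Q g).
apply/funext => v; rewrite /cc_run /=; congr f.
by elim: t.
Qed.

Lemma solves_seq (G X Y Z : Type) t1 t2 (P : G -> ('I_n -> X) -> Prop)
    (R : G -> ('I_n -> Y) -> Prop) (Q : G -> ('I_n -> Z) -> Prop) :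
  solves t1 P R -> solves t2 R Q -> solves (t1 + t2) P Q.
Proof.
move=> [A HA] [B HB].
(* The first phase carries the number of remaining rounds. The switch is made locally on receipt of
   the last message, or at initialisation when [t1 = 0], so it costs no round. *)
pose next v k s : (nat * cc_state A) + cc_state B :=
  if k is k'.+1 then inl (k, s) else inr (cc_init B v (cc_out v s)).
pose C := @CCAlgorithm n (bandwidth 1 n) X Z
  ((nat * cc_state A) + cc_state B)%type
  (fun v x => next v t1 (cc_init A v x))
  (fun v s u => match s with
     | inl ks => cc_send v ks.2 u | inr s => cc_send v s u end)
  (fun v s r => match s with
     | inl ks => next v ks.1.-1 (cc_recv v ks.2 r)
     | inr s => inr (cc_recv v s r) end)
  (fun v s => match s with
     | inl ks => cc_out v (cc_init B v (cc_out v ks.2))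
     | inr s => cc_out v s end).
exists C => g c /HA /HB.
have E1 k v : k <= t1 -> cc_config C c k v = next v (t1 - k) (cc_config A c k v).
  elim: k v => [|k IH] v lk; first by rewrite subn0.
  have Ek u : cc_config C c k u = inl (t1 - k, cc_config A c k u).
    by rewrite IH 1?ltnW // /next -(subnSK lk).
  rewrite /= Ek /= -subnS; congr (next _ _ (cc_recv _ _ _)).
  by apply/funext => u; rewrite Ek.
have E2 k v : cc_config C c (t1 + k) v = inr (cc_config B (cc_run A c t1) k v).
  elim: k v => [|k IH] v; first by rewrite addn0 E1 // subnn.
  rewrite addnS /= IH; congr (inr (cc_recv _ _ _)).
  by apply/funext => u; rewrite IH.
congr (Q g); apply/funext => v.
by rewrite /cc_run E2.
Qed.

Lemma solves_pad (G X Y : Type) t t' (P : G -> ('I_n -> X) -> Prop)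
    (Q : G -> ('I_n -> Y) -> Prop) :
  solves t P Q -> t <= t' -> solves t' P Q.
Proof.
move=> H le; rewrite -(subnKC le); apply: solves_seq H _.
exact: (@solves_idle _ _ _ _ _ _ (fun _ x => x)).
Qed.

Lemma solves_loop (G X : Type) (t : nat -> nat) k
    (I : nat -> G -> ('I_n -> X) -> Prop) :
  (forall i, i < k -> solves (t i) (I i) (I i.+1)) ->
  solves (\sum_(i < k) t i) (I 0) (I k).
Proof.
elim: k => [|k IH] H.
  exact: (@solves_idle _ _ _ _ _ _ (fun _ x => x)).
rewrite big_ord_recr; apply: solves_seq (H k _) => //.
by apply: IH => i lik; apply: H; rewrite ltnW.
Qed.

(** A protocol may depend on common knowledge: every vertex simulates the algorithm chosen for its
    own copy of [h], and by the precondition all copies agree. *)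
Lemma solves_param (H G X Y : Type) t (P : H -> G -> ('I_n -> X) -> Prop)
    (Q : G -> ('I_n -> Y) -> Prop) :
  (forall h, solves t (P h) Q) ->
  solves t (fun g (c : 'I_n -> H * X) =>
      exists2 h, (forall v, (c v).1 = h) & P h g (fun v => (c v).2)) Q.
Proof.
move=> HS.
pose A h := projT1 (cid (HS h)).
have HA h g c : P h g c -> Q g (cc_run (A h) c t).
  by rewrite /A; case: cid => /= a; apply.
pose C := @CCAlgorithm n (bandwidth 1 n) (H * X) Y {h & cc_state (A h)}
  (fun v x => existT _ x.1 (cc_init (A x.1) v x.2))
  (fun v s u => cc_send v (projT2 s) u)
  (fun v s r => existT _ (projT1 s) (cc_recv v (projT2 s) r))
  (fun v s => cc_out v (projT2 s)).
exists C => g c [h Hh /HA].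
have E k : cc_config C c k =
    fun v => existT _ h (cc_config (A h) (fun v => (c v).2) k v).
  elim: k => [|k IH]; apply/funext => v /=; last by rewrite IH.
  by move: (Hh v); case: (c v) => h' x /= ->.
congr (Q g); apply/funext => v.
by rewrite /cc_run E.
Qed.

(** Messages form an alphabet of more than [n] letters, so one round transmits one digit in base
    [n.+1]; all message sizes are counted in such digits. *)
Definition letters := enum {bseq (bandwidth 1 n) of bool}.

Lemma size_letters : n < size letters.
Proof.
rewrite -cardE; apply: (@leq_trans #|{: (bandwidth 1 n).-tuple bool}|).
  rewrite card_tuple card_bool /bandwidth mul1n.
  exact: trunc_log_ltn.
apply: (@leq_card _ _ (fun t => @bseq_of_tuple _ _ t)) => s t /(congr1 val) /= st.
exact: val_inj.
Qed.

Lemma modn_expS a b k :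
  a %% b.+1 ^ k.+1 = a %% b.+1 ^ k + (a %/ b.+1 ^ k) %% b.+1 * b.+1 ^ k.
Proof.
have E : a = (a %/ b.+1 ^ k.+1) * b.+1 ^ k.+1 +
             ((a %/ b.+1 ^ k) %% b.+1 * b.+1 ^ k + a %% b.+1 ^ k).
  have := divn_eq (a %/ b.+1 ^ k) b.+1; have := divn_eq a (b.+1 ^ k).
  rewrite -divnMA -expnSr => Ea Eq; rewrite [LHS]Ea {1}Eq.
  by rewrite mulnDl -mulnA [b.+1 * _]mulnC -expnSr addnA.
rewrite {1}E modnMDl modn_small; first by rewrite addnC.
have h1 : a %% b.+1 ^ k < b.+1 ^ k by rewrite ltn_mod expn_gt0.
have h2 : (a %/ b.+1 ^ k) %% b.+1 < b.+1 by rewrite ltn_mod.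
rewrite expnS; nia.
Qed.

Lemma solves_send (G X Y : Type) (T : finType) e
    (P : G -> ('I_n -> X) -> Prop) (Q : G -> ('I_n -> Y) -> Prop)
    (m : 'I_n -> X -> 'I_n -> T) (h : 'I_n -> X -> ('I_n -> T) -> Y) :
  #|T| <= n.+1 ^ e ->
  (forall g c, P g c -> Q g (fun v => h v (c v) (fun u => m u (c u) v))) ->
  solves e P Q.
Proof.
move=> cT H.
pose rk v x u := index (m v x u) (enum T).
have rkT v x u : rk v x u < n.+1 ^ e.
  by apply: leq_trans cT; rewrite cardE index_mem mem_enum.
pose A := @CCAlgorithm n (bandwidth 1 n) X Y (X * nat * ('I_n -> nat))%type
  (fun _ x => (x, 0, fun=> 0))
  (fun v s u => nth [bseq] letters ((rk v s.1.1 u %/ n.+1 ^ s.1.2) %% n.+1))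
  (fun v s r => (s.1.1, s.1.2.+1,
     fun u => s.2 u + index (r u) letters * n.+1 ^ s.1.2))
  (fun v s => h v s.1.1 (fun u => nth (m v s.1.1 v) (enum T) (s.2 u))).
have E c k v : cc_config A c k v =
    (c v, k, fun u => rk u (c u) v %% n.+1 ^ k).
  elim: k v => [|k IH] v /=.
    by congr (_, _); apply/funext => u; rewrite modn1.
  rewrite IH /=; congr (_, _); apply/funext => u; rewrite IH /= index_uniq.
  - by rewrite modn_expS.
  - by apply: leq_trans size_letters; rewrite ltn_mod.
  - exact: enum_uniq.
exists A => g c /H; congr (Q g); apply/funext => v.
rewrite /cc_run E /=; congr (h _ _ _); apply/funext => u.
by rewrite modn_small // nth_index // mem_enum.
Qed.

(** After the broadcast the vector [x] is common knowledge, so the continuation may be a different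
    protocol for every [x]. *)
Lemma solves_bcast (G X Y : Type) (T : finType) e t
    (P : G -> ('I_n -> X) -> Prop) (Q : G -> ('I_n -> Y) -> Prop)
    (f : 'I_n -> X -> T) :
  #|T| <= n.+1 ^ e ->
  (forall x : 'I_n -> T,
     solves t (fun g c => P g c /\ forall u, f u (c u) = x u) Q) ->
  solves (e + t) P Q.
Proof.
move=> cT H; apply: solves_seq (solves_param H).
apply: (solves_send (m := fun v x _ => f v x) (h := fun v x r => (r, x)) cT).
by move=> g c Pc; exists (fun u => f u (c u)).
Qed.

End Protocols.

(** * Random functions and agreement on one of them *)

Section Counting.
Local Open Scope nat_scope.

Lemma leq_card_inj (T T' : finType) (A : {pred T}) (B : {pred T'}) (f : T -> T') :
  {in A &, injective f} -> {in A, forall x, f x \in B} -> #|A| <= #|B|.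
Proof.
move=> fi fAB; rewrite -(card_in_image fi); apply/subset_leq_card/subsetP => y.
by case/imageP => x xA ->; exact: fAB.
Qed.

Lemma leq_expl a b k : a <= b -> a ^ k <= b ^ k.
Proof. by case: k => // k; rewrite leq_exp2r. Qed.

(** An integer form of [(1 + c/M)^N <= exp(c*N/M)]. From [(1 + c/M)^q * (1 - q*c/M) <= 1], a group
    of [q = M %/ (2 * c)] factors at most doubles the value, and [L] groups cover [N] factors
    because [q >= M / (4 * c)]. *)
Lemma leq_pow_double M c N L : c <= M -> 4 * c * N <= M * L ->
  (M + c) ^ N <= 2 ^ L * M ^ N.
Proof.
move=> cM H.
have bern q : (M + c) ^ q * M <= M ^ q * M + (M + c) ^ q * (q * c).
  elim: q => [|q IH]; first by rewrite !expn0 mul1n; lia.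
  rewrite !expnS; move: IH; set a := (M + c) ^ q; set b := M ^ q => IH.
  have : M * (a * M) <= M * (b * M + a * (q * c)) by rewrite leq_mul2l IH orbT.
  nia.
have one q : 2 * (q * c) <= M -> (M + c) ^ q <= 2 * M ^ q.
  case: (posnP M) => [M0|M0] h.
    by have -> : c = 0 by [move: cM; rewrite M0; lia]; rewrite addn0; lia.
  rewrite -(leq_pmul2r M0); have := bern q; set a := _ ^ q; nia.
have many q k : 2 * (q * c) <= M -> (M + c) ^ (q * k) <= 2 ^ k * M ^ (q * k).
  move=> h; rewrite !expnM -expnMn; case: k => // k.
  by rewrite leq_exp2r // one.
have mono q k : q <= k -> (M + c) ^ k <= 2 ^ L * M ^ k -> 0 < M ->
    (M + c) ^ q <= 2 ^ L * M ^ q.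
  move=> qk h M0; have := h; rewrite -(subnK qk) !expnD => h2.
  have : M ^ (k - q) * (M + c) ^ q <= M ^ (k - q) * (2 ^ L * M ^ q).
    apply: leq_trans (_ : (M + c) ^ (k - q) * (M + c) ^ q <= _); last by nia.
    by rewrite leq_mul2r leq_expl ?orbT ?leq_addr.
  by rewrite leq_pmul2l // expn_gt0 M0.
case: (posnP M) => [M0|M0].
  have -> : c = 0 by lia.
  by rewrite addn0 leq_pmull // expn_gt0.
case: (posnP c) => [->|c0].
  by rewrite addn0 leq_pmull // expn_gt0.
case: (leqP (2 * c) M) => hc; last first.
  apply: leq_trans (_ : 2 ^ N * M ^ N <= _).
    by rewrite -expnMn leq_expl //; lia.
  by rewrite leq_mul2r leq_exp2l // orbC; apply/orP; left; nia.
have q0 : 0 < M %/ (2 * c) by rewrite divn_gt0 //; lia.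
have h1 : 2 * (M %/ (2 * c) * c) <= M.
  by have := leq_divM M (2 * c); lia.
have h2 : M < (M %/ (2 * c)).+1 * (2 * c) by apply: ltn_ceil; lia.
apply: (mono _ (M %/ (2 * c) * L)) => //; last exact: many.
by set q := M %/ _ in q0 h1 h2 *; nia.
Qed.

(* Markov's inequality for [2 ^ (number of hits)]. *)
Lemma card_hits (Z W : finType) (A : Z -> pred W) g :
  #|[pred f : {ffun Z -> W} | g <= #|[pred z | A z (f z)]|]| * 2 ^ g <=
  \prod_z (#|W| + #|[pred w | A z w]|).
Proof.
have -> : \prod_z (#|W| + #|[pred w | A z w]|) =
    \prod_z \sum_w 2 ^ (A z w : nat).
  apply: eq_bigr => z _; rewrite -sum1_card -[X in _ + X]sum1_card.
  rewrite [X in _ + X]big_mkcond -big_split /=.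
  by apply: eq_big => // w _; rewrite inE; case: (A z w).
rewrite bigA_distr_bigA /= -sum1_card big_distrl /=.
rewrite [X in X <= _]big_mkcond leq_sum // => f _.
case: ifP => // h; rewrite mul1n -expn_sum.
rewrite leq_exp2l //; apply: leq_trans h _.
by rewrite -sum1_card big_mkcond /= leq_sum // => z _; rewrite inE; case: (A _ _).
Qed.

(** Only positions in [S] can hit, each with probability at most [c / #|W|]. The expected number of
    hits is then at most [L / 4], and the exponential moment at most [2 ^ L]. *)
Lemma card_hits_le (Z W : finType) (S : {pred Z}) (A : Z -> pred W) c N L g :
  #|S| <= N -> (forall z, z \notin S -> A z =1 pred0) ->
  (forall z, #|[pred w | A z w]| <= c) -> c <= #|W| -> 4 * c * N <= #|W| * L ->
  #|[pred f : {ffun Z -> W} | g <= #|[pred z | A z (f z)]|]| * 2 ^ g <=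
  2 ^ L * #|W| ^ #|Z|.
Proof.
move=> SN AS Ac cW H; apply: leq_trans (card_hits _ _) _.
rewrite (bigID (mem S)) /=.
apply: leq_trans (_ : (#|W| + c) ^ #|S| * #|W| ^ (#|Z| - #|S|) <= _).
  apply: leq_mul.
    rewrite -prod_nat_const; apply: leq_prod => z _; by rewrite leq_add2l.
  have -> : #|Z| - #|S| = #|[predC S]| by rewrite -(cardC S) addKn.
  rewrite -prod_nat_const; apply: leq_prod => z zS.
  by rewrite (eq_card0 (A := [pred w | A z w])) ?addn0 // => w; rewrite inE AS.
apply: leq_trans (_ : (2 ^ L * #|W| ^ #|S|) * #|W| ^ (#|Z| - #|S|) <= _).
  rewrite leq_mul2r; apply/orP; right; apply: leq_pow_double => //.
  by apply: leq_trans H; rewrite leq_mul2l SN orbT.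
by rewrite -mulnA -expnD subnKC // max_card.
Qed.

(** Probabilistic method on the family itself: draw [f z] independently for each seed [z]. For a
    fixed [i] at most one bad seed is expected, [g] of them occur with probability at most
    [16 / 2 ^ g], and a union bound over [I] concludes. A few seeds thus replace the huge sample
    space [W]. *)
Lemma good_family (I W Z : finType) (bad : I -> pred W) g :
  0 < #|W| -> 16 * #|I| < 2 ^ g ->
  (forall i, #|[pred w | bad i w]| * #|Z| <= #|W|) ->
  exists f : Z -> W, forall i, #|[pred z | bad i (f z)]| < g.
Proof.
move=> W0 Ig H.
pose B i := [pred f : {ffun Z -> W} | g <= #|[pred z | bad i (f z)]|].
have BE i : #|B i| * 2 ^ g <= 16 * #|W| ^ #|Z|.
  apply: (@card_hits_le _ _ predT (fun=> bad i) #|[pred w | bad i w]| #|Z| 4) => //.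
  - exact: max_card.
  - by move: (H i); rewrite mulnC; lia.
have : #|[pred f : {ffun Z -> W} | [exists i, B i f]]| < #|{ffun Z -> W}|.
  apply: (@leq_ltn_trans (\sum_i #|B i|)).
    rewrite -sum1_card; under [X in _ <= X]eq_bigr do rewrite -sum1_card big_mkcond.
    rewrite exchange_big big_mkcond /= leq_sum // => f _.
    rewrite inE; case: ifP => // /existsP[i fi].
    by rewrite (bigD1 i) //= ifT.
  rewrite card_ffun -(ltn_pmul2r (expn_gt0 2 g)) big_distrl /=.
  apply: leq_ltn_trans (_ : \sum_(i : I) 16 * #|W| ^ #|Z| < _).
    exact: leq_sum.
  rewrite sum_nat_const mulnA [#|I| * _]mulnC mulnC ltn_pmul2l //.
  by rewrite expn_gt0 W0.
rewrite ltnNge => /negP hf.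
have [f /existsPn fP] : exists f, ~~ [exists i, B i f].
  apply/existsP; apply: contra_notT hf => /existsPn h.
  by apply/subset_leq_card/subsetP => f _; move: (h f); rewrite negbK inE.
by exists f => i; move: (fP i); rewrite /= -ltnNge.
Qed.

End Counting.

(** * Deterministic agreement on a seed *)

Section Agreement.
Local Open Scope nat_scope.
Variable n : nat.

(* Method of conditional expectations: the digits of the candidate are fixed
   one at a time, vertex [a] evaluating the digit [a]. *)
Lemma solves_agree (G X Y : Type) e t (P : G -> ('I_n -> X) -> Prop)
    (Q : G -> ('I_n -> Y) -> Prop) (bad : 'I_n -> X -> e.-tuple 'I_n -> bool) :
  (forall g c, P g c -> \sum_v #|[pred z | bad v (c v) z]| < n ^ e) ->
  (forall z, solves t (fun g c => P g c /\ forall v, ~~ bad v (c v) z) Q) ->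
  solves (e * e.+2 + t) P Q.
Proof.
elim: e G X t P Q bad => [|e IH] G X t P Q bad H HS.
  apply: solves_conseq (HS [tuple]) _ _ => // g c /[dup] Pc /H; split=> // v.
  apply/negP => bv; have : 0 < \sum_v #|[pred z | bad v (c v) z]|.
    rewrite (bigD1 v) //= addn_gt0; apply/orP; left.
    by apply/card_gt0P; exists [tuple].
  by lia.
case: (posnP n) => [n0|n0].
  have e0 (v : 'I_n) : False by case: v => v; rewrite n0.
  apply: (@solves_idle _ _ _ _ _ _ _ (fun v _ => False_rect _ (e0 v))).
  by move=> g c /H; have -> : n ^ e.+1 = 0 by rewrite n0 exp0n.
pose cnt v x a := #|[pred z : e.-tuple 'I_n | bad v x (cons_tuple a z)]|.
have cnt_le v x a : cnt v x a < (n ^ e).+1.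
  by rewrite ltnS (leq_trans (max_card _)) // card_tuple card_ord.
have le_exp k : n ^ k < n.+1 ^ k.+1.
  apply: (@leq_ltn_trans (n.+1 ^ k)); first exact: leq_expl.
  by rewrite ltn_exp2l.
have -> : e.+1 * e.+3 + t = e.+1 + (e.+2 + (e * e.+2 + t)) by lia.
pose R g (c : 'I_n -> X * nat) := P g (fun v => (c v).1) /\
  forall a, (c a).2 = \sum_v cnt v (c v).1 a.
apply: (@solves_seq _ _ _ _ _ _ _ _ R).
  apply: (solves_send (T := 'I_(n ^ e).+1)
    (m := fun v x a => inord (cnt v x a))
    (h := fun v x r => (x, \sum_u (r u : nat)))).
    by rewrite card_ord.
  move=> g c Pc; split => //= a; apply: eq_bigr => v _.
  by rewrite inordK.
apply: (solves_bcast (T := 'I_(n ^ e.+1).+1) (f := fun v x => inord x.2)).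
  by rewrite card_ord.
(* Fewer than [n ^ e.+1] bad pairs are spread over [n] first digits, so the best digit has fewer
   than [n ^ e] of them: the hypothesis for the shorter tuples. *)
move=> x; pose a := [arg min_(a < Ordinal n0) (x a : nat)].
have amin b : x a <= x b by rewrite /a; case: arg_minnP => // i _; apply.
apply: (IH _ _ _ _ _ (fun v (y : X * nat) z => bad v y.1 (cons_tuple a z))).
- move=> g c [[Pc cE] xE].
  have cxE b : (x b : nat) = \sum_v cnt v (c v).1 b.
    rewrite -xE -cE inordK // ltnS cE expnS.
    apply: leq_trans (_ : \sum_(v < n) n ^ e <= _).
      by apply: leq_sum => v _; rewrite -ltnS.
    by rewrite sum_nat_const card_ord.
  rewrite -[X in X < _]/(\sum_v cnt v (c v).1 a) -cxE.
  have : \sum_(b < n) (x a : nat) < n ^ e.+1.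
    apply: leq_ltn_trans (H _ _ Pc).
    apply: leq_trans (_ : \sum_b \sum_v cnt v (c v).1 b <= _).
      by apply: leq_sum => b _; rewrite -cxE.
    rewrite exchange_big leq_sum // => v _ /=.
    rewrite -sum1_card (partition_big (fun z => thead z) predT) //=.
    apply: leq_sum => b _; rewrite sum1_card.
    apply: (leq_card_inj (f := cons_tuple b)).
      by move=> z z' _ _ /(congr1 val) [] /val_inj.
    move=> z zb; rewrite unfold_in /= theadE eqxx andbT.
    exact: zb.
  rewrite sum_nat_const card_ord => h.
  by rewrite -(ltn_pmul2l n0) -expnS.
- move=> z; case: (HS (cons_tuple a z)) => A HA.
  apply: (solves_lift (f := fun _ (x : X * nat) => x.1) (h := fun _ _ d => d)).
    by exists A; exact: HA.
  by move=> g c [[[Pc _] _] Hz]; exists g; split.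
Qed.

End Agreement.

(** * Routing *)

Section Routing.
Local Open Scope nat_scope.

Definition pack (T : finType) K (s : seq T) : {ffun 'I_K -> option T} :=
  [ffun k => onth s (k : 'I_K)].

Definition unpack (T : finType) K (f : {ffun 'I_K -> option T}) : seq T :=
  pmap f (enum 'I_K).

Lemma mem_unpack (T : finType) K (s : seq T) :
  size s <= K -> unpack (pack K s) =i s.
Proof.
move=> sK x; rewrite mem_pmap; apply/mapP/onthP => [[k _]|[i ix]].
  by rewrite ffunE => ->; exists k.
have lt : i < K by apply: leq_trans sK; rewrite -onthTE ix.
by exists (Ordinal lt); rewrite ?mem_enum // ffunE ix.
Qed.

Variable n : nat.
Definition lg := (trunc_log 2 n).+1.

(** An agreement on [2 * a + 5] digits, then three exchanges of at most [4 * t + (2 * a + 6) * lg]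
    items per ordered pair of vertices, an item with its labels taking [a + b + 2] digits. *)
Definition route_cost (a b t : nat) :=
  (2 * a + 5) * (2 * a + 5).+2 +
  3 * ((4 * t + (2 * a + 6) * lg) * (a + b).+2).

Lemma ltn_lg : n < 2 ^ lg.
Proof. exact: trunc_log_ltn. Qed.

Lemma card_ffun_option (T : finType) K e : 0 < n -> #|T| <= n.+1 ^ e ->
  #|{ffun 'I_K -> option T}| <= n.+1 ^ (K * e.+1).
Proof.
move=> n0 cT; rewrite card_ffun card_ord card_option mulnC expnM leq_expl //.
by rewrite expnS; have := expn_gt0 n.+1 e; nia.
Qed.

Lemma size_filter_enum (T : finType) (p : pred T) :
  size [seq y <- enum T | p y] = #|[pred y | p y]|.
Proof.
by rewrite size_filter -sum1_count big_enum_cond -sum1_card; apply: eq_bigl.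
Qed.

Section RandomIntermediate.
Variables (J : finType) (a t : nat).
Hypotheses (n1 : 1 < n) (cJ : #|J| <= n.+1 ^ a).

Let e := 2 * a + 5.
Let K := 4 * t + (2 * a + 6) * lg.
Let W := {ffun 'I_n * J -> 'I_n}.

Definition overload (S : pred ('I_n * J)) (phi : W) :=
  (#|[pred z | S z]| <= n * t) &&
  [exists w, K < #|[pred z | S z && (phi z == w)]|].

(** The expected load of one intermediate vertex is at most [t], so it exceeds [K] with probability
    below [2 ^ (4 * t - K)], which is at most [n ^ (- e - 1)]; a union over the [n] intermediate
    vertices leaves [n ^ (- e)]. *)
Lemma card_overload (S : pred ('I_n * J)) :
  #|[pred phi | overload S phi]| * n ^ e <= #|W|.
Proof.
case: (leqP #|[pred z | S z]| (n * t)) => hS; last first.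
  rewrite eq_card0 ?mul0n // => phi; rewrite !inE /overload.
  by rewrite leqNgt hS.
pose B w := [pred phi : W | K < #|[pred z | S z && (phi z == w)]|].
have cB w : #|B w| * 2 ^ K.+1 <= 2 ^ (4 * t) * #|W|.
  have := @card_hits_le _ _ [pred z | S z] (fun z x => S z && (x == w))
    1 (n * t) (4 * t) K.+1 hS.
  rewrite card_ord !card_ffun card_ord; apply.
  - by move=> z; rewrite inE => /negbTE zS x; rewrite /= zS.
  - move=> z; rewrite -(card1 w); apply/subset_leq_card/subsetP => x.
    by rewrite !inE => /andP[].
  - by lia.
  - by rewrite muln1 mulnCA.
have le1 : #|[pred phi | overload S phi]| <= \sum_w #|B w|.
  rewrite -sum1_card; under [X in _ <= X]eq_bigr do rewrite -sum1_card big_mkcond.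
  rewrite exchange_big big_mkcond /= leq_sum // => f _.
  rewrite inE; case: ifP => // /andP[_ /existsP[w fw]].
  by rewrite (bigD1 w) //= ifT.
rewrite -(leq_pmul2r (expn_gt0 2 K.+1)) mulnAC.
apply: leq_trans (_ : (\sum_(w < n) 2 ^ (4 * t) * #|W|) * n ^ e <= _).
  rewrite leq_mul2r; apply/orP; right; apply: leq_trans (_ : (\sum_w #|B w|) * 2 ^ K.+1 <= _).
    by rewrite leq_mul2r le1 orbT.
  by rewrite big_distrl; apply: leq_sum => w _; exact: cB.
rewrite sum_nat_const card_ord.
have : n * n ^ e <= 2 ^ ((2 * a + 6) * lg).
  rewrite -expnS; apply: leq_trans (leq_expl _ (ltnW ltn_lg)) _.
  by rewrite -expnM leq_exp2l // mulnC leq_mul2r; apply/orP; right; rewrite /e; lia.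
rewrite expnS /K expnD; set x := n ^ e; set y := 2 ^ (4 * t); set z := 2 ^ _.
set w := #|W| => h; apply: leq_trans (_ : w * (y * (n * x)) <= _); first by lia.
by rewrite leq_mul2l; apply/orP; right; nia.
Qed.

Lemma routing_family : exists f : e.-tuple 'I_n -> W,
  forall S : pred ('I_n * J),
    #|[pred z | overload S (f z)]| < n * n.+1 ^ a + 5.
Proof.
have := @good_family {ffun 'I_n * J -> bool} W (e.-tuple 'I_n)
  (fun S phi => overload S phi) (n * n.+1 ^ a + 5).
case.
- by rewrite card_ffun card_ord expn_gt0; apply/orP; left; lia.
- rewrite card_ffun card_bool card_prod card_ord expnD.
  have : 2 ^ (n * #|J|) <= 2 ^ (n * n.+1 ^ a).
    by rewrite leq_exp2l // leq_mul2l cJ orbT.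
  have := expn_gt0 2 (n * n.+1 ^ a).
  by move: (2 ^ _) (2 ^ _) => x y; lia.
- move=> S; rewrite card_tuple card_ord; exact: card_overload.
move=> f fP; exists f => S; have := fP [ffun z => S z].
congr (_ < _); apply: eq_card => z; rewrite !inE /overload.
congr (_ && _); last first.
  by apply: eq_existsb => w; congr (_ < _); apply: eq_card => x; rewrite !inE ffunE.
by congr (_ <= _); apply: eq_card => x; rewrite !inE ffunE.
Qed.

(** Each of the [n] vertices rejects at most [n * n.+1 ^ a + 4] seeds for each of its two item sets,
    sent and received; [e = 2 * a + 5] makes the seeds outnumber all rejections. *)
Lemma routing_count : n * (2 * (n * n.+1 ^ a + 4)) < n ^ e.
Proof.
have h1 : n.+1 <= n ^ 2 by rewrite expnS expn1; nia.
have h2 : n.+1 ^ a <= n ^ (2 * a) by rewrite expnM leq_expl.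
have -> : n ^ e = n * (n * (n ^ 3 * n ^ (2 * a))).
  by rewrite -expnD -!expnS; congr (n ^ _); rewrite /e; lia.
have h3 : 8 <= n ^ 3 by rewrite (leq_expl 3 n1).
have h4 : 0 < n ^ (2 * a) by rewrite expn_gt0; lia.
rewrite ltn_pmul2l; last by lia.
move: h2 h3 h4; set x := n.+1 ^ a; set y := n ^ (2 * a); set z := n ^ 3.
move=> h2 h3 h4; apply: leq_trans (_ : n * (8 * y) <= _).
  by nia.
by rewrite leq_mul2l leq_mul2r h3 !orbT.
Qed.

End RandomIntermediate.

(* Every item travels through a random intermediate vertex; the random choice
   is derandomised by agreement, each vertex being able to evaluate the
   congestion it causes since it knows which items it is waiting for. *)
Lemma solves_fetch (G X Y : Type) (J T : finType) a b t
    (P : G -> ('I_n -> X) -> Prop) (Q : G -> ('I_n -> Y) -> Prop)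
    (act : 'I_n -> X -> pred J) (pay : 'I_n -> X -> J -> T)
    (want : 'I_n -> X -> 'I_n -> pred J)
    (h : 'I_n -> X -> ('I_n -> J -> option T) -> Y) :
  1 < n -> #|J| <= n.+1 ^ a -> #|T| <= n.+1 ^ b ->
  (forall g c, P g c ->
     [/\ forall v u j, want v (c v) u j -> act u (c u) j,
         forall u, #|[pred j | act u (c u) j]| <= n * t &
         forall v, #|[pred z | want v (c v) z.1 z.2]| <= n * t]) ->
  (forall g c, P g c -> Q g (fun v => h v (c v) (fun u j =>
     if want v (c v) u j then Some (pay u (c u) j) else None))) ->
  solves (route_cost a b t) P Q.
Proof.
move=> n1 cJ cT HP HQ; rewrite /route_cost.
set K := 4 * t + _; set e := 2 * a + 5.
have [f fP] := routing_family t n1 cJ.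
pose snd_set v x (z : 'I_n * J) := (z.1 == v) && act v x z.2.
pose rcv_set v x (z : 'I_n * J) := want v x z.1 z.2.
pose bad v x z := overload a t (snd_set v x) (f z) || overload a t (rcv_set v x) (f z).
refine (@solves_agree n G X Y e _ P Q bad _ _).
  move=> g c Pc; apply: leq_ltn_trans (routing_count t n1 cJ).
  rewrite -[X in _ <= X * _](card_ord n) -sum_nat_const; apply: leq_sum => v _.
  pose A := [pred z | overload a t (snd_set v (c v)) (f z)].
  pose B := [pred z | overload a t (rcv_set v (c v)) (f z)].
  have -> : #|[pred z | bad v (c v) z]| = #|[predU A & B]| by exact: eq_card.
  have hA : #|A| < n * n.+1 ^ a + 5 := fP _.
  have hB : #|B| < n * n.+1 ^ a + 5 := fP _.
  by have := cardUI A B; move: hA hB; move: #|A| #|B| #|[predU A & B]| => *; lia.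
move=> z; pose phi := f z.
(* By [l0] a receiver announces to [phi (u, j)] that it wants item [(u, j)], by [l1] the senders
   deposit their items there, and by [l2] the intermediate vertex answers. A sender never learns who
   wants its items. *)
pose l0 v x w := [seq y <- enum {: 'I_n * J} | rcv_set v x y && (phi y == w)].
pose l1 u x w := [seq y <- enum {: J * T} |
  [&& act u x y.1, y.2 == pay u x y.1 & phi (u, y.1) == w]].
pose E0 := {ffun 'I_K -> option ('I_n * J)}.
pose E1 := {ffun 'I_K -> option (J * T)}.
pose l2 (r0 : 'I_n -> E0) (r1 : 'I_n -> E1) v :=
  [seq y <- enum {: 'I_n * J * T} |
    (y.1 \in unpack (r0 v)) && ((y.1.2, y.2) \in unpack (r1 y.1.1))].
pose R0 g c := P g c /\ forall v, ~~ bad v (c v) z.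
pose R1 g (c : 'I_n -> X * ('I_n -> E0)) := R0 g (fun v => (c v).1) /\
  forall w, (c w).2 = fun v => pack K (l0 v (c v).1 w).
pose R2 g (c : 'I_n -> X * ('I_n -> E0) * ('I_n -> E1)) :=
  R1 g (fun v => (c v).1) /\
  forall w, (c w).2 = fun u => pack K (l1 u (c u).1.1 w).
have cM (T' : finType) : #|T'| <= n.+1 ^ (a + b).+1 ->
    #|{ffun 'I_K -> option T'}| <= n.+1 ^ (K * (a + b).+2).
  by apply: card_ffun_option; lia.
have cJT : #|{: J * T}| <= n.+1 ^ (a + b) by rewrite card_prod expnD leq_mul.
have ge1 k : 0 < n.+1 ^ k by rewrite expn_gt0.
have c0 : #|{: 'I_n * J}| <= n.+1 ^ (a + b).+1.
  rewrite card_prod card_ord expnS leq_mul // expnD.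
  by apply: leq_trans cJ _; rewrite leq_pmulr.
have c1 : #|{: J * T}| <= n.+1 ^ (a + b).+1.
  by apply: leq_trans cJT _; rewrite leq_pexp2l.
have c2 : #|{: 'I_n * J * T}| <= n.+1 ^ (a + b).+1.
  rewrite !card_prod card_ord -mulnA expnS; apply: leq_mul; first exact: leqnSn.
  by rewrite -card_prod.
have -> : 3 * (K * (a + b).+2) =
  K * (a + b).+2 + (K * (a + b).+2 + K * (a + b).+2) by lia.
have nobad g c S : R0 g c ->
    (exists v, S = snd_set v (c v) \/ S = rcv_set v (c v)) ->
    forall w, #|[pred x | S x && (phi x == w)]| <= K.
  move=> [/HP[_ sndP rcvP] no] [v Sv] w.
  have : ~~ overload a t S (f z) by move: (no v); rewrite negb_or; case: Sv => -> /andP[].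
  rewrite negb_and => /orP[/negP[]|/existsPn/(_ w)]; last by rewrite -leqNgt.
  case: Sv => ->; last exact: rcvP.
  apply: leq_trans (sndP v); apply: (leq_card_inj (f := fun y => y.2)).
    by move=> [? ?] [? ?]; rewrite !inE /snd_set /= => /andP[/eqP-> _] /andP[/eqP-> _] ->.
  by move=> [? ?]; rewrite !inE /snd_set /= => /andP[].
apply: (@solves_seq _ _ _ _ _ _ _ _ R1).
  by apply: (solves_send (m := fun v x w => pack K (l0 v x w))
    (h := fun v x r => (x, r)) (cM _ c0)) => g c Pc; split.
apply: (@solves_seq _ _ _ _ _ _ _ _ R2).
  by apply: (solves_send (m := fun v x w => pack K (l1 v x.1 w))
    (h := fun v x r => (x, r)) (cM _ c1)) => g c Pc; split.
apply: (solves_send (m := fun w x v => pack K (l2 x.1.2 x.2 v))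
  (h := fun v x r => h v x.1.1 (fun u j =>
     [pick p | [exists w, (u, j, p) \in unpack (r w)]]))
  (cM _ c2)).
move=> g c [[R0c cE0] cE1]; have [Pc _] := R0c; have [wantP _ _] := HP _ _ Pc.
have := HQ _ _ Pc; congr (Q g).
apply/funext => v; congr h; apply/funext => u; apply/funext => j.
have in0 w v0 x : (x \in unpack ((c w).1.2 v0)) = (x \in l0 v0 (c v0).1.1 w).
  rewrite cE0 mem_unpack // size_filter_enum.
  by apply: (nobad _ _ _ R0c); exists v0; right.
have in1 w u0 x : (x \in unpack ((c w).2 u0)) = (x \in l1 u0 (c u0).1.1 w).
  rewrite cE1 mem_unpack // size_filter_enum.
  apply: leq_trans (_ : #|[pred x | snd_set u0 (c u0).1.1 x && (phi x == w)]| <= _).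
    apply: (leq_card_inj (f := fun y => (u0, y.1))).
      move=> [j1 p1] [j2 p2]; rewrite !inE /=.
      by move=> /and3P[_ /eqP-> _] /and3P[_ /eqP-> _] [->].
    by move=> [j1 p1]; rewrite !inE /snd_set /= eqxx => /and3P[-> _ ->].
  by apply: (nobad _ _ _ R0c); exists u0; left.
have in2 w x : (x \in unpack (pack K (l2 (c w).1.2 (c w).2 v))) =
    (x \in l2 (c w).1.2 (c w).2 v).
  rewrite mem_unpack // size_filter_enum.
  apply: leq_trans (_ : #|[pred x | rcv_set v (c v).1.1 x && (phi x == w)]| <= _).
    apply: (leq_card_inj (f := fun y => y.1)).
      move=> [[u1 j1] p1] [[u2 j2] p2]; rewrite !inE /= !in1 !mem_filter /=.
      by move=> /andP[_ /andP[/and3P[_ /eqP-> _] _]] /andP[_ /andP[/and3P[_ /eqP-> _] _]] [-> ->].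
    by move=> [[u1 j1] p1]; rewrite !inE /= in0 mem_filter => /andP[/andP[-> _] _].
  by apply: (nobad _ _ _ R0c); exists v; right.
have inE2 p : [exists w, (u, j, p) \in unpack (pack K (l2 (c w).1.2 (c w).2 v))] =
    want v (c v).1.1 u j && (p == pay u (c u).1.1 j).
  apply/existsP/andP => [[w]|[h1 /eqP h2]].
    by rewrite in2 mem_filter /= in0 in1 !mem_filter /rcv_set /= => /andP[/andP[/andP[/andP[-> _] _] /andP[/and3P[_ -> _] _]] _].
  exists (phi (u, j)); rewrite in2 mem_filter mem_enum andbT /= in0 in1.
  rewrite !mem_filter ?mem_enum /rcv_set /= h1 h2 !eqxx.
  by rewrite -!enumT !mem_enum (wantP v).
case: pickP => [p|h0]; first by rewrite inE2 => /andP[-> /eqP ->].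
case: ifP => // dE; have := h0 (pay u (c u).1.1 j).
by rewrite inE2 dE eqxx.
Qed.

Lemma solves_route (G X Y : Type) (J T : finType) a b t
    (P : G -> ('I_n -> X) -> Prop) (Q : G -> ('I_n -> Y) -> Prop)
    (dst : 'I_n -> X -> J -> option 'I_n) (pay : 'I_n -> X -> J -> T)
    (exp : 'I_n -> X -> 'I_n -> J -> bool)
    (h : 'I_n -> X -> ('I_n -> J -> option T) -> Y) :
  1 < n -> #|J| <= n.+1 ^ a -> #|T| <= n.+1 ^ b ->
  (forall g c, P g c ->
     [/\ forall v u j, exp v (c v) u j = (dst u (c u) j == Some v),
         forall u, #|[pred j | dst u (c u) j]| <= n * t &
         forall v, #|[pred z | exp v (c v) z.1 z.2]| <= n * t]) ->
  (forall g c, P g c -> Q g (fun v => h v (c v) (fun u j =>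
     if dst u (c u) j == Some v then Some (pay u (c u) j) else None))) ->
  solves (route_cost a b t) P Q.
Proof.
move=> n1 cJ cT HP HQ.
apply: (solves_fetch (act := fun u x j => isSome (dst u x j)) (pay := pay)
  (want := exp) (h := h)) => // g c Pc; have [expP h1 h2] := HP _ _ Pc.
  by split=> // v u j; rewrite expP => /eqP ->.
have := HQ _ _ Pc; congr (Q g); apply/funext => v; congr h.
by apply/funext => u; apply/funext => j; rewrite expP.
Qed.

End Routing.

(** * Bilinear algorithms from straight-line programs *)

Section Bilinear.
Variables (m k l : nat).

Definition pairing m n (U V : 'M[int]_(m, n)) : int := \sum_i \sum_j U i j * V i j.

Lemma pairingDl p q (U U' V : 'M[int]_(p, q)) :
  pairing (U + U') V = pairing U V + pairing U' V.
Proof.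
rewrite /pairing -big_split; apply: eq_bigr => i _; rewrite -big_split.
by apply: eq_bigr => j _; rewrite mxE mulrDl.
Qed.

Lemma pairingZl p q z (U V : 'M[int]_(p, q)) : pairing (z *: U) V = z * pairing U V.
Proof.
rewrite /pairing mulr_sumr; apply: eq_bigr => i _; rewrite mulr_sumr.
by apply: eq_bigr => j _; rewrite mxE mulrA.
Qed.

Lemma pairingNl p q (U V : 'M[int]_(p, q)) : pairing (- U) V = - pairing U V.
Proof. by rewrite -scaleN1r pairingZl mulN1r. Qed.

Lemma pairing0l p q (V : 'M[int]_(p, q)) : pairing 0 V = 0.
Proof. by rewrite -(scale0r V) pairingZl mul0r. Qed.

Lemma pairing_delta p q i j (V : 'M[int]_(p, q)) : pairing (delta_mx i j) V = V i j.
Proof.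
rewrite /pairing (bigD1 i) //= (bigD1 j) //= mxE !eqxx mul1r.
rewrite big1 ?addr0 => [|j' /negbTE j'j]; last by rewrite mxE j'j andbF mul0r.
rewrite big1 ?addr0 // => i' /negbTE i'i.
by rewrite big1 // => j' _; rewrite mxE i'i mul0r.
Qed.

Notation T := {poly {poly int}}.
(** The inner indeterminate marks entries of the left factor, the outer one entries of the right
    factor, so running the program over this ring sorts every register by bidegree. *)
Let Amx (a : 'M[int]_(m, k)) : 'M[T]_(m, k) := \matrix_(i, j) (a i j *: 'X)%:P.
Let Bmx (b : 'M[int]_(k, l)) : 'M[T]_(k, l) := \matrix_(i, j) ((b i j)%:P *: 'X).

(* Only the part of bidegree at most (1,1) of a polynomial matters; its
   (1,1)-part is a combination of the products of linear forms in [L]. *)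
Definition tracked (L : seq ('M[int]_(m, k) * 'M[int]_(k, l)))
    (f : 'M[int]_(m, k) -> 'M[int]_(k, l) -> T) :=
  exists (z : int) (U : 'M[int]_(m, k)) (V : 'M[int]_(k, l)) (w : nat -> int),
  forall a b,
    [/\ (f a b)`_0`_0 = z, (f a b)`_0`_1 = pairing U a, (f a b)`_1`_0 = pairing V b &
        (f a b)`_1`_1 = \sum_(t < size L)
           w t * (pairing (nth (0, 0) L t).1 a * pairing (nth (0, 0) L t).2 b)].

Lemma tracked_cat L L' f : tracked L f -> tracked (L ++ L') f.
Proof.
move=> [z [U [V [w H]]]]; exists z, U, V, (fun t => if (t < size L)%N then w t else 0).
move=> a b; have [-> -> -> ->] := H a b; split=> //.
rewrite size_cat big_split_ord /= [X in _ = _ + X]big1 ?addr0; last first.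
  by move=> t _; rewrite ltnNge leq_addr mul0r.
by apply: eq_bigr => t _; rewrite ltn_ord nth_cat ltn_ord.
Qed.

Lemma tracked_add L f g : tracked L f -> tracked L g ->
  tracked L (fun a b => f a b + g a b).
Proof.
move=> [z [U [V [w H]]]] [z' [U' [V' [w' H']]]].
exists (z + z'), (U + U'), (V + V'), (fun t => w t + w' t) => a b.
have [h1 h2 h3 h4] := H a b; have [h1' h2' h3' h4'] := H' a b.
rewrite !coefD h1 h2 h3 h4 h1' h2' h3' h4' !pairingDl; split=> //.
by rewrite -big_split; apply: eq_bigr => t _; rewrite mulrDl.
Qed.

Lemma tracked_opp L f : tracked L f -> tracked L (fun a b => - f a b).
Proof.
move=> [z [U [V [w H]]]].
exists (- z), (- U), (- V), (fun t => - w t) => a b.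
have [h1 h2 h3 h4] := H a b.
rewrite !coefN h1 h2 h3 h4 !pairingNl; split=> //.
by rewrite -sumrN; apply: eq_bigr => t _; rewrite mulNr.
Qed.

(** In the (1,1)-part of a product, constants times (1,1)-parts reuse old products; only the two
    products of a linear form in [a] with one in [b] are new. *)
Lemma tracked_mul L f g : tracked L f -> tracked L g ->
  exists L', [/\ size L' = 2%N & tracked (L ++ L') (fun a b => f a b * g a b)].
Proof.
move=> [z [U [V [w H]]]] [z' [U' [V' [w' H']]]].
exists [:: (U, V'); (U', V)]; split=> //.
exists (z * z'), (z *: U' + z' *: U), (z *: V' + z' *: V).
exists (fun t => if (t < size L)%N then z * w' t + z' * w t else 1) => a b.
have [h1 h2 h3 h4] := H a b; have [h1' h2' h3' h4'] := H' a b.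
have c0 (R : nzRingType) (x y : {poly R}) : (x * y)`_0 = x`_0 * y`_0.
  by rewrite coefM big_ord1 subn0.
have c1 (R : nzRingType) (x y : {poly R}) : (x * y)`_1 = x`_0 * y`_1 + x`_1 * y`_0.
  by rewrite coefM !big_ord_recl big_ord0 addr0.
rewrite !(c0, c1) !coefD !(c0, c1) h1 h2 h3 h4 h1' h2' h3' h4' !pairingDl !pairingZl.
split=> //; [by rewrite [z' * _]mulrC | by rewrite [z' * _]mulrC |].
rewrite size_cat /= !addnS addn0 !big_ord_recr /=.
rewrite ltnn ltnNge leqnSn /= !mul1r !nth_cat ltnn subnn ltnNge leqnSn /= subSnn /=.
under [X in _ = X + _ + _]eq_bigr => t _ do rewrite ltn_ord nth_cat ltn_ord mulrDl -!mulrA.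
rewrite big_split /= -!mulr_sumr; ring.
Qed.

Lemma tracked_slp (p : seq (instr m k l)) :
  exists L, [/\ (size L <= 2 * size p)%N &
    forall o : operand m k l,
      tracked L (fun a b =>
        operand_val (Amx a) (Bmx b) (slp_regs (Amx a) (Bmx b) p) o)].
Proof.
have base q0 L : (forall q, tracked L (fun a b => nth 0 (slp_regs (Amx a) (Bmx b) q0) q)) ->
  forall o : operand m k l, tracked L (fun a b =>
        operand_val (Amx a) (Bmx b) (slp_regs (Amx a) (Bmx b) q0) o).
  move=> h; case=> [i j|i j|z|q] //=.
  - exists 0, (delta_mx i j), 0, (fun=> 0) => a b.
    rewrite mxE; split; rewrite ?(coefC, coefZ, coefX) /= ?(coef0, coefC, coefZ, coefX) /=
      ?(mulr0, mulr1, coef0, coefC, pairing_delta, pairing0l) //.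
    by rewrite big1 // => t _; rewrite mul0r.
  - exists 0, 0, (delta_mx i j), (fun=> 0) => a b.
    rewrite mxE; split; rewrite ?(coefC, coefZ, coefX) /= ?(coef0, coefC, coefZ, coefX) /=
      ?(mulr0, mulr1, coef0, coefC, pairing_delta, pairing0l) //.
    by rewrite big1 // => t _; rewrite mul0r.
  - exists z, 0, 0, (fun=> 0) => a b.
    have -> : (z%:~R : T) = z%:P%:P by rewrite -[z in RHS]intz !rmorph_int.
    split; rewrite ?coefC /= ?coefC /= ?coef0 ?pairing0l //.
    by rewrite big1 // => t _; rewrite mul0r.
elim/last_ind: p => [|p [[f x] y] [L [sL HL]]].
  exists [::]; split=> //; apply: base => q.
  exists 0, 0, 0, (fun=> 0) => a b.
  by rewrite nth_nil !coef0 !pairing0l big_ord0.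
pose val a b := op_val f (operand_val (Amx a) (Bmx b) (slp_regs (Amx a) (Bmx b) p) x)
   (operand_val (Amx a) (Bmx b) (slp_regs (Amx a) (Bmx b) p) y).
have [L' [sL' HL']] : exists L', (size L' <= 2)%N /\ tracked (L ++ L') val.
  rewrite /val; case: f {val} => /=.
  - by exists [::]; rewrite cats0; split=> //; apply: tracked_add.
  - by exists [::]; rewrite cats0; split=> //; apply: tracked_add => //; apply: tracked_opp.
  - by have [L' [h ?]] := tracked_mul (HL x) (HL y); exists L'; rewrite h.
exists (L ++ L'); split.
  by rewrite size_cat size_rcons mulnS addnC leq_add.
apply: base => q.
have E a b : nth 0 (slp_regs (Amx a) (Bmx b) (rcons p (f, x, y))) q =
    if q == size p then val a b else nth 0 (slp_regs (Amx a) (Bmx b) p) q.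
  have sz (T' : comNzRingType) (A : 'M[T']_(m, k)) B (p' : seq (instr m k l)) :
      size (slp_regs A B p') = size p'.
    elim/last_ind: p' => // p' [[f' x'] y'].
    by rewrite /slp_regs foldl_rcons size_rcons => ->; rewrite size_rcons.
  rewrite /slp_regs foldl_rcons -!/(slp_regs _ _ _) nth_rcons sz.
  case: ltngtP => // h; by rewrite nth_default // sz ltnW.
case: (boolP (q == size p)) E => [_|_] E.
  case: HL' => z [U [V [w H]]]; exists z, U, V, w => a b; rewrite E; exact: H.
case: (tracked_cat L' (HL (Reg _ _ _ q))) => z [U [V [w H]]].
by exists z, U, V, w => a b; rewrite E; exact: H.
Qed.

(** The (1,1)-coefficient of a computed entry is the entry of the matrix product; reading it on
    pairs of matrix units gives the tensor identity. Integer coefficients make it usable over every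
    prime field. *)
Lemma slp_bilinear (p : seq (instr m k l)) out : computes_mulmx p out ->
  exists R (u : 'I_R -> 'I_m -> 'I_k -> int) (v : 'I_R -> 'I_k -> 'I_l -> int)
      (w : 'I_R -> 'I_m -> 'I_l -> int),
    (R <= 2 * size p)%N /\
    forall i j i' x x' j', \sum_t w t i j * (u t i' x * v t x' j') =
      ((i' == i) && (x == x') && (j' == j))%:R.
Proof.
move=> H; have [L [sL HL]] := tracked_slp p.
have HO i j := HL (out i j).
pose W i j := projT1 (cid (projT2 (cid (projT2 (cid (projT2 (cid (HO i j)))))))).
exists (size L), (fun t i j => (nth (0, 0) L t).1 i j).
exists (fun t i j => (nth (0, 0) L t).2 i j), (fun t i j => W i j t); split=> // i j i' x x' j'.
have := projT2 (cid (projT2 (cid (projT2 (cid (projT2 (cid (HO i j)))))))).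
rewrite -/(W i j) => /(_ (delta_mx i' x) (delta_mx x' j')) [_ _ _].
rewrite H mxE !coef_sum => E.
have {E} : \sum_(s < k) delta_mx i' x i s * delta_mx x' j' s j =
    \sum_(t < size L) W i j t * (pairing (nth (0, 0) L t).1 (delta_mx i' x) *
      pairing (nth (0, 0) L t).2 (delta_mx x' j')).
  rewrite -E; apply: eq_bigr => s _.
  by rewrite !mxE coefCM coefZ coefX mulr1 coefMC coefZ coefX mulr1.
rewrite (bigD1 x) //= big1 ?addr0 => [|s /negbTE sx]; last by rewrite !mxE sx andbF mul0r.
rewrite !mxE eqxx andbT => E.
have pd s1 s2 (U : 'M[int]_(s1, s2)) a b : pairing U (delta_mx a b) = U a b.
  rewrite -[RHS](pairing_delta a b); apply: eq_bigr => *; apply: eq_bigr => *.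
  exact: mulrC.
transitivity (\sum_(t < size L) W i j t * (pairing (nth (0, 0) L t).1 (delta_mx i' x) *
      pairing (nth (0, 0) L t).2 (delta_mx x' j'))).
  by apply: eq_bigr => t _; rewrite !pd.
rewrite -E -natrM mulnb; congr (nat_of_bool _)%:R.
by rewrite ![_ == i']eq_sym ![_ == j']eq_sym andbA.
Qed.

End Bilinear.

(** * Distributed matrix multiplication *)

Section PartialInverse.
Local Open Scope nat_scope.

Lemma inj_of_card (T U : finType) : #|T| <= #|U| -> exists f : T -> U, injective f.
Proof.
move=> h; exists (fun x => enum_val (widen_ord h (enum_rank x))) => x y.
by move=> /enum_val_inj /(congr1 val) /= /val_inj /enum_rank_inj.
Qed.

Definition part_inv (T : finType) (U : eqType) (f : T -> U) (z : U) : option T :=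
  [pick x | f x == z].

Lemma part_invK (T : finType) (U : eqType) (f : T -> U) :
  injective f -> forall x, part_inv f (f x) = Some x.
Proof.
move=> fi x; rewrite /part_inv; case: pickP => [y /eqP/fi ->//|/(_ x)].
by rewrite eqxx.
Qed.

Lemma part_inv_some (T : finType) (U : eqType) (f : T -> U) z x :
  part_inv f z = Some x -> f x = z.
Proof. by rewrite /part_inv; case: pickP => // y /eqP h [<-]. Qed.

Lemma sum_part_inv (V : nmodType) (T U : finType) (f : T -> U) (F : T -> V) :
  injective f ->
  (\sum_z (if part_inv f z is Some x then F x else 0) = \sum_x F x)%R.
Proof.
move=> fi; rewrite [RHS](partition_big f predT) //=; apply: eq_bigr => z _.
case E: (part_inv f z) => [x|].
  rewrite (big_pred1 x) // => y; rewrite /= -(part_inv_some E).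
  by apply/eqP/eqP => [/fi|->].
by rewrite big_pred0 // => x; move: E; rewrite /part_inv; case: pickP => // /(_ x).
Qed.

Definition owner (n : nat) (n0 : 0 < n) (T : finType) (x : T) : 'I_n :=
  Ordinal (ltn_pmod (enum_rank x) n0).

Lemma card_owner n (n0 : 0 < n) (T : finType) w :
  #|[pred x : T | owner n0 x == w]| <= #|T| %/ n + 1.
Proof.
rewrite addn1 -[X in _ <= X]card_ord.
have lt (x : T) : enum_rank x %/ n < (#|T| %/ n).+1.
  by rewrite ltnS leq_div2r // ltnW.
apply: (leq_card_inj (f := fun x => Ordinal (lt x))) => // x y.
rewrite !inE => /eqP/(congr1 val) /= hx /eqP/(congr1 val) /= hy.
move=> /(congr1 val) /= h; apply/enum_rank_inj/val_inj.
by rewrite /= (divn_eq (enum_rank x) n) (divn_eq (enum_rank y) n) h hx hy.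
Qed.

End PartialInverse.

(** * Linear combinations of distributed blocks *)

Section LinearStage.
Variables (n : nat) (F : finFieldType) (I1 I2 Pos : finType).
Variables (a f t : nat).
Hypotheses (n1 : (1 < n)%N) (cF : (#|F| <= n.+1 ^ f)%N).
Hypotheses (cJ1 : (#|{: I1 * Pos}| <= n.+1 ^ a)%N).
Hypotheses (cJ2 : (#|{: I2 * Pos}| <= n.+1 ^ a)%N).
Variables (src : I1 -> Pos -> option 'I_n) (dst : I2 -> Pos -> option 'I_n).
Variable M : I2 -> I1 -> F.
Hypothesis src_load :
  forall u, (#|[pred z | src z.1 z.2 == Some u]| <= n * t)%N.
Hypothesis dst_load :
  forall u, (#|[pred z | dst z.1 z.2 == Some u]| <= n * t)%N.
Hypothesis in_load : ((#|Pos| %/ n + 1) * #|I1| <= n * t)%N.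
Hypothesis out_load : ((#|Pos| %/ n + 1) * #|I2| <= n * t)%N.

(* Entry [pos] of all the blocks goes to one vertex, which computes entry
   [pos] of all the linear combinations. *)
Lemma solves_linear (G X Y : Type) (P : G -> ('I_n -> X) -> Prop)
    (Q : G -> ('I_n -> Y) -> Prop) (val : 'I_n -> X -> I1 -> Pos -> F)
    (h : 'I_n -> X -> (I2 -> Pos -> F) -> Y) :
  (forall g c, P g c -> Q g (fun v => h v (c v) (fun j pos =>
     if dst j pos == Some v then
       \sum_i M j i * (if src i pos is Some u then val u (c u) i pos else 0)
     else 0))) ->
  solves (route_cost n a f t + route_cost n a f t) P Q.
Proof.
move=> HQ.
have n0 : (0 < n)%N by exact: ltnW.
pose own (pos : Pos) : 'I_n := owner n0 pos.
pose vv c i pos := if src i pos is Some u then val u (c u) i pos else 0.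
pose R g (c : 'I_n -> X * (I1 -> Pos -> F)) := P g (fun v => (c v).1) /\
  forall i pos, (c (own pos)).2 i pos = vv (fun v => (c v).1) i pos.
have fiber (T : finType) (p : Pos -> bool) w : (forall pos, p pos -> own pos == w) ->
    (#|[pred z : T * Pos | p z.2]| <= (#|Pos| %/ n + 1) * #|T|)%N.
  move=> hp; apply: leq_trans (_ : (#|[pred z : Pos * T | own z.1 == w]| <= _)%N).
    apply: (leq_card_inj (f := fun z => (z.2, z.1))).
      by move=> [? ?] [? ?] _ _ [-> ->].
    by move=> [? ?]; rewrite !inE; exact: hp.
  rewrite -(eq_card (A := predX [pred pos | own pos == w] predT)); last first.
    by move=> [? ?]; rewrite !inE andbT.
  by rewrite cardX leq_mul2r card_owner orbT.
apply: (@solves_seq _ _ _ _ _ _ _ _ R).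
  apply: (solves_route (J := (I1 * Pos)%type) (T := F)
    (dst := fun u _ z => if src z.1 z.2 == Some u then Some (own z.2) else None)
    (pay := fun u x z => val u x z.1 z.2)
    (exp := fun w _ u z => (src z.1 z.2 == Some u) && (own z.2 == w))
    (h := fun w x r => (x, fun i pos =>
        if src i pos is Some u then odflt 0 (r u (i, pos)) else 0))) => //.
    move=> g c Pc; split.
    - by move=> v u [i pos] /=; case: (_ == _).
    - move=> u; apply: leq_trans (src_load u); apply/subset_leq_card/subsetP => z.
      by rewrite !inE; case: (_ == _).
    - move=> v; apply: leq_trans in_load.
      apply: leq_trans (_ : #|[pred z : I1 * Pos | own z.2 == v]| <= _)%N; last first.
        exact: (fiber I1 (fun pos => own pos == v) v).
      apply: (leq_card_inj (f := snd)).
        move=> [u z] [u' z']; rewrite !inE /= => /andP[/eqP hu _] /andP[/eqP hu' _] zz.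
        by move: hu; rewrite zz hu' => -[->].
      by move=> [u z]; rewrite !inE /= => /andP[].
  move=> g c Pc; split => //= i pos; rewrite /vv.
  by case: (src i pos) => // u; rewrite !eqxx.
apply: (solves_route (J := (I2 * Pos)%type) (T := F)
    (dst := fun u _ z => if own z.2 == u then dst z.1 z.2 else None)
    (pay := fun u x z => \sum_i M z.1 i * x.2 i z.2)
    (exp := fun w _ u z => (own z.2 == u) && (dst z.1 z.2 == Some w))
    (h := fun w x r => h w x.1 (fun j pos => odflt 0 (r (own pos) (j, pos))))) => //.
  move=> g c Pc; split.
  - by move=> v u [i pos] /=; case: (_ == _).
  - move=> u; apply: leq_trans out_load.
    apply: leq_trans (_ : #|[pred z : I2 * Pos | own z.2 == u]| <= _)%N; last first.
      exact: (fiber I2 (fun pos => own pos == u) u).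
    by apply/subset_leq_card/subsetP => z; rewrite !inE; case: (_ == _).
  - move=> v; apply: leq_trans (dst_load v).
    apply: (leq_card_inj (f := snd)).
      by move=> [u z] [u' z']; rewrite !inE /= => /andP[/eqP <- _] /andP[/eqP <- _] ->.
    by move=> [u z]; rewrite !inE /= => /andP[].
move=> g c [Pc cE]; have := HQ _ _ Pc; congr (Q g); apply/funext => v.
congr h; apply/funext => j; apply/funext => pos; rewrite eqxx.
case: ifP => // _; apply: eq_bigr => i _; by rewrite cE.
Qed.

End LinearStage.

(** * Block products over a finite field, one layer per value *)

Section Product.
Variables (n : nat) (F : finFieldType) (f : nat).
Variables (R d1 d bk bn K W : nat).
Variables (u : 'I_R -> 'I_d1 -> 'I_d -> int) (v : 'I_R -> 'I_d -> 'I_d -> int).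
Variable (w : 'I_R -> 'I_d1 -> 'I_d -> int).
Hypothesis bilinear : forall i j i' x x' j',
  \sum_t w t i j * (u t i' x * v t x' j') =
    ((i' == i) && (x == x') && (j' == j))%:R.
Hypotheses (n1 : (1 < n)%N) (cF : (#|F| <= n.+1 ^ f)%N).
Variable a : nat.
Hypothesis labels :
  ((R + d * d + d1 * d) * ((bn + bk) * (bn + bk) * (2 * W)) <= n.+1 ^ a)%N.

Let n0 : (0 < n)%N := ltnW n1.
Let own (t : 'I_R) : 'I_n := owner n0 t.

Variable iN : 'I_n -> 'I_d * 'I_bn.
Variable iK : 'I_K -> 'I_d1 * 'I_bk.
Hypotheses (iN_inj : injective iN) (iK_inj : injective iK).

Definition blockB (B : 'I_n -> 'I_n -> 'I_W -> F) (z : 'I_d * 'I_d)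
    (p : 'I_bn * 'I_bn * 'I_W) : F :=
  if part_inv iN (z.2, p.1.2) is Some y then
    if part_inv iN (z.1, p.1.1) is Some x then B x y p.2 else 0 else 0.

(** The owner of product [t] stores its right linear form, evaluated on whole blocks; one
    preparation serves many left factors. *)
Definition prepared (B : 'I_n -> 'I_n -> 'I_W -> F)
    (pd : 'I_n -> 'I_R -> 'I_bn * 'I_bn * 'I_W -> F) : Prop :=
  forall t p, pd (own t) t p = \sum_z (v t z.1 z.2)%:~R * blockB B z p.

Lemma card_fiber (T : finType) x :
  (#|[pred z : 'I_R * T | Some (own z.1) == Some x]| <= (R %/ n + 1) * #|T|)%N.
Proof.
rewrite -(eq_card (A := predX [pred t | own t == x] predT)); last first.
  by move=> [? ?]; rewrite !inE andbT.
rewrite cardX leq_mul2r -[X in (_ <= X %/ n + 1)%N](card_ord R) card_owner orbT //.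
Qed.

Section Prepare.
Variable t : nat.
Hypotheses (tB1 : (d * bn * W <= n * t)%N)
  (tB2 : ((bn * bn * W %/ n + 1) * (d * d) <= n * t)%N)
  (tB3 : ((bn * bn * W %/ n + 1) * R <= n * t)%N)
  (tB4 : ((R %/ n + 1) * (bn * bn * W) <= n * t)%N).

Lemma solves_prepare (G X Y : Type) (P : G -> ('I_n -> X) -> Prop)
    (Q : G -> ('I_n -> Y) -> Prop) (b : 'I_n -> X -> 'I_n -> 'I_W -> F)
    (h : 'I_n -> X -> ('I_R -> 'I_bn * 'I_bn * 'I_W -> F) -> Y) :
  (forall g c pd, P g c -> prepared (fun x y k => b y (c y) x k) pd ->
     Q g (fun y => h y (c y) (pd y))) ->
  solves (route_cost n a f t + route_cost n a f t) P Q.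
Proof.
move=> H.
apply: (@solves_linear n F ('I_d * 'I_d)%type 'I_R ('I_bn * 'I_bn * 'I_W)%type
  a f t n1 cF _ _ (fun z p => part_inv iN (z.2, p.1.2)) (fun j _ => Some (own j))
  (fun j z => (v j z.1 z.2)%:~R) _ _ _ _ G X Y P Q
  (fun y x z p => if part_inv iN (z.1, p.1.1) is Some x' then b y x x' p.2 else 0) h).
- by rewrite !card_prod !card_ord; apply: leq_trans labels; nia.
- by rewrite !card_prod !card_ord; apply: leq_trans labels; nia.
- move=> y; apply: leq_trans tB1.
  apply: (@leq_trans #|{: 'I_d * 'I_bn * 'I_W}|); last by rewrite !card_prod !card_ord.
  apply: (leq_card_inj (f := fun z => (z.1.1, z.2.1.1, z.2.2))) => //.
  move=> [[a1 b1] [[i1 j1] w1]] [[a2 b2] [[i2 j2] w2]]; rewrite !inE /=.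
  by move=> /eqP/part_inv_some h1 /eqP/part_inv_some; rewrite h1 => -[-> ->] [-> -> ->].
- move=> y; apply: leq_trans (card_fiber _ y) _.
  by rewrite !card_prod !card_ord.
- by rewrite !card_prod !card_ord.
- by rewrite !card_prod !card_ord.
move=> g c Pc; apply: H => // t' p; rewrite eqxx; apply: eq_bigr => z _.
by rewrite /blockB; case: (part_inv _ _).
Qed.

End Prepare.

(** A layer is a power of an indeterminate: this is coefficient [m] of a product of matrices of
    polynomials of degree below [W], the usual encoding of min-plus products by exponents. *)
Definition conv (A : 'I_K -> 'I_n -> 'I_W -> F) (B : 'I_n -> 'I_n -> 'I_W -> F)
    (rho : 'I_K) (y : 'I_n) (m : 'I_(2 * W)) : F :=
  \sum_(k < W) \sum_(k' < W) \sum_x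
    (if (k + k' == m :> nat)%N then A rho x k * B x y k' else 0).

Definition blockA (A : 'I_K -> 'I_n -> 'I_W -> F) (z : 'I_d1 * 'I_d)
    (p : 'I_bk * 'I_bn * 'I_W) : F :=
  if part_inv iN (z.2, p.1.2) is Some x then
    if part_inv iK (z.1, p.1.1) is Some rho then A rho x p.2 else 0 else 0.

Lemma sum_delta (V : nmodType) (T : finType) (x0 : T) (g : T -> V) :
  \sum_x (if x == x0 then g x else 0) = g x0.
Proof. by rewrite -big_mkcond big_pred1_eq. Qed.

Lemma bilinear_sum (i0 : 'I_d1) (j0 : 'I_d) (p : 'I_d1 * 'I_d -> F)
    (q : 'I_d * 'I_d -> F) :
  \sum_t (w t i0 j0)%:~R * ((\sum_z (u t z.1 z.2)%:~R * p z) *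
    (\sum_z (v t z.1 z.2)%:~R * q z)) = \sum_x p (i0, x) * q (x, j0).
Proof.
transitivity (\sum_z \sum_z' (\sum_t w t i0 j0 * (u t z.1 z.2 * v t z'.1 z'.2))%:~R *
    (p z * q z')).
  under eq_bigr => t _ do rewrite big_distrlr /= big_distrr /=.
  rewrite exchange_big; apply: eq_bigr => z _ /=.
  under eq_bigr => t _ do rewrite big_distrr /=.
  rewrite exchange_big; apply: eq_bigr => z' _ /=.
  rewrite rmorph_sum big_distrl; apply: eq_bigr => t _ /=.
  by rewrite !rmorphM /=; ring.
transitivity (\sum_i \sum_x \sum_x' \sum_j
  (if (i, x, x', j) == (i0, x, x, j0) then p (i, x) * q (x', j) else 0)).
  rewrite [RHS]pair_bigA /=; apply: eq_bigr => -[i x] _.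
  rewrite [RHS]pair_bigA /=; apply: eq_bigr => -[x' j] _ /=.
  rewrite bilinear !xpair_eqE !eqxx andbT [x' == x]eq_sym.
  by case: (_ && _); rewrite ?mul1r // rmorph0 mul0r.
transitivity (\sum_i (if i == i0 then \sum_x p (i, x) * q (x, j0) else 0)); last exact: sum_delta.
apply: eq_bigr => i _; case: eqP => [->|ne]; last first.
  by rewrite !big1 // => *; rewrite !big1 // => *; rewrite big1 // => *; rewrite !xpair_eqE (negbTE (introN eqP ne)).
apply: eq_bigr => x _.
transitivity (\sum_x' (if x' == x then p (i0, x) * q (x', j0) else 0)); last exact: sum_delta.
apply: eq_bigr => x' _; case: eqP => [->|ne]; last first.
  by rewrite big1 // => *; rewrite !xpair_eqE (negbTE (introN eqP ne)) !andbF.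
rewrite -[RHS](sum_delta j0 (fun j => p (i0, x) * q (x, j))).
by apply: eq_bigr => j _; rewrite !xpair_eqE !eqxx.
Qed.

Section Multiply.
Variable t : nat.
Hypotheses (tA1 : (d1 * bk * (2 * W) <= n * t)%N)
  (tA2 : ((bk * bn * (2 * W) %/ n + 1) * (d1 * d) <= n * t)%N)
  (tA3 : ((bk * bn * (2 * W) %/ n + 1) * R <= n * t)%N)
  (tA4 : ((R %/ n + 1) * (bk * bn * (2 * W)) <= n * t)%N).

Lemma solves_multiply (G X Y : Type) (P : G -> ('I_n -> X) -> Prop)
    (Q : G -> ('I_n -> Y) -> Prop) (A : 'I_n -> X -> 'I_K -> 'I_W -> F)
    (pd : 'I_n -> X -> 'I_R -> 'I_bn * 'I_bn * 'I_W -> F)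
    (h : 'I_n -> X -> ('I_K -> 'I_(2 * W) -> F) -> Y) :
  (forall g c, P g c -> exists2 B, prepared B (fun y => pd y (c y)) &
     Q g (fun y => h y (c y) (fun rho m =>
       conv (fun rho x k => A x (c x) rho k) B rho y m))) ->
  solves (route_cost n a f t + route_cost n a f t +
          (route_cost n a f t + route_cost n a f t)) P Q.
Proof.
move=> H.
pose At c t p := \sum_z (u t z.1 z.2)%:~R * blockA (fun rho x k => A x (c x) rho k) z p.
pose mid g (c : 'I_n -> X * ('I_R -> 'I_bk * 'I_bn * 'I_W -> F)) :=
  P g (fun y => (c y).1) /\ forall t p, (c (own t)).2 t p = At (fun y => (c y).1) t p.
have le2 : (bk * bn * W %/ n <= bk * bn * (2 * W) %/ n)%N.
  by apply: leq_div2r; nia.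
apply: (@solves_seq _ _ _ _ _ _ _ _ mid).
  apply: (@solves_linear n F ('I_d1 * 'I_d)%type 'I_R ('I_bk * 'I_bn * 'I_W)%type
    a f t n1 cF _ _ (fun z p => part_inv iN (z.2, p.1.2)) (fun j _ => Some (own j))
    (fun j z => (u j z.1 z.2)%:~R) _ _ _ _ G X _ P mid
    (fun y x z p => if part_inv iK (z.1, p.1.1) is Some rho then A y x rho p.2 else 0)
    (fun y x r => (x, r))).
  - by rewrite !card_prod !card_ord; apply: leq_trans labels; nia.
  - by rewrite !card_prod !card_ord; apply: leq_trans labels; nia.
  - move=> y; apply: leq_trans (_ : d1 * bk * W <= _)%N; last by nia.
    apply: (@leq_trans #|{: 'I_d1 * 'I_bk * 'I_W}|); last by rewrite !card_prod !card_ord.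
    apply: (leq_card_inj (f := fun z => (z.1.1, z.2.1.1, z.2.2))) => //.
    move=> [[a1 b1] [[i1 j1] w1]] [[a2 b2] [[i2 j2] w2]]; rewrite !inE /=.
    by move=> /eqP/part_inv_some h1 /eqP/part_inv_some; rewrite h1 => -[-> ->] [-> -> ->].
  - move=> y; apply: leq_trans (card_fiber _ y) _.
    by rewrite !card_prod !card_ord; nia.
  - by rewrite !card_prod !card_ord; apply: leq_trans tA2; rewrite leq_mul2r leq_add2r le2 orbT.
  - by rewrite !card_prod !card_ord; apply: leq_trans tA3; rewrite leq_mul2r leq_add2r le2 orbT.
  move=> g c Pc; split => //= t' p; rewrite eqxx; apply: eq_bigr => z _.
  by rewrite /blockA; case: (part_inv _ _).
(* The owner of product [t] multiplies its two combined blocks as matrices of polynomials, by free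
   local computation. *)
pose loc (r : 'I_R -> 'I_bk * 'I_bn * 'I_W -> F)
    (q : 'I_R -> 'I_bn * 'I_bn * 'I_W -> F) t (p : 'I_bk * 'I_bn * 'I_(2 * W)) :=
  \sum_(k < W) \sum_(k' < W) \sum_i (if (k + k' == p.2 :> nat)%N then
     r t (p.1.1, i, k) * q t (i, p.1.2, k') else 0).
apply: (@solves_linear n F 'I_R ('I_d1 * 'I_d)%type ('I_bk * 'I_bn * 'I_(2 * W))%type
  a f t n1 cF _ _ (fun j _ => Some (own j)) (fun z p => part_inv iN (z.2, p.1.2))
  (fun z j => (w j z.1 z.2)%:~R) _ _ _ _ G _ Y mid Q
  (fun y x t p => loc x.2 (pd y x.1) t p)
  (fun y x r => h y x.1 (fun rho m =>
     r ((iK rho).1, (iN y).1) ((iK rho).2, (iN y).2, m)))).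
- by rewrite !card_prod !card_ord; apply: leq_trans labels; nia.
- by rewrite !card_prod !card_ord; apply: leq_trans labels; nia.
- move=> y; apply: leq_trans (card_fiber _ y) _.
  by rewrite !card_prod !card_ord.
- move=> y; apply: leq_trans tA1.
  apply: (@leq_trans #|{: 'I_d1 * 'I_bk * 'I_(2 * W)}|); last by rewrite !card_prod !card_ord.
  apply: (leq_card_inj (f := fun z => (z.1.1, z.2.1.1, z.2.2))) => //.
  move=> [[a1 b1] [[i1 j1] w1]] [[a2 b2] [[i2 j2] w2]]; rewrite !inE /=.
  by move=> /eqP/part_inv_some h1 /eqP/part_inv_some; rewrite h1 => -[-> ->] [-> -> ->].
- by rewrite !card_prod !card_ord.
- by rewrite !card_prod !card_ord.
move=> g c [Pc cE]; have [B Bp] := H _ _ Pc; congr (Q g).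
apply/funext => y; congr h; apply/funext => rho; apply/funext => m /=.
rewrite -surjective_pairing part_invK // eqxx /loc /conv; apply/esym.
under eq_bigr => t' _ do rewrite mulr_sumr.
rewrite exchange_big /=; apply: eq_bigr => k _.
under eq_bigr => t' _ do rewrite mulr_sumr.
rewrite exchange_big /=; apply: eq_bigr => k' _.
under eq_bigr => t' _ do rewrite mulr_sumr.
rewrite exchange_big /=; case: (k + k' == m :> nat)%N; last first.
  rewrite [RHS]big1 // big1 // => i _; rewrite big1 // => j _; exact: mulr0.
pose A0 rho x k := A x (c x).1 rho k.
transitivity (\sum_i \sum_x blockA A0 ((iK rho).1, x) ((iK rho).2, i, k) *
    blockB B (x, (iN y).1) (i, (iN y).2, k')).
  apply: eq_bigr => i _.
  under eq_bigr => t' _ do rewrite cE Bp.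
  exact: bilinear_sum.
rewrite exchange_big pair_bigA /= -[RHS](sum_part_inv _ iN_inj).
apply: eq_bigr => -[x i] _; rewrite /blockA /blockB /=.
rewrite -!surjective_pairing !part_invK //.
by case: (part_inv iN (x, i)) => [z|]; rewrite ?mul0r.
Qed.

Definition indicator (b : 'I_n -> 'I_n -> option 'I_W) (x y : 'I_n) (k : 'I_W) : F :=
  (b x y == Some k)%:R.

Definition is_minplus (al : 'I_n -> 'I_n -> option 'I_W) (b : 'I_n -> 'I_n -> option 'I_W)
    (out : 'I_n -> 'I_n -> option 'I_(2 * W)) : Prop :=
  (forall y s m, out y s = Some m -> exists x k k',
     [/\ al x s = Some k, b x y = Some k' & (m = k + k' :> nat)%N]) /\
  (forall x y s k k', al x s = Some k -> b x y = Some k' ->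
     exists2 m, out y s = Some m & (m <= k + k')%N).

Variable pt : 'I_n -> F.
Hypothesis pt_inj : injective pt.
Hypothesis natF : forall k, (0 < k <= n)%N -> k%:R != 0 :> F.

(** The conditions make [g] orthogonal to all polynomials of degree below [K] evaluated at the
    points [pt]. Testing with the product of ['X - pt s'] over the other points of [S] isolates
    [g s]. *)
Lemma vandermonde_unique (S : pred 'I_n) (g : 'I_n -> F) :
  (#|S| <= K)%N -> (forall s, ~~ S s -> g s = 0) ->
  (forall rho : 'I_K, \sum_s pt s ^+ rho * g s = 0) -> forall s, g s = 0.
Proof.
move=> SK gS H s; case: (boolP (S s)) => [Ss|/gS//].
have poly (q : {poly F}) : (size q <= K)%N -> \sum_s q.[pt s] * g s = 0.
  move=> sq; under eq_bigr => s' _ do rewrite (horner_coef_wide _ sq) mulr_suml.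
  rewrite exchange_big big1 // => rho _ /=.
  transitivity (q`_rho * (\sum_s pt s ^+ rho * g s)); last by rewrite H mulr0.
  by rewrite mulr_sumr; apply: eq_bigr => s' _; rewrite mulrA.
pose l := [seq pt s' | s' <- [seq s' <- enum 'I_n | S s' && (s' != s)]].
pose q := \prod_(z <- l) ('X - z%:P).
have ql s' : root q (pt s') = S s' && (s' != s).
  by rewrite root_prod_XsubC (mem_map pt_inj) mem_filter mem_enum andbT.
have := poly q; rewrite (bigD1 s) //= big1 ?addr0; last first.
  move=> s' ss'; case: (boolP (S s')) => [Ss'|/gS ->]; last exact: mulr0.
  by have := ql s'; rewrite Ss' ss' => /rootP ->; rewrite mul0r.
have -> : (size q <= K)%N.
  rewrite size_prod_XsubC size_map size_filter_enum; apply: leq_trans SK.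
  by rewrite (cardD1 s S) [s \in S]Ss add1n ltnS; apply/subset_leq_card/subsetP => s'; rewrite !inE andbC.
move=> /(_ isT)/eqP; rewrite mulf_eq0 => /orP[|/eqP//].
by rewrite -/(root q (pt s)) ql eqxx andbF.
Qed.

Definition hits (ox oy : option 'I_W) (m : nat) : bool :=
  match ox, oy with Some k, Some k' => (k + k' == m)%N | _, _ => false end.

Lemma conv_indicator (al b : 'I_n -> 'I_n -> option 'I_W) rho y m :
  conv (fun rho x k => \sum_s (if al x s == Some k then pt s ^+ rho else 0))
    (indicator b) rho y m =
  \sum_s pt s ^+ rho * #|[pred x | hits (al x s) (b x y) m]|%:R.
Proof.
transitivity (\sum_s \sum_x pt s ^+ rho * (hits (al x s) (b x y) m)%:R); last first.
  apply: eq_bigr => s _; rewrite -mulr_sumr -natr_sum; congr (_ * _%:R).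
  by rewrite -sum1_card [RHS]big_mkcond; apply: eq_bigr => x _; rewrite inE; case: hits.
have pointwise s x : \sum_(k < W) \sum_(k' < W) (if (k + k' == m :> nat)%N then
    (if al x s == Some k then pt s ^+ rho else 0) * (b x y == Some k')%:R else 0) =
    pt s ^+ rho * (hits (al x s) (b x y) m)%:R.
  case: (al x s) => [k0|] /=; last first.
    by rewrite mulr0n mulr0 big1 // => k _; rewrite big1 // => k' _; rewrite mul0r if_same.
  transitivity (\sum_(k < W) if k == k0 then \sum_(k' < W)
      if (k + k' == m :> nat)%N then pt s ^+ rho * (b x y == Some k')%:R else 0 else 0).
    apply: eq_bigr => k _; rewrite (inj_eq Some_inj) eq_sym; case: eqP => // _.
    by rewrite big1 // => k' _; rewrite mul0r if_same.
  rewrite sum_delta; case: (b x y) => [k1|] /=; last first.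
    by rewrite mulr0n mulr0 big1 // => k' _; case: ifP => // _; exact: mulr0.
  rewrite -[RHS](sum_delta k1 (fun k' : 'I_W => pt s ^+ rho * (k0 + k' == m :> nat)%N%:R)).
  apply: eq_bigr => k' _; rewrite (inj_eq Some_inj) [k1 == k']eq_sym.
  by case: (k' == k1); case: (_ == _); rewrite ?mulr1n ?mulr0n ?mulr0.
transitivity (\sum_s \sum_x \sum_(k < W) \sum_(k' < W) (if (k + k' == m :> nat)%N then
    (if al x s == Some k then pt s ^+ rho else 0) * (b x y == Some k')%:R else 0)); last first.
  by apply: eq_bigr => s _; apply: eq_bigr => x _; rewrite pointwise.
rewrite /conv exchange_big /=.
under eq_bigr => k' _ do rewrite exchange_big /=.
rewrite exchange_big /=; under [RHS]eq_bigr => s _ do under eq_bigr => x _ do rewrite exchange_big /=.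
rewrite [RHS]exchange_big; apply: eq_bigr => x _ /=.
rewrite [RHS]exchange_big; apply: eq_bigr => k' _ /=.
rewrite [RHS]exchange_big; apply: eq_bigr => k _ /=.
rewrite /indicator; case: ifP => // _; last by rewrite big1.
by rewrite mulr_suml.
Qed.

(** The linear system is solved by exhaustive search, local computation being free;
    [vandermonde_unique] makes the solution unique. *)
Definition decode_coef (S : pred 'I_n) (C : 'I_K -> 'I_(2 * W) -> F) (s : 'I_n)
    (m : 'I_(2 * W)) : F :=
  if [pick g : {ffun 'I_n -> F} | [forall s, ~~ S s ==> (g s == 0)] &&
      [forall rho : 'I_K, \sum_s pt s ^+ rho * g s == C rho m]] is Some g
  then g s else 0.

Definition decode (S : pred 'I_n) (C : 'I_K -> 'I_(2 * W) -> F) (s : 'I_n) :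
    option 'I_(2 * W) :=
  [pick m | (decode_coef S C s m != 0) &&
            [forall m', (decode_coef S C s m' != 0) ==> (m <= m')%N]].

(* The rows of the left factor are compressed into [K] combinations with
   Vandermonde coefficients; a vertex that knows a set of at most [K] rows
   containing all those that matter to it inverts its own linear system. *)
Lemma solves_relax (G X Y : Type) (P : G -> ('I_n -> X) -> Prop)
    (Q : G -> ('I_n -> Y) -> Prop) (al : 'I_n -> X -> 'I_n -> option 'I_W)
    (pd : 'I_n -> X -> 'I_R -> 'I_bn * 'I_bn * 'I_W -> F)
    (sup : 'I_n -> X -> pred 'I_n)
    (h : 'I_n -> X -> ('I_n -> option 'I_(2 * W)) -> Y) :
  (forall g c, P g c -> exists b, [/\ prepared (indicator b) (fun y => pd y (c y)),
     forall y, (#|sup y (c y)| <= K)%N,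
     forall x y s, al x (c x) s -> b x y -> sup y (c y) s &
     forall out, is_minplus (fun x => al x (c x)) b out ->
       Q g (fun y => h y (c y) (out y))]) ->
  solves (route_cost n a f t + route_cost n a f t +
          (route_cost n a f t + route_cost n a f t)) P Q.
Proof.
move=> H; apply: (solves_multiply
  (A := fun x z rho k => \sum_s (if al x z s == Some k then pt s ^+ rho else 0))
  (pd := pd) (h := fun y z C => h y z (decode (sup y z) C))) => g c Pc.
have [b [bp supK supP HQ]] := H _ _ Pc; exists (indicator b) => //.
apply: (HQ (fun y => decode (sup y (c y)) _)).
set al' := fun x => al x (c x).
pose cnt y s m := #|[pred x | hits (al' x s) (b x y) m]|.
(* A count of witnesses is at most [n], so by [natF] it vanishes in the field only when there is no
   witness. *)
have cntF y s m : (#|[pred x | hits (al' x s) (b x y) m]|%:R == 0 :> F) = (cnt y s m == 0%N).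
  rewrite -/(cnt y s m); case: (posnP (cnt y s m)) => [->|h0]; first by rewrite !eqxx.
  have := natF (k := cnt y s m); rewrite h0 (leq_trans (max_card _)) ?card_ord //.
  by move=> /(_ isT) /negbTE ->.
have dec y s : decode (sup y (c y)) (fun rho m => conv (fun rho x k =>
    \sum_s (if al x (c x) s == Some k then pt s ^+ rho else 0)) (indicator b) rho y m) s =
    [pick m : 'I_(2 * W) | (cnt y s m != 0%N) &&
      [forall m' : 'I_(2 * W), (cnt y s m' != 0%N) ==> (m <= m')%N]].
  have sol (m : 'I_(2 * W)) (s' : 'I_n) : ~~ sup y (c y) s' -> cnt y s' m = 0%N.
    move=> ns; apply: eq_card0 => x; rewrite !inE /hits.
    case E: (al' x s') => [k|//]; case E': (b x y) => [k'|//].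
    by move: ns; rewrite (supP x y s') // ?E' // -/(al' x s') E.
  rewrite /decode; set C := fun rho : 'I_K => _.
  have vE m : decode_coef (sup y (c y)) C s m = (cnt y s m)%:R.
    rewrite /decode_coef /C; case: pickP => [g' /andP[/forallP g0 /forallP gC]|no].
      apply/eqP; rewrite -subr_eq0; apply/eqP.
      apply: (@vandermonde_unique (sup y (c y)) (fun s => g' s - (cnt y s m)%:R) _ _ _ s) => //.
        by move=> s' ns; rewrite (eqP (implyP (g0 s') ns)) sol // subr0.
      move=> rho; under eq_bigr => s' _ do rewrite mulrBr.
      by rewrite sumrB (eqP (gC rho)) conv_indicator subrr.
    have := no [ffun s => (cnt y s m)%:R]; case/negP; apply/andP; split.
      by apply/forallP => s'; apply/implyP => ns; rewrite ffunE sol.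
    apply/forallP => rho; rewrite conv_indicator; apply/eqP; apply: eq_bigr => s' _.
    by rewrite ffunE.
  apply: eq_pick => m; rewrite vE cntF; congr (_ && _).
  by apply: eq_forallb => m'; rewrite vE cntF.
split=> [y s m|x y s k k' xk yk'].
  rewrite dec; case: pickP => // m0 /andP[c0 _] [<-].
  have /card_gt0P[x] : (0 < cnt y s m0)%N by rewrite lt0n.
  rewrite inE /hits; case E: (al' x s) => [k|//]; case E': (b x y) => [k'|//] /eqP kk.
  by exists x, k, k'.
have lt : (k + k' < 2 * W)%N by have := ltn_ord k; have := ltn_ord k'; lia.
have c0 : cnt y s (Ordinal lt) != 0%N.
  by rewrite -lt0n; apply/card_gt0P; exists x; rewrite inE /hits xk yk' /=.
rewrite dec; case: pickP => [m /andP[_ /forallP/(_ (Ordinal lt))]|].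
  by rewrite c0 => h0; exists m.
pose m1 := [arg min_(m < Ordinal lt | cnt y s m != 0%N) (m : nat)].
move=> /(_ m1); rewrite /m1; case: arg_minnP => // m mc mmin /negP[].
by rewrite mc; apply/forallP => m'; apply/implyP; exact: mmin.
Qed.

End Multiply.
End Product.

(** * Min-plus products *)

Section PrimeAbove.
Local Open Scope nat_scope.

(** Legendre's formula: index [k] contributes [m.*2 %/ p ^ k - 2 * (m %/ p ^ k)], which is at most
    1, and 0 once [p ^ k] exceeds [m.*2]. *)
Lemma logn_central_bin p m : prime p -> logn p 'C(m.*2, m) <= trunc_log p m.*2.
Proof.
move=> pp; have p1 := prime_gt1 pp.
have := bin_fact (leq_addr m m); rewrite addnn -addnn addnK addnn => /(congr1 (logn p)).
rewrite !lognM ?muln_gt0 ?fact_gt0 ?bin_gt0 //; last by rewrite -addnn leq_addr.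
rewrite !logn_fact // => E.
have ext : \sum_(1 <= k < m.*2.+1) m %/ p ^ k = \sum_(1 <= k < m.+1) m %/ p ^ k.
  rewrite (@big_cat_nat _ _ _ m.+1) //=; last by rewrite ltnS -addnn leq_addr.
  have -> : \sum_(m.+1 <= k < m.*2.+1) m %/ p ^ k = 0; last by rewrite addn0.
  rewrite big_nat big1 // => k /andP[mk _]; apply: divn_small.
  by apply: leq_trans mk _; exact/ltnW/ltn_expl.
have : \sum_(1 <= k < m.*2.+1) m.*2 %/ p ^ k <=
    \sum_(1 <= k < m.*2.+1) (2 * (m %/ p ^ k) + (k <= trunc_log p m.*2)).
  rewrite !big_nat; apply: leq_sum => k _.
  case: (leqP k (trunc_log p m.*2)) => hk.
    rewrite -mul2n; have pk : 0 < p ^ k by rewrite expn_gt0 ltnW.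
    rewrite -ltnS ltn_divLR //; have := ltn_ceil m pk; rewrite mulnC.
    by move: (m %/ p ^ k) => q; nia.
  rewrite divn_small ?leq0n //; apply: leq_trans (trunc_log_ltn _ p1) _.
  by rewrite leq_exp2l.
rewrite big_split -big_distrr /= ext.
have : \sum_(1 <= k < m.*2.+1) (k <= trunc_log p m.*2) <= trunc_log p m.*2.
  case: (posnP m.*2) => [->|h]; first by rewrite big_geq.
  have tl : trunc_log p m.*2 < m.*2.+1.
    by rewrite ltnS; apply: leq_trans (ltnW (ltn_expl _ p1)) _; exact: trunc_logP.
  rewrite (@big_cat_nat _ _ _ (trunc_log p m.*2).+1) //=.
  have -> : \sum_((trunc_log p m.*2).+1 <= k < m.*2.+1)
      (k <= trunc_log p m.*2) = 0.
    by rewrite big_nat big1 // => k /andP[hk _]; rewrite leqNgt hk.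
  rewrite addn0.
  apply: leq_trans (_ : \sum_(1 <= k < (trunc_log p m.*2).+1) 1 <= _).
    by apply: leq_sum => k _; exact: leq_b1.
  by rewrite sum_nat_const_nat muln1 subn1.
by lia.
Qed.

Lemma central_bin_ge m : 2 ^ m <= 'C(m.*2, m).
Proof.
elim: m => // m IH; rewrite doubleS binS expnS mul2n -addnn leq_add //.
  by apply: leq_trans IH _; rewrite binS leq_addl.
by apply: leq_trans IH _; apply: leq_bin2l.
Qed.

(** Erdos's argument: prime powers in the central binomial are at most [m.*2], so without primes
    above [n] the coefficient, at least [2 ^ m], would be at most [m.*2 ^ n.+1]. The choice
    [m.*2 = 2 ^ (2 * lg n + 4)] excludes this, and a field element fits into 8 digits. *)
Lemma exists_prime n : 1 < n -> exists p, [/\ prime p, n < p & p <= n.+1 ^ 8].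
Proof.
move=> n1; set s := (2 * lg n + 4); pose m := 2 ^ s.-1.
have m2 : m.*2 = 2 ^ s by rewrite /m -mul2n -expnS /s addnS.
have C0 : 0 < 'C(m.*2, m) by rewrite bin_gt0 -addnn leq_addr.
have logC p : prime p -> p ^ logn p 'C(m.*2, m) <= m.*2.
  move=> pp; apply: leq_trans (_ : p ^ trunc_log p m.*2 <= _).
    by rewrite leq_exp2l ?prime_gt1 // logn_central_bin.
  by apply: trunc_logP; rewrite ?prime_gt1 // m2 expn_gt0.
case: (pselect (exists p, [/\ prime p, n < p & p %| 'C(m.*2, m)])) => [[p [pp np pd]]|no].
  exists p; split=> //; apply: leq_trans (_ : m.*2 <= _).
    apply: leq_trans (logC p pp); rewrite -{1}(expn1 p) leq_exp2l ?prime_gt1 //.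
    by rewrite logn_gt0 mem_primes pp C0.
  have h2 : 2 ^ lg n <= 2 * n.
    by rewrite /lg expnS leq_mul2l /=; apply: trunc_logP => //; exact: ltnW.
  rewrite m2 /s expnD [2 * _]mulnC expnM expnS expn1.
  apply: leq_trans (_ : (2 * n) * (2 * n) * 2 ^ 4 <= _).
    by rewrite leq_mul2r; apply/orP; right; exact: leq_mul.
  rewrite -[8]/(2 + 6) expnD; apply: leq_trans (_ : n.+1 ^ 2 * 3 ^ 6 <= _).
    by rewrite [n.+1 ^ 2]expnS expn1; have -> : 3 ^ 6 = 729 by []; have -> : 2 ^ 4 = 16 by []; nia.
  by rewrite leq_mul2l leq_expl ?orbT.
exfalso; have : 2 ^ m <= m.*2 ^ n.+1.
  apply: leq_trans (central_bin_ge m) _.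
  rewrite -[X in X <= _](partnT C0) /partn.
  apply: leq_trans (_ : \prod_(0 <= p < n.+1) m.*2 <= _); last first.
    by rewrite prod_nat_const_nat subn0.
  have big1C p : n < p -> p ^ logn p 'C(m.*2, m) = 1.
    move=> np; case: (posnP (logn p 'C(m.*2, m))) => [->//|].
    rewrite logn_gt0 mem_primes => /and3P[pp _ pd].
    by case: no; exists p.
  have le p : p ^ logn p 'C(m.*2, m) <= m.*2.
    case: (boolP (prime p)) => [/logC//|np].
    by rewrite lognE (negbTE np) /= m2 expn_gt0.
  case: (leqP n 'C(m.*2, m)) => hn.
    rewrite (@big_cat_nat _ _ _ n.+1) //= [X in _ * X]big_nat_cond [X in _ * X]big1 ?muln1.
      by apply: leq_prod => p _; exact: le.
    by move=> p /andP[/andP[np _] _]; exact: big1C.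
  apply: leq_trans (_ : \prod_(0 <= p < 'C(m.*2, m).+1) m.*2 <= _).
    by apply: leq_prod => p _; exact: le.
  by rewrite !prod_nat_const_nat !subn0 leq_pexp2l ?leqW // m2 expn_gt0.
rewrite m2 -expnM leq_exp2l // leqNgt => /negP[].
have h1 := ltn_lg n.
have h3 : (2 * lg n + 4) < 2 ^ (lg n + 3).
  rewrite expnD; have := ltn_expl (lg n) (isT : 1 < 2).
  by move: (2 ^ lg n) => q; have -> : 2 ^ 3 = 8 by []; lia.
rewrite /m /s; have -> : (2 * lg n + 4).-1 = lg n + (lg n + 3) by lia.
rewrite expnD mulnC; apply: leq_ltn_trans (_ : 2 ^ lg n * (2 * lg n + 4) < _).
  by rewrite leq_mul2r h1 orbT.
by rewrite ltn_pmul2l // expn_gt0.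
Qed.

End PrimeAbove.

(** * Distances in weighted graphs *)

Section Distances.
Local Open Scope nat_scope.
Variables (n : nat) (G : wgraph n).
Implicit Types (u v x y : 'I_n) (p q : seq 'I_n).

Definition connected u v : Prop := exists p, path (edge G) u p /\ last u p = v.

Lemma walk_weight_cat u p q :
  walk_weight G u (p ++ q) = walk_weight G u p + walk_weight G (last u p) q.
Proof. by elim: p u => //= v p IH u; rewrite IH addnA. Qed.

Lemma edge_sym u v : edge G u v = edge G v u.
Proof. by rewrite /edge wadj_sym. Qed.

Lemma rev_walk u p : path (edge G) u p -> exists q,
  [/\ path (edge G) (last u p) q, last (last u p) q = u &
      walk_weight G (last u p) q = walk_weight G u p].
Proof.
elim: p u => [|v p IH] u /=; first by exists [::].
move=> /andP[uv /IH[q [pq lq wq]]]; exists (rcons q u).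
rewrite rcons_path pq lq last_rcons edge_sym uv; split=> //.
by rewrite -cats1 walk_weight_cat wq lq /= addn0 wadj_sym addnC.
Qed.

Lemma connected_refl u : connected u u.
Proof. by exists [::]. Qed.

Lemma connected_sym u v : connected u v -> connected v u.
Proof. by move=> [p [/rev_walk[q [pq lq _]] <-]]; exists q. Qed.

Lemma connected_trans v u x : connected u v -> connected v x -> connected u x.
Proof.
move=> [p [pp <-]] [q [pq <-]]; exists (p ++ q).
by rewrite cat_path pp pq last_cat.
Qed.

(** Natural-valued distance with default 0 for disconnected vertices, so statements carry
    [connected] separately. *)
Definition dn u v : nat :=
  match pselect (exists D, `[< exists p, [/\ path (edge G) u p, last u p = v &
     walk_weight G u p = D] >]) with
  | left h => ex_minn h
  | right _ => 0
  end.

Lemma dn_walk u v : connected u v -> exists p,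
  [/\ path (edge G) u p, last u p = v & walk_weight G u p = dn u v].
Proof.
move=> [p [pp lp]]; rewrite /dn; case: pselect => [h|[]].
  by case: ex_minnP => D /asboolP[q [? ? ?]] _; exists q.
by exists (walk_weight G u p); apply/asboolP; exists p.
Qed.

Lemma dn_le u p : path (edge G) u p -> dn u (last u p) <= walk_weight G u p.
Proof.
move=> pp; rewrite /dn; case: pselect => // h.
by case: ex_minnP => D _; apply; apply/asboolP; exists p.
Qed.

Lemma dn_disconnected u v : ~ connected u v -> dn u v = 0.
Proof.
move=> no; rewrite /dn; case: pselect => // h; exfalso.
by case: h => D /asboolP[p [pp lp _]]; apply: no; exists p.
Qed.

Lemma dn_self u : dn u u = 0.
Proof. by apply/eqP; rewrite -leqn0 (@dn_le u [::]). Qed.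

Lemma dn_sym u v : dn u v = dn v u.
Proof.
wlog: u v / dn v u <= dn u v => [H|le].
  by case/orP: (leq_total (dn u v) (dn v u)) => /H.
apply/eqP; rewrite eqn_leq le andbT.
case: (pselect (connected v u)) => [/dn_walk[p [pp <- <-]]|no].
  have [q [pq lq <-]] := rev_walk pp.
  by have := dn_le pq; rewrite lq.
by rewrite (@dn_disconnected u v) // => /connected_sym.
Qed.

Lemma dn_tri v u x : connected u v -> connected v x -> dn u x <= dn u v + dn v x.
Proof.
move=> /dn_walk[p [pp lp <-]] /dn_walk[q [pq <- <-]].
have := @dn_le u (p ++ q); rewrite cat_path pp last_cat walk_weight_cat lp.
exact.
Qed.

Lemma edge_connected u v w : wadj G u v = Some w -> connected u v.
Proof. by move=> E; exists [:: v]; rewrite /= /edge E. Qed.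

Lemma edge_dn u v w : wadj G u v = Some w -> dn u v <= w.
Proof.
move=> E; have := @dn_le u [:: v]; rewrite /= /edge E addn0; exact.
Qed.

Definition shortest u p := path (edge G) u p /\ walk_weight G u p = dn u (last u p).

Lemma shortest_cat u p q : shortest u (p ++ q) ->
  shortest u p /\ shortest (last u p) q.
Proof.
move=> []; rewrite cat_path last_cat walk_weight_cat => /andP[pp pq] E.
have h1 := dn_le pp; have h2 := dn_le pq.
have h3 : dn u (last (last u p) q) <= dn u (last u p) + dn (last u p) (last (last u p) q).
  by apply: dn_tri; [exists p|exists q].
by split; split=> //; lia.
Qed.

Lemma shortest_dist u p q : shortest u (p ++ q) ->
  dn u (last u (p ++ q)) = dn u (last u p) + dn (last u p) (last u (p ++ q)).
Proof.
move=> h; have [_ E0] := h; have [[_ E1] [_ E2]] := shortest_cat h.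
by rewrite -E0 -E1 last_cat -E2 walk_weight_cat.
Qed.

Lemma aligned_prefix s x u v : connected s x -> connected x u -> connected u v ->
  dn s v = dn s x + dn x v -> dn x v = dn x u + dn u v ->
  dn s u = dn s x + dn x u /\ dn s v = dn s u + dn u v.
Proof.
move=> sx xu uv h1 h2; have := dn_tri sx xu; have := dn_tri (connected_trans sx xu) uv.
lia.
Qed.

Lemma shortest_edge u v : shortest u [:: v] -> wadj G u v = Some (dn u v).
Proof.
move=> [] /=; rewrite /edge; case: wadj => //= w _.
by rewrite addn0 => ->.
Qed.

Lemma shortest_walk u v : connected u v -> exists2 p, shortest u p & last u p = v.
Proof. by move=> /dn_walk[p [pp lp wp]]; exists p => //; split; rewrite ?lp. Qed.

Lemma walk_weight_gt0 u v p : path (edge G) u (v :: p) -> 0 < walk_weight G u (v :: p).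
Proof.
rewrite /= /edge; case E: wadj => [w|//] _ /=.
by rewrite addn_gt0 (wadj_pos E).
Qed.

(** A repeated vertex would enclose a closed piece of the walk, of weight 0 by minimality, whereas
    weights are positive. *)
Lemma shortest_uniq u p : shortest u p -> uniq (u :: p).
Proof.
move=> sp; apply/(uniqP u) => i j.
wlog ij : i j / i < j.
  move=> H ip jp; case: (ltngtP i j) => // ij E; first exact: H.
  by apply/esym; apply: H.
rewrite !inE /= !ltnS => ip jp; have nthE k : k <= size p -> nth u (u :: p) k = last u (take k p).
  by case: k => [|k] kp; rewrite ?take0 //= -nth_last size_take_min (minn_idPl kp) /= nth_take //;
    exact: set_nth_default.
rewrite !nthE // => E; exfalso.
have [] := @shortest_cat u (take j p) (drop j p); first by rewrite cat_take_drop.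
move=> + _; rewrite -{1}(cat_take_drop i (take j p)) -take_min (minn_idPl (ltnW ij)) => sj.
have lq : last (last u (take i p)) (drop i (take j p)) = last u (take i p).
  by rewrite -last_cat -{1}(minn_idPl (ltnW ij)) take_min cat_take_drop E.
have [_ [pq wq]] := shortest_cat sj; move: pq wq; rewrite lq dn_self.
have : size (drop i (take j p)) = j - i by rewrite size_drop size_takel.
case: (drop i (take j p)) => [/eqP|y q _ /walk_weight_gt0 + E0]; last by rewrite E0.
by rewrite eq_sym subn_eq0 leqNgt ij.
Qed.

Lemma shortest_size u p : shortest u p -> size p < n.
Proof.
move=> /shortest_uniq up; apply: (@leq_trans #|'I_n|); last by rewrite card_ord.
by rewrite -[(size p).+1]/(size (u :: p)) -(card_uniqP up) max_card.
Qed.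

Lemma dn_gt0 u v : connected u v -> u != v -> 0 < dn u v.
Proof.
move=> /shortest_walk[[|x p] sp <-]; first by rewrite eqxx.
by case: sp => /walk_weight_gt0 + <-.
Qed.

Lemma dn_le_weights M u v : weights_le G M -> dn u v <= n * M.
Proof.
move=> GM; case: (pselect (connected u v)) => [/shortest_walk[p sp <-]|no]; last by rewrite dn_disconnected.
case: (sp) => pp <-; apply: leq_trans (_ : size p * M <= _).
  elim: p u pp {sp} => //= x p IH u /andP[ux px]; rewrite mulSn leq_add ?IH //.
  by move: ux; rewrite /edge; case E: wadj => [w|] // _; exact: GM E.
by rewrite leq_mul2r ltnW ?orbT // (shortest_size sp).
Qed.

End Distances.

(** * Scaling the weights, so that windows and rounding units are integers *)

Section Scaling.
Local Open Scope nat_scope.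
Variables (n : nat) (G : wgraph n) (L : nat).
Hypothesis L0 : 0 < L.

Let sadj (u v : 'I_n) := omap (muln L) (wadj G u v).

Lemma scaled_sym u v : sadj u v = sadj v u.
Proof. by rewrite /sadj wadj_sym. Qed.

Lemma scaled_irrefl u : sadj u u = None.
Proof. by rewrite /sadj wadj_irrefl. Qed.

Lemma scaled_pos u v w : sadj u v = Some w -> 0 < w.
Proof.
by rewrite /sadj; case E: wadj => [w'|] //= [<-]; rewrite muln_gt0 L0 (wadj_pos E).
Qed.

Definition scaled : wgraph n := WGraph scaled_sym scaled_irrefl scaled_pos.

Lemma scaled_edge : edge scaled =2 edge G.
Proof. by move=> u v; rewrite /edge /= /sadj; case: wadj. Qed.

Lemma scaled_weight u p : walk_weight scaled u p = L * walk_weight G u p.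
Proof.
elim: p u => [|v p IH] u; first by rewrite muln0.
by rewrite /= IH mulnDr /sadj; case: wadj => //=; rewrite muln0.
Qed.

Lemma scaled_connected u v : connected scaled u v <-> connected G u v.
Proof.
by split=> -[p [pp lp]]; exists p; split=> //; move: pp; rewrite (eq_path scaled_edge).
Qed.

Lemma scaled_dn u v : dn scaled u v = L * dn G u v.
Proof.
case: (pselect (connected G u v)) => [cuv|no]; last first.
  by rewrite !dn_disconnected ?muln0 // => /scaled_connected.
have [p [pp lp wp]] := dn_walk cuv.
have [q [pq lq wq]] := dn_walk ((scaled_connected u v).2 cuv).
apply/eqP; rewrite eqn_leq -wp -{2}wq -!scaled_weight; apply/andP; split.
  by rewrite -lp; apply: dn_le; rewrite (eq_path scaled_edge).
rewrite !scaled_weight leq_mul2l wp -lq; apply/orP; right.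
by apply: dn_le; rewrite -(eq_path scaled_edge).
Qed.

End Scaling.

Lemma dist_dn (R : realType) n (G : wgraph n) u v :
  connected G u v -> dist R G u v = ((dn G u v)%:R)%:E.
Proof.
move=> cuv; apply/eqP; rewrite eq_le; apply/andP; split.
  have [p [pp lp <-]] := dn_walk cuv.
  by apply: ereal_inf_lbound; exists p.
apply: le_ereal_inf_tmp => _ [p [pp lp] <-].
by rewrite lee_fin ler_nat -lp dn_le.
Qed.

Lemma dist_infty (R : realType) n (G : wgraph n) u v :
  ~ connected G u v -> dist R G u v = +oo%E.
Proof.
move=> no; rewrite /dist; set A := (X in ereal_inf X).
have -> : A = classical_sets.set0.
  by apply/seteqP; split=> // x h; exfalso; case: h => p [pp lp] _; apply: no; exists p.
exact: ereal_inf0.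
Qed.

(** * Sweeping a distance scale *)

Section Estimates.
Local Open Scope nat_scope.
Variable n : nat.

Definition table := 'I_n -> 'I_n -> option nat.

Definition est (E : table) s x B : Prop := exists2 e, E s x = Some e & e <= B.

Definition improves (E E' : table) : Prop :=
  forall s x B, est E s x B -> est E' s x B.

Lemma est_le E s x B B' : est E s x B -> B <= B' -> est E s x B'.
Proof. by move=> [e h le] le'; exists e => //; apply: leq_trans le'. Qed.

Lemma improves_refl E : improves E E.
Proof. by []. Qed.

Lemma improves_trans E2 E1 E3 : improves E1 E2 -> improves E2 E3 -> improves E1 E3.
Proof. by move=> h1 h2 s x B /h1 /h2. Qed.

End Estimates.

Section Sweep.
Local Open Scope nat_scope.
Variables (n : nat) (G : wgraph n) (Q A : pred 'I_n) (aw : table n).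
Variables (l0 u0 M C J : nat) (theta : 'I_n -> nat).
Variable near : nat -> nat -> 'I_n -> 'I_n -> bool.
Let D := M * l0.
Hypotheses (l00 : 0 < l0) (l0E : l0 = 8 * M * u0) (M4 : 4 <= M) (MJ : M <= 2 ^ J).

Hypothesis aw_sound : forall x y w, aw x y = Some w -> connected G x y /\ dn G x y <= w.
Hypothesis aw_edge : forall x y w, wadj G x y = Some w -> est aw x y w.

Definition ball_exact x : Prop := forall u, connected G x u -> u != x ->
  dn G x u <= l0 -> aw x u = Some (dn G x u).

Definition near_hub x b : Prop := [/\ A b, connected G x b, dn G x b <= l0 &
  b = x \/ aw x b = Some (dn G x b)].

Hypothesis good_or_bad : forall x, (exists b, near_hub x b) \/ ball_exact x.
Hypothesis hubs_sources : forall b, A b -> Q b.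

Hypothesis near_complete : forall j t s x, Q s -> connected G s x ->
  dn G s x <= 2 * D -> t * l0 <= dn G s x + (theta s + 4 * 2 ^ j) * l0 ->
  dn G s x + theta s * l0 <= (t + 4 * 2 ^ j) * l0 -> near j t s x.

(* A longer edge tolerates a coarser rounding: class [j] is rounded to multiples
   of [2 ^ j * u0] and relaxed only every [2 ^ j] time steps. *)
Definition in_class j w : bool :=
  (w <= 4 * 2 ^ j * l0) && ((j == 0) || (2 * 2 ^ j * l0 < w)).

(** Relaxation is promised only near the front of [s]: the vertex is at most [4 * 2 ^ j] windows
    behind it and its estimate at most [(C - 4) * 2 ^ j] windows ahead. The loss [2 * 2 ^ j * u0] is
    one rounding of each factor. *)
Definition relaxes t j (E E' : table n) : Prop :=
  forall s x y w B, Q s -> near j t s x ->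
    t * l0 <= dn G s x + (theta s + 4 * 2 ^ j) * l0 ->
    est E s x B -> B + (theta s + 4 * 2 ^ j) * l0 <= (t + C * 2 ^ j) * l0 ->
    aw x y = Some w -> in_class j w -> est E' s y (B + w + 2 * 2 ^ j * u0).

(** Two relaxations of class 0 allow a ball hop followed by a short edge within one step; the longer
    classes due at time [t] also start after the ball hop. *)
Definition macro_step t (E E' : table n) : Prop :=
  exists E1 E2, [/\ improves E E1, relaxes t 0 E E1, improves E1 E2,
    relaxes t 0 E1 E2 & improves E2 E' /\
    forall j, 0 < j <= J -> 2 ^ j %| t -> exists E3 E4,
      [/\ improves E2 E3, relaxes t j E3 E4 & improves E4 E']].

Variables (E : nat -> table n) (Tmax : nat).
Hypothesis steps : forall t, t < Tmax -> macro_step t (E t) (E t.+1).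

Lemma improves_steps t t' : t <= t' -> t' <= Tmax -> improves (E t) (E t').
Proof.
move=> le; rewrite -(subnKC le); elim: (t' - t) => [|k IH] h.
  by rewrite addn0; exact: improves_refl.
rewrite addnS; apply: (improves_trans (IH _)); first by lia.
have [E1 [E2 [h1 _ h2 _ [h3 _]]]] := steps (t := t + k) ltac:(lia).
exact: improves_trans (improves_trans h1 h2) h3.
Qed.

Lemma aw_exact x y : shortest G x [:: y] -> aw x y = Some (dn G x y).
Proof.
move=> /shortest_edge xy; have [w aE le] := aw_edge xy.
have [_ ge] := aw_sound aE; rewrite aE; congr Some; apply/eqP.
by rewrite eqn_leq le.
Qed.

Lemma class_exists w : w <= 2 * D -> exists2 j, j <= J & in_class j w.
Proof.
move=> wD; have ex : exists j, w <= 4 * 2 ^ j * l0.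
  exists J; apply: leq_trans wD _; rewrite /D; nia.
case: (ex_minnP ex) => j jw jmin; exists j.
  apply: jmin; apply: leq_trans wD _; rewrite /D; nia.
rewrite /in_class jw /=; case: j jw jmin => //= j jw jmin.
rewrite ltnNge; apply/negP => h; have := jmin j; rewrite ltnn => /implyP.
by rewrite implybF => /negP[]; apply: leq_trans h _; rewrite expnS; lia.
Qed.

Section Source.
Variables (s : 'I_n) (Err : nat).
(** The front of [s] starts after the delay [theta s] and crosses one window per step; [bound]
    charges [4 * u0] per window on top of the inherited error [Err]. *)
Definition time x := theta s + dn G s x %/ l0.
Definition bound x := dn G s x + Err + 4 * u0 * (dn G s x %/ l0).
Let dnt x : dn G s x < (dn G s x %/ l0).+1 * l0.
Proof. exact: ltn_ceil. Qed.
Let dnt' x : (dn G s x %/ l0) * l0 <= dn G s x.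
Proof. exact: leq_divM. Qed.

(** Origin of [l0 = 8 * M * u0]: a distance [2 * D] spans [2 * M] windows, whose rounding charges
    add up to a single window, a relative error of order [1 / M]. *)
Lemma rounding_small x : dn G s x <= 2 * D -> 4 * u0 * (dn G s x %/ l0) <= l0.
Proof.
move=> h; have : dn G s x %/ l0 <= 2 * M.
  by rewrite -[2 * M](mulnK _ l00) leq_div2r // /D -mulnA.
move=> h2; rewrite {2}l0E; nia.
Qed.

Lemma bound_le x y : dn G s x <= dn G s y ->
  bound x + (dn G s y - dn G s x) <= bound y.
Proof.
move=> h; rewrite /bound; have := leq_div2r l0 h => /(leq_mul (leqnn (4 * u0))).
lia.
Qed.

Hypothesis Qs : Q s.
Hypothesis time_max : forall x, connected G s x -> dn G s x <= 2 * D -> time x + 4 <= Tmax.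
Hypothesis ErrC : Err + 12 * l0 <= C * l0.

Lemma ball_hop x v t B : connected G s x -> dn G s x <= 2 * D ->
  time x <= t <= time x + 2 -> est (E t) s x B -> B + 8 * l0 <= dn G s x + C * l0 ->
  (v = x \/ aw x v = Some (dn G x v)) -> dn G x v <= l0 ->
  est (E t.+1) s v (B + dn G x v + 2 * u0).
Proof.
move=> cx dx /andP[t1 t2] ex BC av dv.
have tT : t < Tmax by have := time_max cx dx; lia.
have [tl1 tl2 tE] : [/\ time x * l0 <= t * l0, t * l0 <= time x * l0 + 2 * l0 &
    time x * l0 = theta s * l0 + dn G s x %/ l0 * l0].
  split; [by rewrite leq_mul2r t1 orbT | by rewrite -mulnDl leq_mul2r t2 orbT |].
  by rewrite /time mulnDl.
have := dnt x; have := dnt' x; rewrite mulSn => lo hi.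
have [E1 [E2 [i1 r1 i2 r2 [i3 _]]]] := steps tT.
have lift y b : est E1 s y b -> est (E t.+1) s y b by move=> /i2 /i3.
case: av => [->|av]; first by rewrite dn_self; apply: est_le (lift _ _ (i1 _ _ _ ex)) _; lia.
apply: lift; have := r1 s x v _ B Qs; rewrite !expn0 !muln1; apply => //.
- by apply: near_complete => //; rewrite expn0; lia.
- by lia.
- by lia.
- by rewrite /in_class /= expn0 andbT; lia.
Qed.

(** A ball hop to [u], then the edge to [u']. An edge of class [j > 0] waits for a multiple of
    [2 ^ j] and loses [2 * 2 ^ j * u0], but it crosses at least [2 * 2 ^ j] windows, whose charges
    pay for this. The alternative on [t] ensures that the front has not passed [u']. *)
Lemma edge_hop x u u' t B :
  connected G s x -> time x <= t <= time x + 1 -> est (E t) s x B ->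
  B + 8 * l0 <= dn G s x + C * l0 -> dn G s u' <= 2 * D ->
  connected G x u -> u = x \/ aw x u = Some (dn G x u) -> dn G x u <= l0 ->
  dn G s u = dn G s x + dn G x u -> connected G u u' ->
  aw u u' = Some (dn G u u') -> dn G s u' = dn G s u + dn G u u' ->
  (t = time x \/ dn G s x + l0 <= dn G s u') ->
  est (E (time u').+1) s u'
    (B + (dn G s u' - dn G s x) + 4 * u0 * maxn 1 (time u' - time x)).
Proof.
move=> cx /andP[t1 t2] ex BC du' cxu axu dxu dsu cuu' auu' dsu' far.
have csu := connected_trans cx cxu; have csu' := connected_trans csu cuu'.
have dx : dn G s x <= 2 * D by lia.
have wD : dn G u u' <= 2 * D by lia.
have [tl1 tl2 tE] : [/\ time x * l0 <= t * l0, t * l0 <= time x * l0 + l0 &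
    time x * l0 = theta s * l0 + dn G s x %/ l0 * l0].
  split; [by rewrite leq_mul2r t1 orbT | by rewrite -mulSnr leq_mul2r -addn1 t2 orbT |].
  by rewrite /time mulnDl.
have := dnt x; have := dnt' x; rewrite mulSn => lo hi.
have mul_le a b : a <= b -> a * l0 <= b * l0 by move=> h; rewrite leq_mul2r h orbT.
have div_ge k : dn G s x + k * l0 <= dn G s u' -> time x + k <= time u'.
  by move=> h; rewrite /time -addnA leq_add2l leq_divRL // mulnDl; move: (dnt' x); lia.
have time_le : time x <= time u'.
  by have := div_ge 0; rewrite mul0n !addn0; apply; lia.
have tu' : t <= time u'.
  by case: far => [->//|far]; have := div_ge 1; rewrite mul1n; lia.
have tT : t < Tmax by have := time_max cx dx; lia.
have [E1 [E2 [i1 r1 i2 r2 [i3 r3]]]] := steps tT.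
have e1u : est E1 s u (B + dn G x u + 2 * u0).
  case: axu => [ux|axu].
    by rewrite ux dn_self; apply: est_le (i1 _ _ _ ex) _; lia.
  have := r1 s x u _ B Qs; rewrite !expn0 !muln1; apply => //.
  - by apply: near_complete => //; rewrite expn0; lia.
  - by lia.
  - by lia.
  - by rewrite /in_class /= expn0 andbT; lia.
have u0l : 8 * u0 <= l0 by rewrite l0E; nia.
have [j jJ cj] := class_exists wD.
case: (posnP j) => [j0|j0].
  have : est E2 s u' (B + dn G x u + 2 * u0 + dn G u u' + 2 * u0).
    have := r2 s u u' _ (B + dn G x u + 2 * u0) Qs; rewrite !expn0 !muln1; apply => //.
    - by apply: near_complete => //; rewrite ?expn0; lia.
    - by lia.
    - by lia.
    - by rewrite -j0.
  move=> /i3 h.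
  have := improves_steps (_ : t.+1 <= (time u').+1) _ h; move=> /(_ tu').
  have tm : (time u').+1 <= Tmax by have := time_max csu' du'; lia.
  move=> /(_ tm) h'; apply: est_le h' _.
  have : 1 <= maxn 1 (time u' - time x) by rewrite leq_maxl.
  by move: (maxn _ _) => m hm; have := leq_mul2l u0 1 m; rewrite hm orbT; lia.
have /andP[cj1] := cj; rewrite (gtn_eqF j0) /= => cj2.
have p0 : 0 < 2 ^ j by rewrite expn_gt0.
have tj : time x + 2 * 2 ^ j <= time u' by apply: div_ge; lia.
(* The first multiple of [2 ^ j] not before [t]; it precedes [time u'] because of the length of the
   edge. *)
pose t' := (t + 2 ^ j - 1) %/ 2 ^ j * 2 ^ j.
have t'1 : t <= t'.
  have := ltn_ceil (t + 2 ^ j - 1) p0; rewrite mulSn /t'; lia.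
have t'2 : t' <= t + 2 ^ j - 1 by exact: leq_divM.
have t'u : t' < time u' by lia.
have t'T : t' < Tmax by have := time_max csu' du'; lia.
have e2u : est (E t') s u (B + dn G x u + 2 * u0) \/ t' = t.
  case: (ltngtP t' t) => [|h|->]; [by lia | left | by right].
  by apply: (improves_steps (t := t.+1)) => //; [lia | exact/i3/i2].
have [E1' [E2' [i1' r1' i2' r2' [i3' r3']]]] := steps t'T.
have : est (E t'.+1) s u' (B + dn G x u + 2 * u0 + dn G u u' + 2 * 2 ^ j * u0).
  have tl3 : t' * l0 + l0 <= t * l0 + 2 ^ j * l0.
    by rewrite -{2}[l0]mul1n -!mulnDl; apply: mul_le; lia.
  have tl4 : t * l0 <= t' * l0 by exact: mul_le.
  have tl5 : l0 <= 2 ^ j * l0 by rewrite leq_pmull.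
  have C4 : 4 <= C by rewrite -(leq_pmul2r l00); lia.
  have tl6 : 4 * (2 ^ j * l0) + C * l0 <= 4 * l0 + C * (2 ^ j * l0).
    have h1 := leq_mul (leqnn (C - 4)) tl5; rewrite !mulnBl in h1.
    have h2 := leq_mul C4 (leqnn l0); have h3 := leq_mul C4 (leqnn (2 ^ j * l0)).
    by lia.
  have relax E3 E4 : relaxes t' j E3 E4 -> est E3 s u (B + dn G x u + 2 * u0) ->
      est E4 s u' (B + dn G x u + 2 * u0 + dn G u u' + 2 * 2 ^ j * u0).
    move=> r e3; apply: (r s u u' _ (B + dn G x u + 2 * u0)) => //.
    - by apply: near_complete => //; lia.
    - by lia.
    - by lia.
  have dv : 2 ^ j %| t' by exact: dvdn_mull.
  case: e2u => [e2u|tt].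
    have [E3 [E4 [i4 r4 i5]]] := r3' j ltac:(lia) dv.
    by apply/i5/(relax _ _ r4)/i4/i2'/i1'.
  rewrite tt in dv relax *.
  have [E3 [E4 [i4 r4 i5]]] := r3 j ltac:(lia) dv.
  by apply/i5/(relax _ _ r4)/i4/i2.
move=> h; have tm : (time u').+1 <= Tmax by have := time_max csu' du'; lia.
have h' := improves_steps (_ : t'.+1 <= (time u').+1) tm h.
apply: est_le (h' _) _; first by lia.
have : time u' - time x <= maxn 1 (time u' - time x) by rewrite leq_maxr.
move: (maxn _ _) => m hm; have hm2 : 2 * 2 ^ j <= m by lia.
have := leq_mul2l u0 (2 * 2 ^ j) m; rewrite hm2 orbT.
have := leq_pmulr u0 p0; lia.
Qed.

(* The walk is followed by key vertices: from a key vertex [x] one ball hop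
   leads to the last vertex at distance at most [l0], and the next edge of the
   walk to the next key vertex, so that every macro step is long enough. *)
Lemma chain p x : connected G s x -> shortest G x p ->
  dn G s (last x p) = dn G s x + dn G x (last x p) -> dn G s (last x p) <= 2 * D ->
  (forall q y r, p = q ++ y :: r -> ball_exact (last x q)) ->
  est (E (time x).+1) s x (bound x) ->
  exists2 t, time (last x p) <= t <= time (last x p) + 2 &
    est (E t) s (last x p) (bound (last x p) + 2 * u0).
Proof.
have [m] := ubnP (size p); elim: m p x => // m IH p x pm sx sp al vD bad ex.
case: p sp al vD bad pm => [|y p'] sp al vD bad pm.
  by exists (time x).+1; [rewrite /=; lia | apply: est_le ex _; rewrite /=; lia].
move: sp al vD bad pm; set p := y :: p'; set v := last x p => sp al vD bad pm.
have bx : ball_exact x by exact: (bad [::] y p').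
have xv : connected G x v by case: (sp) => pp _; exists p.
have BC z : dn G s z <= 2 * D -> bound z + 8 * l0 <= dn G s z + C * l0.
  by move=> /rounding_small; rewrite /bound; lia.
have ltx := dnt x; have gex := dnt' x.
have dx : dn G s x <= 2 * D by lia.
(* The final ball hop may cross no window; its rounding is the extra [2 * u0] of the conclusion. *)
case: (leqP (dn G x v) l0) => dv.
  exists (time x).+2.
    have : dn G s x %/ l0 <= dn G s v %/ l0 by apply: leq_div2r; lia.
    have : dn G s v %/ l0 <= dn G s x %/ l0 + 1.
      by rewrite -ltnS ltn_divLR // addn1 !mulSn; lia.
    by rewrite /time; lia.
  have : est (E (time x).+2) s v (bound x + dn G x v + 2 * u0).
    apply: ball_hop (ex) _ _ _ => //; [by lia | exact: BC |].
    by case: (eqVneq v x) => [|vx]; [left | right; exact: bx].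
  by move/est_le; apply; have := bound_le (x := x) (y := v); lia.
have hp : has (fun z => l0 < dn G x z) p.
  by apply/hasP; exists v => //; rewrite /v /p /= mem_last.
pose i := find (fun z => l0 < dn G x z) p.
have ip : i < size p by rewrite -has_find.
pose u := last x (take i p); pose u' := nth x p i.
have pE : p = take i p ++ u' :: drop i.+1 p by rewrite -drop_nth // cat_take_drop.
have xu' : l0 < dn G x u' by exact: (nth_find x hp).
have xu : dn G x u <= l0.
  rewrite /u; case Ei: i => [|k]; first by rewrite take0 dn_self.
  have ki : k < i by rewrite Ei.
  have -> : last x (take k.+1 p) = nth x p k.
    by rewrite -nth_last size_takel ?nth_take // -Ei ltnW.
  by rewrite leqNgt; have /negbT := before_find x ki.
have sp' := sp; rewrite pE in sp'; have [spu] := shortest_cat sp'; rewrite -/u => spu'.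
have [spe spr] := @shortest_cat _ _ u [:: u'] _ spu'.
have cxu : connected G x u by case: spu => pp _; exists (take i p).
have cuu' : connected G u u' by case: spe => pp _; exists [:: u'].
have lv : last u' (drop i.+1 p) = v by rewrite /v [in RHS]pE last_cat.
have cu'v : connected G u' v by case: spr => pp _; exists (drop i.+1 p).
have cuv := connected_trans cuu' cu'v.
have d1 := shortest_dist sp'; rewrite -pE -/u -/v in d1.
have d2 := @shortest_dist _ _ u [:: u'] _ spu'; rewrite /= lv in d2.
have [a1 a2] := aligned_prefix sx cxu cuv al d1.
have [a3 a4] := aligned_prefix (connected_trans sx cxu) cuu' cu'v a2 d2.
have xu'E : dn G x u' <= dn G x u + dn G u u' := dn_tri cxu cuu'.
have du' : dn G s u' <= 2 * D by lia.
have tx : time x + 1 <= time u'.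
  by rewrite /time -addnA leq_add2l leq_divRL // mulnDl; lia.
have : est (E (time u').+1) s u'
    (bound x + (dn G s u' - dn G s x) + 4 * u0 * maxn 1 (time u' - time x)).
  apply: (@edge_hop x u u' (time x).+1) => //; [by lia | exact: BC | | exact: aw_exact |].
    by case: (eqVneq u x) => [|ux]; [left | right; exact: bx].
  by right; lia.
have -> : maxn 1 (time u' - time x) = time u' - time x by lia.
rewrite /time subnDl => eu'.
rewrite -lv; apply: IH => //.
- by rewrite size_drop; lia.
- exact: connected_trans (connected_trans sx cxu) cuu'.
- by rewrite lv.
- by rewrite lv.
- move=> q z r E'; have := bad (take i p ++ u' :: q) z r; rewrite last_cat; apply.
  by rewrite {1}pE E' -catA.
- apply: est_le eu' _; rewrite /bound mulnBr.
  have h : 4 * u0 * (dn G s x %/ l0) <= 4 * u0 * (dn G s u' %/ l0).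
    by rewrite leq_mul2l leq_div2r ?orbT //; lia.
  by lia.
Qed.

End Source.

Variables (e0 : nat) (E' : table n).
Hypothesis time_max : forall s x, Q s -> connected G s x -> dn G s x <= 2 * D ->
  time s x + 4 <= Tmax.
Hypotheses (eC : e0 + 13 <= C) (eM : e0 <= M).
Hypothesis initial : forall s x, Q s -> connected G s x -> dn G s x <= D ->
  est (E 0) s x (dn G s x + e0 * dn G s x %/ M).
Hypothesis hub_improves : improves (E Tmax) E'.
Hypothesis hub_product : forall s b v B1 B2, Q s -> A b ->
  est (E Tmax) s b B1 -> est (E Tmax) b v B2 -> B1 <= 4 * D -> B2 <= 4 * D ->
  est E' s v (B1 + B2 + l0).

(** Only targets beyond [D] need work. The path is entered at the edge from [y] to [y'] that leaves
    the known range, and followed to its first vertex [x] with a near hub [b], or to its end. The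
    detour through [b] costs at most two windows, and all new losses stay within [8 * l0], at most
    [8 / M] of the distance. *)
Lemma sweep_scale s v : Q s -> connected G s v -> 2 * dn G s v <= 3 * D ->
  est E' s v (dn G s v + (e0 + 8) * dn G s v %/ M).
Proof.
move=> Qs sv v3.
have M0 : 0 < M by lia.
have tM : 0 <= Tmax by [].
case: (leqP (dn G s v) D) => vD.
  apply/hub_improves/(improves_steps tM (leqnn _))/(est_le (initial Qs sv vD)).
  by rewrite leq_add2l leq_div2r // leq_mul2r leq_addr orbT.
have [p sp lp] := shortest_walk sv.
have hp : has (fun z => D < dn G s z) p.
  apply/hasP; exists v => //; case: p lp {sp} => [|z p] lp /=.
    by move: vD; rewrite -lp /= dn_self; lia.
  by rewrite -lp /= mem_last.
pose i := find (fun z => D < dn G s z) p.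
have ip : i < size p by rewrite -has_find.
pose y := last s (take i p); pose y' := nth s p i; pose r := drop i.+1 p.
have pE : p = take i p ++ y' :: r by rewrite -drop_nth // cat_take_drop.
have sy' : D < dn G s y' by exact: (nth_find s hp).
have sy : dn G s y <= D.
  rewrite /y; case Ei: i => [|k]; first by rewrite take0 dn_self.
  have ki : k < i by rewrite Ei.
  have -> : last s (take k.+1 p) = nth s p k.
    by rewrite -nth_last size_takel ?nth_take // -Ei ltnW.
  by rewrite leqNgt; have /negbT := before_find s ki.
have sp' := sp; rewrite pE in sp'; have [spy] := shortest_cat sp'; rewrite -/y => spy'.
have [spe spr] := @shortest_cat _ _ y [:: y'] _ spy'.
have csy : connected G s y by case: spy => pp _; exists (take i p).
have cyy' : connected G y y' by case: spe => pp _; exists [:: y'].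
have lv : last y' r = v by rewrite -lp [in RHS]pE last_cat.
have cy'v : connected G y' v by case: spr => pp _; exists r.
have d1 := shortest_dist sp'; rewrite -pE -/y lp in d1.
have d2 := @shortest_dist _ _ y [:: y'] _ spy'; rewrite /= lv in d2.
have [_ a2] := aligned_prefix (connected_refl G s) csy (connected_trans cyy' cy'v)
   ltac:(by rewrite dn_self) d1.
have [a3 a4] := aligned_prefix csy cyy' cy'v a2 d2.
(* The error inherited at [y]; the entering edge may cross no window boundary, hence the extra
   [4 * u0] in [Err]. *)
pose Err0 := e0 * dn G s y %/ M; pose Err := Err0 + 4 * u0.
have u0l : 8 * (4 * u0) <= l0 by rewrite l0E; nia.
have Err0l : Err0 <= e0 * l0.
  rewrite /Err0; apply: (@leq_trans (e0 * D %/ M)).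
    by rewrite leq_div2r // leq_mul2l sy orbT.
  by rewrite /D mulnCA mulKn.
have ErrC : Err + 12 * l0 <= C * l0.
  have := leq_mul eC (leqnn l0); rewrite /Err; lia.
have Dl : l0 <= D by rewrite /D leq_pmull.
have tmax := time_max (s := s) ^~ Qs.
have tm x : connected G s x -> dn G s x <= 2 * D -> time s x + 4 <= Tmax by exact: time_max.
have dy' : dn G s y' <= 2 * D by lia.
have csy' := connected_trans csy cyy'.
have yy' : time s y <= time s y' by rewrite /time leq_add2l leq_div2r //; lia.
have ey : est (E (time s y)) s y (dn G s y + Err0).
  apply: (improves_steps (leq0n _) _) (initial Qs csy sy).
  by have := tm y csy; lia.
have ey' : est (E (time s y').+1) s y' (bound s Err y').
  have := edge_hop Qs tm ErrC (x := y) (u := y) (u' := y') (t := time s y) (B := dn G s y + Err0).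
  move=> /(_ csy); rewrite leqnn leq_addr => /(_ isT ey).
  case=> //; try exact: connected_refl; rewrite ?dn_self ?addn0 //.
  - by move: ErrC; rewrite /Err; lia.
  - by left.
  - exact: aw_exact.
  - by left.
  move=> e0' h le; exists e0' => //; apply: leq_trans le _.
  rewrite /bound /Err /time subnDl.
  have h1 : maxn 1 (dn G s y' %/ l0 - dn G s y %/ l0) <= 1 + dn G s y' %/ l0.
    by rewrite geq_max leq_addr (leq_trans (leq_subr _ _)) ?leq_addl.
  move: (maxn _ _) h1 => m h1; have := leq_mul (leqnn (4 * u0)) h1.
  by lia.
have small x : dn G s x <= 2 * D -> 4 * u0 * (dn G s x %/ l0) <= l0.
  exact: (rounding_small (s := s)).
have fin e : e <= dn G s v + 7 * l0 + (e0 * dn G s v) %/ M ->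
    e <= dn G s v + (e0 + 8) * dn G s v %/ M.
  move=> h; apply: leq_trans h _; rewrite -addnA leq_add2l mulnDl.
  apply: leq_trans (leq_add _ (leqnn _)) (_ : 8 * l0 + (e0 * dn G s v) %/ M <= _).
    by rewrite leq_mul2r orbT.
  rewrite -divnMDl // leq_div2r // addnC leq_add2l -mulnA leq_mul2l /=.
  by rewrite mulnC -/D ltnW.
have chain' := chain Qs tm ErrC.
have Err0v : Err0 <= (e0 * dn G s v) %/ M by rewrite leq_div2r // leq_mul2l orbC; lia.
case: (pselect (exists q z r', y' :: r = q ++ z :: r' /\ exists b, near_hub z b)); last first.
  move=> no; have [||||t /andP[_ t2] et] := chain' r y' csy' spr.
  - by rewrite lv.
  - by rewrite lv; lia.
  - move=> q z r' rE; case: (good_or_bad (last y' q)) => // gb; case: no.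
    case/lastP: q rE gb => [|q q'] rE gb.
      by exists [::], y', r; split.
    by exists (y' :: q), q', (z :: r'); rewrite rE last_rcons in gb *; rewrite cat_rcons.
  - exact: ey'.
  rewrite lv in t2 et.
  have tT : t <= Tmax by have := tm v sv; lia.
  have := hub_improves (improves_steps tT (leqnn _) et); move/est_le; apply.
  by apply: fin; have := small v; rewrite /bound /Err; lia.
move=> goodex.
have ex : exists k, (k < size (y' :: r)) && `[< exists b, near_hub (nth y' (y' :: r) k) b >].
  have [q [z [r' [E1 hz]]]] := goodex; exists (size q).
  by rewrite E1 size_cat /= addnS ltnS leq_addr nth_cat ltnn subnn /=; apply/asboolP.
case: (ex_minnP ex) => k /andP[kr /asboolP[b hb]] kmin; move: hb.
rewrite -[nth _ _ _]/(nth y' (y' :: r) k).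
have nE m : m <= size r -> nth y' (y' :: r) m = last y' (take m r).
  case: m => [|m] mr; first by rewrite take0.
  by rewrite -nth_last size_takel //= nth_take.
have kr' : k <= size r by rewrite -ltnS.
rewrite nE //; set x := last y' (take k r) => -[Ab cxb dxb axb].
have rE : r = take k r ++ drop k r by rewrite cat_take_drop.
have spr2 := spr; rewrite /= rE in spr2; have [spx spx'] := shortest_cat spr2.
rewrite -/x in spx'.
have cy'x : connected G y' x by case: spx => pp _; exists (take k r).
have cxv : connected G x v by case: spx' => pp _; exists (drop k r); rewrite -last_cat cat_take_drop.
have d3 := shortest_dist spr2; rewrite cat_take_drop -/x lv in d3.
have [b1 b2] := aligned_prefix csy' cy'x cxv a4 d3.
have csx := connected_trans csy' cy'x; have csb := connected_trans csx cxb.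
have [||||t /andP[t1 t2] et] := chain' (take k r) y' csy' spx.
- by rewrite -/x.
- by rewrite -/x; lia.
- move=> q z r' tE; have kq : size q < k.
    have := congr1 size tE; rewrite size_takel // size_cat /=; lia.
  case: (good_or_bad (last y' q)) => // -[b' hb'].
  exfalso; suff : k <= size q by rewrite leqNgt kq.
  apply: kmin; rewrite ltnS (leq_trans (ltnW kq)) //=; apply/asboolP; exists b'.
  rewrite nE ?(leq_trans (ltnW kq)) //.
  have <- : q = take (size q) r; last by [].
  by rewrite -[r](cat_take_drop k) tE -catA take_size_cat.
- exact: ey'.
rewrite -/x in t1 t2 et.
(* The path left the range [D] before [x] and has length at most [3 * D / 2], so [x] is within
   [D / 2] of [v]; with [M >= 4] the hub is within [D] of [v], where initial estimates are
   available. *)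
have D4 : 4 * l0 <= D by rewrite /D leq_mul2r M4 orbT.
have bv : dn G b v <= dn G x b + dn G x v.
  by rewrite [dn G x b]dn_sym; apply: dn_tri (connected_sym cxb) cxv.
have bvD : dn G b v <= D by lia.
have sxD : dn G s x <= 2 * D by lia.
have smx := small x sxD.
have e0z z : e0 * z %/ M <= z.
  by rewrite -[X in _ <= X](mulKn z M0) leq_div2r // leq_mul2r eM orbT.
have eb : est (E Tmax) s b (bound s Err x + 2 * u0 + dn G x b + 2 * u0).
  apply: (improves_steps (t := t.+1)) (leqnn _) _ _ _ _.
    by have := tm x csx sxD; lia.
  apply: (ball_hop Qs tm ErrC) (et) _ _ _ => //; first by rewrite t1 t2.
  by rewrite /bound; lia.
have ebv : est (E Tmax) b v (dn G b v + e0 * dn G b v %/ M).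
  apply/(improves_steps (leq0n _) (leqnn _))/initial => //; first exact: hubs_sources.
  exact: connected_trans (connected_sym cxb) cxv.
have ErrD : Err <= D + l0.
  have := leq_mul eM (leqnn l0); rewrite -/D /Err; lia.
have := hub_product Qs Ab eb ebv; move=> /(_ _ _)/est_le; apply.
- by rewrite /bound; lia.
- by have := e0z (dn G b v); lia.
apply: fin.
(* The inherited errors belong to the legs from [s] to [y] and from [b] to [v], of total length at
   most [dn G s v + l0], so the relative error does not double. *)
have sum : Err0 + e0 * dn G b v %/ M <= (e0 * dn G s v) %/ M + l0.
  apply: leq_trans (_ : (l0 * M + e0 * dn G s v) %/ M <= _); last first.
    by rewrite divnMDl // addnC.
  rewrite leq_divRL // mulnDl; apply: leq_trans (leq_add (leq_divM _ _) (leq_divM _ _)) _.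
  have : e0 * (dn G s y + dn G b v) <= e0 * (dn G s v + l0) by rewrite leq_mul2l orbC; lia.
  by have := leq_mul eM (leqnn l0); rewrite !mulnDr; lia.
by rewrite /bound /Err; lia.
Qed.

End Sweep.

(** * Distributed sweep *)

Section Engine.
Local Open Scope nat_scope.
Variable n : nat.

(* A way to compute min-plus products with a right factor that is preprocessed
   in [pc] rounds, at a cost depending on the number [K] of relevant rows of
   the left factor in each column of the result. *)
Definition engine W (PD : Type) (prep : ('I_n -> 'I_n -> option 'I_W) -> ('I_n -> PD) -> Prop)
    (pc : nat) (mc : nat -> nat) : Prop :=
  (forall (H X Y : Type) (P : H -> ('I_n -> X) -> Prop) (Q : H -> ('I_n -> Y) -> Prop)
     (b : 'I_n -> X -> 'I_n -> option 'I_W) (h : 'I_n -> X -> PD -> Y),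
     (forall g c pd, P g c -> prep (fun x y => b y (c y) x) pd ->
        Q g (fun y => h y (c y) (pd y))) -> solves pc P Q) /\
  (forall (K : nat) (H X Y : Type) (P : H -> ('I_n -> X) -> Prop)
     (Q : H -> ('I_n -> Y) -> Prop) (al : 'I_n -> X -> 'I_n -> option 'I_W)
     (pd : 'I_n -> X -> PD) (sup : 'I_n -> X -> pred 'I_n)
     (h : 'I_n -> X -> ('I_n -> option 'I_(2 * W)) -> Y),
     K <= n ->
     (forall g c, P g c -> exists b, [/\ prep b (fun y => pd y (c y)),
        forall y, #|sup y (c y)| <= K,
        forall x y s, al x (c x) s -> b x y -> sup y (c y) s &
        forall out, is_minplus (fun x => al x (c x)) b out ->
          Q g (fun y => h y (c y) (out y))]) ->
     solves (mc K) P Q).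

End Engine.

Section DistributedSweep.
Local Open Scope nat_scope.
Variables (n W : nat) (PD : Type) (prep : ('I_n -> 'I_n -> option 'I_W) -> ('I_n -> PD) -> Prop).
Variables (pc : nat) (mc : nat -> nat).
Hypothesis eng : engine prep pc mc.

Definition sound (G : wgraph n) (E : table n) : Prop :=
  forall s x e, E s x = Some e -> connected G s x /\ dn G s x <= e.

(* The quotient is increased even when [u] divides [a]. *)
Definition units u a : option 'I_W := insub (a %/ u).+1.

Lemma units_some u a k : 0 < u -> units u a = Some k -> a <= k * u <= a + u.
Proof.
move=> u0; rewrite /units; case: insubP => // k' _ E [<-].
rewrite E; apply/andP; split; first exact/ltnW/ltn_ceil.
by rewrite mulSn addnC leq_add2r leq_divM.
Qed.

Lemma units_lt u a b : 0 < u -> a <= b * u -> b.+1 < W ->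
  exists2 k, units u a = Some k & k * u <= a + u.
Proof.
move=> u0 ab bW; have lt : (a %/ u).+1 < W.
  by apply: leq_ltn_trans bW; rewrite ltnS -(mulnK b u0) leq_div2r.
have E : units u a = Some (Ordinal lt) by rewrite /units insubT.
by exists (Ordinal lt) => //; have /andP[] := units_some u0 E.
Qed.

Definition omin (o : option nat) (e : nat) : option nat :=
  Some (if o is Some e' then minn e' e else e).

Lemma est_omin (o : option nat) e B : (exists2 e', o = Some e' & e' <= B) \/ e <= B ->
  exists2 e', omin o e = Some e' & e' <= B.
Proof.
rewrite /omin => -[[e' -> le]|le].
  by exists (minn e' e) => //; rewrite geq_min le.
by case: o => [e'|]; [exists (minn e' e) => //; rewrite geq_min le orbT | exists e].
Qed.

Variables (X : Type) (awf : 'I_n -> X -> 'I_n -> option nat).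
Variable (pdf : 'I_n -> X -> nat -> PD).
Variables (nearf supf : 'I_n -> X -> nat -> nat -> pred 'I_n).
Variables (Q : pred 'I_n) (l0 u0 M C J Tmax : nat) (K : nat -> nat) (theta : 'I_n -> nat).
Hypotheses (u00 : 0 < u0) (l0E : l0 = 8 * M * u0) (C4 : 4 <= C).
Hypothesis WE : 8 * C * M + 2 <= W.
Hypothesis Kn : forall j, K j <= n.

Definition classB j (aw : table n) x y : option 'I_W :=
  if aw x y is Some w then if in_class l0 j w then units (2 ^ j * u0) w else None
  else None.

Definition static (G : wgraph n) (st : 'I_n -> X) : Prop :=
  let aw x y := awf y (st y) x in
  [/\ forall x y w, aw x y = Some w -> connected G x y /\ dn G x y <= w,
      forall j, j <= J -> prep (classB j aw) (fun y => pdf y (st y) j),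
      forall y j t, j <= J -> #|supf y (st y) j t| <= K j &
      forall x y w j t s, j <= J -> Q s -> nearf x (st x) j t s -> aw x y = Some w ->
        in_class l0 j w -> supf y (st y) j t s].

(** The estimate is measured from an origin [4 * 2 ^ j] windows behind the front. In the rounding
    unit of class [j] the entry is then about [8 * C * M] at most, whatever the scale and the
    class. *)
Definition active j t s (st : 'I_n -> X) x (o : option nat) : option 'I_W :=
  if o is Some e then
    if [&& Q s, nearf x (st x) j t s, t * l0 <= e + (theta s + 4 * 2 ^ j) * l0 &
        e + (theta s + 4 * 2 ^ j) * l0 <= (t + C * 2 ^ j) * l0]
    then units (2 ^ j * u0) (e + (theta s + 4 * 2 ^ j) * l0 - t * l0) else None
  else None.

Definition tab (c : 'I_n -> X * ('I_n -> option nat)) : table n :=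
  fun s x => (c x).2 s.

Definition state_of (c : 'I_n -> X * ('I_n -> option nat)) : 'I_n -> X :=
  fun x => (c x).1.

Definition relaxing (g : wgraph n * ('I_n -> X)) := relaxes g.1 Q
  (fun x y => awf y (g.2 y) x) l0 u0 C theta (fun j t s x => nearf x (g.2 x) j t s).

Definition good_state (g : wgraph n * ('I_n -> X)) c : Prop :=
  [/\ static g.1 g.2, state_of c = g.2 & sound g.1 (tab c)].

Lemma solves_relax_step (H : Type) j t
    (P P' : H -> ('I_n -> X * ('I_n -> option nat)) -> Prop)
    (gr : H -> wgraph n * ('I_n -> X)) : j <= J ->
  (forall g c, P g c -> good_state (gr g) c) ->
  (forall g c c', P g c -> good_state (gr g) c' -> improves (tab c) (tab c') ->
     relaxing (gr g) t j (tab c) (tab c') -> P' g c') ->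
  solves (mc (K j)) P P'.
Proof.
move=> jJ HP HP'; pose u := 2 ^ j * u0.
have u0' : 0 < u by rewrite muln_gt0 expn_gt0.
have [_ mult] := eng.
pose al x (z : X * ('I_n -> option nat)) s := active j t s (fun=> z.1) x (z.2 s).
pose off s := (theta s + 4 * 2 ^ j) * l0.
pose upd (z : X * ('I_n -> option nat)) (out : 'I_n -> option 'I_(2 * W)) :=
  (z.1, fun s => if out s is Some m then omin (z.2 s) (m * u + t * l0 - off s) else z.2 s).
apply: (mult (K j) _ _ _ _ _ al (fun y z => pdf y z.1 j) (fun y z => supf y z.1 j t)
  (fun y z out => upd z out)) => // g c Pc.
have [sta stE cs] := HP _ _ Pc; have [aws pp supK supP] := sta.
set st := (gr g).2 in sta pp supK supP stE aws *; set aw := fun x y => awf y (st y) x in aws pp.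
have stc x : (c x).1 = st x by rewrite -stE.
exists (classB j aw); split.
- by have := pp j jJ; congr prep; apply/funext => y; rewrite stc.
- by move=> y; rewrite stc; exact: supK.
- move=> x y s; rewrite /al /active /classB.
  case: ((c x).2 s) => // e; case: ifP => // /and4P[Qs nr _ _] _.
  case E: (aw x y) => [w|//]; case: ifP => // cl _.
  by rewrite stc; apply: supP jJ _ _ E cl => //; rewrite -stc.
move=> out [sp1 sp2].
have imp : improves (tab c) (tab (fun y => upd (c y) (out y))).
  move=> s x B [e E le]; rewrite /est /tab /upd /=.
  case: (out x s) => [m|]; last by exists e.
  by apply: est_omin; left; exists e.
apply: (HP' g c) => //.
- split; [exact: sta | by rewrite -/st -stE |].
  move=> s y e; rewrite /tab /upd /=; case E: (out y s) => [m|]; last exact: cs.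
  have [x [k [k' [alE bE mE]]]] := sp1 _ _ _ E.
  move: alE bE; rewrite /al /active /classB.
  case E1: ((c x).2 s) => [e1|//]; case: ifP => // /and4P[_ _ h1 _] /(units_some u0')/andP[hk _].
  case E2: (aw x y) => [w|//]; case: ifP => // _ /(units_some u0')/andP[hk' _].
  have [cxy dxy] := aws _ _ _ E2; have [csx dsx] := cs _ _ _ E1.
  have tri := dn_tri csx cxy; have mu : m * u = k * u + k' * u by rewrite mE mulnDl.
  have low : dn (gr g).1 s y <= m * u + t * l0 - off s by move: hk; rewrite -/(off s); lia.
  rewrite /omin => -[<-]; split; first exact: connected_trans csx cxy.
  case E3: ((c y).2 s) => [e3|//]; rewrite leq_min low andbT.
  by have [] := cs s y e3.
- move=> s x y w B Qs nr lo [e E le] hi awE cl; rewrite /est /tab /upd /=.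
  have [csx dsx] := cs _ _ _ E; move: E; rewrite /tab => E.
  have l0u : l0 * 2 ^ j = 8 * M * u by rewrite l0E /u; lia.
  have [||k alE hk] := units_lt (u := u) (a := e + off s - t * l0) (b := 8 * C * M) u0'.
  + by move: hi; rewrite -/(off s) mulnDl -mulnA [2 ^ j * _]mulnC l0u; lia.
  + by lia.
  have [||k' bE hk'] := units_lt (u := u) (a := w) (b := 8 * C * M) u0'.
  + move: cl => /andP[h _]; apply: leq_trans h _.
    rewrite -mulnA [2 ^ j * _]mulnC l0u.
    by have := leq_mul C4 (leqnn (8 * M * u)); lia.
  + by lia.
  have [||m mE mk] := sp2 x y s k k'.
  + have h1 : t * l0 <= e + off s by apply: leq_trans lo _; rewrite leq_add2r.
    have h2 : e + off s <= (t + C * 2 ^ j) * l0 by apply: leq_trans hi; rewrite leq_add2r.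
    by rewrite /al /active E Qs stc nr -/(off s) h1 h2.
  + have awE' : aw x y = Some w by [].
    by rewrite /classB awE' cl.
  rewrite mE; apply: est_omin; right.
  have := leq_mul mk (leqnn u); rewrite mulnDl -/u.
  have -> : 2 * 2 ^ j * u0 = 2 * u by rewrite /u; lia.
  by have := lo; rewrite -/(off s); lia.
Qed.

Definition macro (g : wgraph n * ('I_n -> X)) := macro_step g.1 Q
  (fun x y => awf y (g.2 y) x) l0 u0 C J theta (fun j t s x => nearf x (g.2 x) j t s).

Definition macro_cost t := mc (K 0) + (mc (K 0) +
  \sum_(i < J) if 2 ^ i.+1 %| t then mc (K i.+1) else 0).

Lemma solves_macro t : solves (macro_cost t)
  (fun g c => good_state g.1 c /\ tab c = g.2)
  (fun (g : wgraph n * ('I_n -> X) * table n) c =>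
     good_state g.1 c /\ macro g.1 t g.2 (tab c)).
Proof.
pose I1 (g : wgraph n * ('I_n -> X) * table n) c := good_state g.1 c /\
  improves g.2 (tab c) /\ relaxing g.1 t 0 g.2 (tab c).
pose I2 i (g : wgraph n * ('I_n -> X) * table n) c := good_state g.1 c /\
  exists E1 E2, [/\ improves g.2 E1, relaxing g.1 t 0 g.2 E1, improves E1 E2,
    relaxing g.1 t 0 E1 E2 & improves E2 (tab c) /\
    forall j, 0 < j <= i -> 2 ^ j %| t -> exists E3 E4,
      [/\ improves E2 E3, relaxing g.1 t j E3 E4 & improves E4 (tab c)]].
apply: (@solves_seq _ _ _ _ _ _ _ _ I1).
  apply: (solves_relax_step (gr := fun g => g.1) (t := t)) => // [g c [] //|].
  by move=> g c c' [gc cE] gc' imp r; split=> //; rewrite -cE.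
apply: (@solves_seq _ _ _ _ _ _ _ _ (I2 0)).
  apply: (solves_relax_step (gr := fun g => g.1) (t := t)) => // [g c [] //|].
  move=> g c c' [gc [i1 r1]] gc' imp r; split=> //.
  exists (tab c), (tab c'); split=> //; split; first exact: improves_refl.
  by move=> j; lia.
refine (@solves_conseq _ _ _ _ _ (I2 0) _ (I2 J) _ (@solves_loop _ _ _
  (fun i => if 2 ^ i.+1 %| t then mc (K i.+1) else 0) J I2 _) _ _) => //.
move=> i iJ; case dv: (2 ^ i.+1 %| t); last first.
  apply: (@solves_idle _ _ _ _ _ _ _ (fun _ x => x)) => g c [gc [E1 [E2 [a1 a2 a3 a4 [a5 a6]]]]].
  split=> //; exists E1, E2; split=> //; split=> // j /andP[j0 ji] dj; apply: a6 => //.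
  by rewrite j0 /= -ltnS ltn_neqAle ji andbT; apply/eqP => jE; rewrite -jE dj in dv.
apply: (solves_relax_step (gr := fun g => g.1) (t := t)) => // [g c [] //|].
move=> g c c' [gc [E1 [E2 [a1 a2 a3 a4 [a5 a6]]]]] gc' imp r; split=> //.
exists E1, E2; split=> //; split; first exact: improves_trans imp.
move=> j /andP[j0 ji] dj; case: (ltngtP j i.+1) ji => // [ji _|-> _].
  have [|E3 [E4 [b1 b2 b3]]] := a6 j _ dj; first by rewrite j0.
  by exists E3, E4; split=> //; exact: improves_trans imp.
by exists (tab c), (tab c'); split=> //.
Qed.

Lemma solves_sweep : solves (\sum_(t < Tmax) macro_cost t)
  (fun g c => good_state g.1 c /\ tab c = g.2)
  (fun (g : wgraph n * ('I_n -> X) * table n) c => good_state g.1 c /\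
     exists E, [/\ E 0 = g.2, E Tmax = tab c & forall t, t < Tmax -> macro g.1 t (E t) (E t.+1)]).
Proof.
pose I t (g : wgraph n * ('I_n -> X) * table n) c := good_state g.1 c /\
  exists E, [/\ E 0 = g.2, E t = tab c & forall k, k < t -> macro g.1 k (E k) (E k.+1)].
refine (@solves_conseq _ _ _ _ _ (I 0) _ (I Tmax) _ (solves_loop _) _ _) => //; last first.
  by move=> g c [gc cE]; split=> //; exists (fun=> g.2).
move=> t tT.
apply: (solves_lift (f := fun _ x => x) (h := fun _ _ x => x) (solves_macro t)).
move=> g c [gc [E [E0 Et steps]]]; exists (g.1, tab c); split=> // c' [gc' mac]; split=> //.
exists (fun k => if k <= t then E k else tab c'); rewrite ltnn leq0n; split=> // k kt.
case: (ltnP k t) => [kt'|tk]; first by rewrite ltnW //; exact: steps.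
by have -> : k = t; [lia | rewrite leqnn Et].
Qed.

End DistributedSweep.

(** * One scale: preparation, sweep and hub product *)

Section Scale.
Local Open Scope nat_scope.
Variables (n W : nat) (PD : Type) (prep : ('I_n -> 'I_n -> option 'I_W) -> ('I_n -> PD) -> Prop).
Variables (pc : nat) (mc : nat -> nat).
Hypothesis eng : engine prep pc mc.
Variable pd0 : PD.
Variables (X : Type) (awf : 'I_n -> X -> 'I_n -> option nat).
Variables (nearf supf : 'I_n -> X -> nat -> nat -> pred 'I_n).
Variables (Q A : pred 'I_n) (l0 u0 M C J Tmax N e0 : nat) (K : nat -> nat) (theta : 'I_n -> nat).
Hypotheses (u00 : 0 < u0) (l0E : l0 = 8 * M * u0) (M4 : 4 <= M) (MJ : M <= 2 ^ J).
Hypotheses (eC : e0 + 13 <= C) (eM : e0 <= M) (WE : 8 * C * M + 2 <= W).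
Hypothesis Kn : forall j, K j <= n.
Hypotheses (hubs_sources : forall b, A b -> Q b) (QN : #|Q| <= N) (Nn : N <= n).
Hypothesis Tm : forall s, theta s + 2 * M + 4 <= Tmax.

Definition distances (aw : table n) (G : wgraph n) : Prop :=
  [/\ forall x y w, aw x y = Some w -> connected G x y /\ dn G x y <= w,
      forall x y w, wadj G x y = Some w -> est aw x y w &
      forall x, (exists b, near_hub G A aw l0 x b) \/ ball_exact G aw l0 x].

Definition schedule (G : wgraph n) (st : 'I_n -> X) : Prop :=
  let aw x y := awf y (st y) x in
  [/\ forall y j t, j <= J -> #|supf y (st y) j t| <= K j,
      forall x y w j t s, j <= J -> Q s -> nearf x (st x) j t s -> aw x y = Some w ->
        in_class l0 j w -> supf y (st y) j t s &
      forall j t s x, Q s -> connected G s x -> dn G s x <= 2 * (M * l0) ->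
        t * l0 <= dn G s x + (theta s + 4 * 2 ^ j) * l0 ->
        dn G s x + theta s * l0 <= (t + 4 * 2 ^ j) * l0 -> nearf x (st x) j t s].

Definition known (G : wgraph n) D e (E : table n) : Prop :=
  sound G E /\ forall s x, Q s -> connected G s x -> dn G s x <= D ->
    est E s x (dn G s x + e * dn G s x %/ M).

Lemma solves_scale D' (H : Type) (gr : H -> wgraph n)
    (P P' : H -> ('I_n -> X * ('I_n -> option nat)) -> Prop) :
  2 * D' <= 3 * (M * l0) ->
  (forall g c, P g c -> [/\ distances (fun x y => awf y (state_of c y) x) (gr g),
     schedule (gr g) (state_of c) & known (gr g) (M * l0) e0 (tab c)]) ->
  (forall g c c', P g c -> state_of c' = state_of c ->
     known (gr g) D' (e0 + 8) (tab c') -> P' g c') ->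
  solves (J.+1 * pc + (\sum_(t < Tmax) macro_cost mc J K t + (pc + mc N))) P P'.
Proof.
move=> D3 HP HP'; have [prp mult] := eng.
have C4 : 4 <= C by lia.
have l00 : 0 < l0 by rewrite l0E !muln_gt0 u00 /=; lia.
pose aw (st : 'I_n -> X) x y := awf y (st y) x.
pose Y := ((X * (nat -> PD)) * ('I_n -> option nat))%type.
pose awY y (z : X * (nat -> PD)) := awf y z.1.
pose pdY (y : 'I_n) (z : X * (nat -> PD)) := z.2.
pose nearY x (z : X * (nat -> PD)) := nearf x z.1.
pose supY x (z : X * (nat -> PD)) := supf x z.1.
pose out (c : 'I_n -> Y) v := ((c v).1.1, (c v).2).
pose I1 i g (c : 'I_n -> Y) := P g (out c) /\
  forall j, j < i -> prep (classB W l0 u0 j (aw (fun v => (c v).1.1))) (fun y => (c y).1.2 j).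
have first : solves (J.+1 * pc) P (I1 J.+1).
  have -> : J.+1 * pc = 0 + \sum_(i < J.+1) pc by rewrite sum_nat_const card_ord.
  apply: (@solves_seq _ _ _ _ _ _ _ _ (I1 0)).
    apply: (@solves_idle _ _ _ _ _ _ _ (fun _ z => ((z.1, fun=> pd0), z.2))) => g c Pc.
    split=> //; rewrite /out /=; move: Pc; congr (P g).
    by apply/funext => v; case: (c v).
  apply: (@solves_loop _ _ _ (fun=> pc)) => i iJ.
  apply: (prp _ _ _ _ _ (fun y (z : Y) x =>
      classB W l0 u0 i (fun x' y' => awf y z.1.1 x') x y)
    (fun y (z : Y) pd => ((z.1.1, fun j => if j == i then pd else z.1.2 j), z.2))).
  move=> g c pd [Pc pj] pi; split=> // j ji; rewrite /=.
  by case: eqP => [->|ne] //; apply: pj; lia.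
pose G1 := (H * ('I_n -> X * ('I_n -> option nat)))%type.
pose I2 g (c : 'I_n -> Y) := exists c0, [/\ P g c0, forall v, (c v).1.1 = (c0 v).1,
   sound (gr g) (tab c) & exists E, [/\ E 0 = tab c0, E Tmax = tab c &
     forall t, t < Tmax -> macro_step (gr g) Q (aw (state_of c0)) l0 u0 C J theta
       (fun j t s x => nearf x (state_of c0 x) j t s) t (E t) (E t.+1)]].
apply: (solves_seq first).
apply: (@solves_seq _ _ _ _ _ _ _ _ I2).
  apply: (solves_lift (f := fun _ z => z) (h := fun _ _ z => z)
    (@solves_sweep n W PD prep pc mc eng (X * (nat -> PD)) awY pdY nearY supY Q l0 u0 M C J Tmax
       K theta u00 l0E C4 WE Kn)).
  move=> g c [Pc pj]; have [[d1 d2 d3] [s1 s2 s3] [k1 k2]] := HP _ _ Pc.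
  exists (gr g, (fun v => (c v).1), tab c); split.
    by split=> //; split=> //; split=> //= j; rewrite -ltnS; exact: pj.
  move=> c' [[_ st' so'] [E [E0 ET st]]] /=.
  by exists (out c); split=> //; [move=> v; rewrite -[(c' v).1]/(state_of c' v) st' | exists E].
(* Half a window: two roundings cost the [l0] allowed to the hub product, and distances up to
   [4 * M * l0] fit into [8 * M] units. *)
pose uh := 4 * M * u0.
have uh0 : 0 < uh by rewrite /uh !muln_gt0 u00 /=; lia.
have l0uh : l0 = 2 * uh by rewrite l0E /uh; lia.
pose I3 g (c : 'I_n -> Y * PD) := I2 g (fun v => (c v).1) /\
  prep (fun x y => if A x then obind (units W uh) ((c y).1.2 x) else None) (fun y => (c y).2).
have small e : e <= 4 * (M * l0) ->
    exists2 k, units W uh e = Some k & k * uh <= e + uh.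
  move=> h; apply: (@units_lt W uh e (8 * M)) => //; first by rewrite l0uh in h; lia.
  by have := leq_mul C4 (leqnn (8 * M)); lia.
apply: (@solves_seq _ _ _ _ _ _ _ _ I3).
  by apply: (prp _ _ _ _ _ (fun y (z : Y) x => if A x then obind (units W uh) (z.2 x) else None)
    (fun y z pd => (z, pd))).
apply: (mult N _ _ _ _ _
  (fun x (z : Y * PD) s => if Q s && A x then obind (units W uh) (z.1.2 s) else None)
  (fun y z => z.2) (fun _ _ => Q)
  (fun y z o => (z.1.1.1, fun s => if o s is Some m then omin (z.1.2 s) (m * uh) else z.1.2 s))).
- exact: Nn.
move=> g c [[c0 [Pc0 c01 so [E [E0 ET st]]]] pp].
exists (fun x y => if A x then obind (units W uh) ((c y).1.2 x) else None); split=> //.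
  by move=> x y s; case: (Q s).
move=> o [sp1 sp2]; have [[d1 d2 d3] [s1 s2 s3] [k1 k2]] := HP _ _ Pc0.
apply: (HP' g c0) => //; first by apply/funext => v; rewrite /state_of /= c01.
set c' := fun y => _.
have tabE s y : tab c' s y = if o y s is Some m then omin ((c y).1.2 s) (m * uh) else (c y).1.2 s.
  by [].
have unit_le e k : units W uh e = Some k -> e <= k * uh by move=> /(units_some uh0)/andP[].
split.
  move=> s y e; rewrite tabE; case oE: (o y s) => [m|]; last exact: so.
  have [x [k [k' [alE bE mE]]]] := sp1 _ _ _ oE.
  move: alE bE; case: (Q s) => //=; case: (A x) => //.
  case E1: ((c x).1.2 s) => [e1|//] /= /unit_le h1; case E2: ((c y).1.2 x) => [e2|//] /= /unit_le h2.
  have [cx dx] := so _ _ _ E1; have [cy dy] := so _ _ _ E2.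
  have tri := dn_tri cx cy; have mu : m * uh = k * uh + k' * uh by rewrite mE mulnDl.
  rewrite /omin => -[<-]; split; first exact: connected_trans cx cy.
  case E3: ((c y).1.2 s) => [e3|]; last by lia.
  by have [_] := so _ _ _ E3; rewrite leq_min => ->; lia.
have imp : improves (E Tmax) (tab c').
  rewrite ET => s y B [e eE le]; rewrite /est tabE; case: (o y s) => [m|]; last by exists e.
  by apply: est_omin; left; exists e.
move=> s v Qs sv vD.
apply: (@sweep_scale n (gr g) Q A (aw (state_of c0)) l0 u0 M C J theta
  (fun j t s x => nearf x (state_of c0 x) j t s) l00 l0E M4 MJ d1 d2 d3 hubs_sources _
  E Tmax st e0 (tab c')) => //.
- move=> s' x Qs' cx dx; have := Tm s'; rewrite /time.
  have : dn (gr g) s' x %/ l0 <= 2 * M by rewrite -[2 * M](mulnK _ l00) leq_div2r // -mulnA.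
  by lia.
- by rewrite E0.
- move=> s' b v' B1 B2 Qs' Ab; rewrite ET => -[e1 E1 le1] [e2 E2 le2] h1 h2.
  have [|k uE hk] := small e1; first by lia.
  have [|k' uE' hk'] := small e2; first by lia.
  have [||m oE mk] := sp2 b v' s' k k'.
  + by rewrite Qs' Ab /= (_ : (c b).1.2 s' = Some e1).
  + by rewrite Ab (_ : (c v').1.2 b = Some e2).
  rewrite /est tabE oE; apply: est_omin; right.
  by have := leq_mul mk (leqnn uh); rewrite mulnDl l0uh; lia.
by lia.
Qed.

End Scale.

(** * Random delays *)

Section Delays.
Local Open Scope nat_scope.
Variables (n m T0 cw N J T1 x b : nat).
Hypotheses (n1 : 1 < n) (m0 : 0 < m).

Definition in_window c t k d := (k + d <= t + c) && (t <= k + d + c).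

Lemma card_window c t k : #|[pred d : 'I_m | in_window c t k d]| <= 2 * c + 1.
Proof.
rewrite addn1 -[X in _ <= X]card_ord.
apply: (leq_card_inj (f := fun d : 'I_m => inord (k + d + c - t) : 'I_(2 * c).+1)) => //.
move=> d d'; rewrite !inE /in_window => /andP[h1 h2] /andP[h3 h4] /(congr1 val).
by rewrite /= !inordK; try lia; move=> h; apply/val_inj => /=; lia.
Qed.

(** Four times a bound on the expected number of roots in the window, plus [x] for concentration,
    and never more than all [N] roots. *)
Definition load j := minn N ((4 * (2 * (cw * 2 ^ j) + 1) * N) %/ m + 1 + x).

Definition overloaded (tau : 'I_n -> option 'I_T0) (theta : 'I_n -> nat) : bool :=
  [exists j : 'I_J.+1, exists t : 'I_T1,
    load j < #|[pred s | if tau s is Some k then in_window (cw * 2 ^ j) t k (theta s) else false]|].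

(* The delays of the sources are random, so that few of them are active at the
   same time near a given vertex. *)
Lemma delay_family : T0.+1 <= n.+1 ^ b -> J.+1 * T1 * n ^ (b + 6) <= 2 ^ x ->
  exists f : (b + 6).-tuple 'I_n -> 'I_n -> 'I_m,
  forall tau, #|[pred s | isSome (tau s)]| <= N ->
    n * #|[pred z | overloaded tau (f z)]| < n ^ (b + 6).
Proof.
move=> hT hx; pose Wt := {ffun 'I_n -> 'I_m}; pose g := n * n * b + 5.
pose bad (tau : {ffun 'I_n -> option 'I_T0}) (th : Wt) :=
  (#|[pred s | isSome (tau s)]| <= N) && overloaded tau (fun s => th s).
have [] := @good_family {ffun 'I_n -> option 'I_T0} Wt ((b + 6).-tuple 'I_n) bad g.
- by rewrite card_ffun card_ord expn_gt0 card_ord m0.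
- rewrite card_ffun card_option !card_ord /g expnD.
  (* The family must serve every map [tau]; counting these maps fixes [g]. *)
  have : T0.+1 ^ n <= 2 ^ (n * n * b).
    apply: leq_trans (leq_expl n hT) _; rewrite -expnM -mulnA [2 ^ _]expnM [b * n]mulnC.
    by apply: leq_expl; exact: ltn_expl.
  by have := expn_gt0 2 (n * n * b); move: (2 ^ _) (_ ^ n); lia.
- move=> tau; rewrite card_tuple card_ord.
  case: (boolP (#|[pred s | isSome (tau s)]| <= N)) => [tN|no]; last first.
    by rewrite eq_card0 // => th; rewrite !inE /bad (negbTE no).
  pose A (p : 'I_J.+1 * 'I_T1) s := [pred d : 'I_m |
    if tau s is Some k then in_window (cw * 2 ^ p.1) p.2 k d else false].
  pose B (p : 'I_J.+1 * 'I_T1) := [pred th : Wt | load p.1 < #|[pred s | A p s (th s)]|].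
  have each p : #|B p| * 2 ^ x <= #|Wt|.
    have AS s : s \notin [pred s | isSome (tau s)] -> A p s =1 pred0.
      by rewrite inE /A => + d /=; case: (tau s).
    case: (leqP (N) ((4 * (2 * (cw * 2 ^ p.1) + 1) * N) %/ m + 1 + x)) => h.
      rewrite eq_card0 // => th; apply/negbTE; rewrite !inE -leqNgt /load (minn_idPl h).
      apply: leq_trans tN; apply: subset_leq_card; apply/subsetP => s; rewrite !inE.
      by case: (tau s).
    set c := 2 * (cw * 2 ^ p.1) + 1 in h; set L := (4 * c * N) %/ m + 1 in h.
    have Ac s : #|[pred d | A p s d]| <= c.
      rewrite /A; case: (tau s) => [k|]; first exact: card_window.
      by rewrite eq_card0.
    (* A window longer than the range of the delays would already make the load bound [N]. *)
    have cW : c <= #|'I_m|.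
      rewrite card_ord leqNgt; apply/negP => mc; move: h; rewrite ltnNge => /negP; apply.
      apply: leq_trans (leq_addr _ _); apply: leq_trans (leq_addr _ _).
      rewrite -{1}[N](mulnK _ m0) leq_div2r // mulnC leq_mul //.
      by apply: leq_trans (ltnW mc) _; lia.
    have cL : 4 * c * N <= #|'I_m| * L.
      by rewrite card_ord /L addn1 mulnC [m * _]mulnC ltnW // mulnC ltn_ceil.
    have := @card_hits_le _ 'I_m [pred s | isSome (tau s)] (A p) c N L (L + x).+1 tN AS Ac cW cL.
    rewrite (_ : #|[pred f : Wt | _]| = #|B p|); last first.
      by apply: eq_card => th; rewrite !inE /load -/c -/L (minn_idPr (ltnW h)).
    rewrite expnS expnD [#|Wt|]card_ffun card_ord.
    have := expn_gt0 2 L; move: (2 ^ L) => y y0 h2.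
    by rewrite -(leq_pmul2l y0); apply: leq_trans h2; lia.
  apply: leq_trans (_ : (\sum_p #|B p|) * n ^ (b + 6) <= _).
    rewrite leq_mul2r; apply/orP; right.
    apply: leq_trans (_ : #|\bigcup_p [set th in B p]| <= _).
      apply: subset_leq_card; apply/subsetP => th; rewrite !inE => /andP[_].
      move=> /existsP[j /existsP[t h]]; apply/bigcupP; exists (j, t) => //.
      by rewrite !inE.
    apply: leq_trans (_ : \sum_p #|[set th in B p]| <= _).
      by apply: (big_rec2 (fun (u : {set Wt}) (v : nat) => #|u| <= v)); rewrite ?cards0 // => p u v _ h;
        apply: leq_trans (leq_card_setU _ _) _; rewrite leq_add2l.
    by apply: leq_sum => p _; rewrite cardsE.
  rewrite -(@leq_pmul2r (2 ^ x)) ?expn_gt0 //.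
  apply: leq_trans (_ : (\sum_p #|B p| * 2 ^ x) * n ^ (b + 6) <= _).
    by rewrite -big_distrl /= mulnAC.
  apply: leq_trans (_ : (\sum_(p : 'I_J.+1 * 'I_T1) #|Wt|) * n ^ (b + 6) <= _).
    by rewrite leq_mul2r leq_sum ?orbT // => p _; exact: each.
  by rewrite sum_nat_const card_prod !card_ord mulnC mulnA [_ * #|Wt|]mulnC leq_mul2l mulnC hx orbT.
move=> f fP; exists (fun z s => f z s) => tau tN.
have tauE : overloaded tau =1 overloaded [ffun s => tau s].
  move=> th; rewrite /overloaded; apply: eq_existsb => j; apply: eq_existsb => t.
  by congr (_ < _); apply: eq_card => s; rewrite !inE ffunE.
apply: leq_ltn_trans (_ : n * (g.-1) < _).
  rewrite leq_mul2l; apply/orP; right; have := fP [ffun s => tau s].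
  have -> : #|[pred z | bad [ffun s => tau s] (f z)]| = #|[pred z | overloaded tau (fun s => f z s)]|.
    apply: eq_card => z; rewrite !inE /bad tauE (_ : #|_| <= N) //.
    by apply: leq_trans tN; rewrite (eq_card (B := [pred s | isSome (tau s)])) // => s; rewrite !inE ffunE.
  by move=> h; rewrite -ltnS prednK; [exact: h | rewrite /g addnC].
have h6 : n ^ (b + 6) = n ^ b * (n * n * n * (n * n * n)) by rewrite expnD !expnS expn0; lia.
have n3 : 8 <= n * n * n by have := leq_mul (leq_mul n1 n1) n1.
have nn : n <= n * n * n by have := leq_mul (leq_mul n1 n1) (leqnn n); lia.
have bb : b < n ^ b by exact: ltn_expl.
have := leq_mul bb (leq_mul n3 (leqnn (n * n * n))); rewrite -h6.
have -> : n * g.-1 = n * n * n * b + 4 * n by rewrite /g addnS /=; lia.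
by move: (n * n * n) n3 nn => y; lia.
Qed.

End Delays.

(** * Windows seen through coarse estimates *)

Section Windows.
Local Open Scope nat_scope.
Variables (l0 m k0 M : nat).
Hypotheses (l00 : 0 < l0) (m0 : 0 < m) (ME : M = k0 * m).

Lemma coarse_error d e X : d <= X * m -> e * m <= d * m + 2 * d -> e <= d + 2 * X.
Proof. by move=> h1 h2; rewrite -(leq_pmul2r m0) mulnDl -mulnA; lia. Qed.

(** Coarse estimates have relative error at most [2 / m], hence are off by [O(k0)] windows; along an
    edge of at most [4 * P] windows the window numbers differ by [O(P + k0)]. A vertex can thus tell
    from its own estimates which roots its neighbours may send. *)
Lemma window_shift P a d e e' w : 0 < k0 -> 0 < P -> a <= e -> d <= e' -> d <= a + w -> a <= d + w ->
  e * m <= a * m + 2 * a -> e' * m <= d * m + 2 * d -> w <= 4 * P * l0 ->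
  e %/ l0 <= 6 * M ->
  e' %/ l0 <= e %/ l0 + 12 * P + 14 * k0 /\ e %/ l0 <= e' %/ l0 + 14 * k0 + 4 * P.
Proof.
move=> k00 P0 ae de da ad he he' hw kM.
have k1 := ltn_ceil e l00; have k2 := ltn_ceil e' l00.
have M0 : 0 < M by rewrite ME muln_gt0 k00.
have aM : a <= 7 * k0 * l0 * m.
  have : (e %/ l0).+1 * l0 <= 7 * M * l0 by rewrite leq_mul2r; apply/orP; right; lia.
  by rewrite ME; lia.
have e1 := coarse_error aM he.
have dM : d <= (7 * k0 * l0 + 4 * P * l0) * m.
  have := leq_mul (leqnn (4 * P * l0)) m0; rewrite mulnDl; lia.
have e2 := coarse_error dM he'.
have k3 := leq_divM e l0; have k4 := leq_divM e' l0.
split; rewrite -ltnS -(ltn_pmul2r l00) ?mulSn !mulnDl.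
  by apply: leq_ltn_trans k4 _; rewrite mulSn in k1; lia.
by apply: leq_ltn_trans k3 _; rewrite mulSn in k2; lia.
Qed.

Lemma window_complete t th P d e : 0 < k0 -> 0 < P -> d <= e -> d <= 2 * (M * l0) ->
  e * m <= d * m + 2 * d -> t * l0 <= d + (th + 4 * P) * l0 ->
  d + th * l0 <= (t + 4 * P) * l0 ->
  [/\ e %/ l0 <= 6 * M, t <= e %/ l0 + 1 + th + 4 * P & e %/ l0 + th <= t + 4 * P + 4 * k0].
Proof.
move=> k00 P0 de dM he h1 h2.
have dM' : d <= (2 * k0 * l0) * m by move: dM; rewrite ME; lia.
have e1 := coarse_error dM' he; have k3 := leq_divM e l0; have k1 := ltn_ceil e l00.
have km : k0 <= M by rewrite ME leq_pmulr.
split; rewrite -(leq_pmul2r l00).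
- by apply: leq_trans k3 _; have := leq_mul km (leqnn l0); lia.
- by apply: leq_trans h1 _; rewrite !mulnDl; move: k1; rewrite mulSn; lia.
- by move: h2; rewrite !mulnDl; lia.
Qed.

End Windows.

(** * One scale with randomly delayed roots *)

Section DelayedScale.
Local Open Scope nat_scope.
Variables (n W : nat) (PD : Type) (prep : ('I_n -> 'I_n -> option 'I_W) -> ('I_n -> PD) -> Prop).
Variables (pc : nat) (mc : nat -> nat).
Hypothesis eng : engine prep pc mc.
Variable pd0 : PD.
Variables (Q A : pred 'I_n) (N : nat).
Hypotheses (n1 : 1 < n) (hubs_sources : forall b, A b -> Q b) (QN : #|Q| <= N) (Nn : N <= n).

(* A vertex holds its row of the short-cut weights and coarse estimates of its
   distances to the sources. *)
Definition local_view : Type := (('I_n -> option nat) * ('I_n -> option nat))%type.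

Definition weights_of (st : 'I_n -> local_view) : table n := fun x y => (st y).1 x.
Definition coarse_of (st : 'I_n -> local_view) : table n := fun s x => (st x).2 s.

Definition coarse (G : wgraph n) (m : nat) (st : 'I_n -> local_view) : Prop :=
  sound G (coarse_of st) /\ forall s x, Q s -> connected G s x ->
    est (coarse_of st) s x (dn G s x + 2 * dn G s x %/ m).

Definition shortcuts (G : wgraph n) (st : 'I_n -> local_view) : Prop :=
  forall l, distances A l (weights_of st) G.

Variables (l0 u0 M C J e0 D' : nat).
Hypotheses (u00 : 0 < u0) (l0E : l0 = 8 * M * u0) (M4 : 4 <= M) (MJ : M <= 2 ^ J).
Hypotheses (eC : e0 + 13 <= C) (eM : e0 <= M) (WE : 8 * C * M + 2 <= W).
Hypothesis D3 : 2 * D' <= 3 * (M * l0).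

(** Delays are below [M], the range [2 * D] spans [2 * M] windows, and 4 steps are left for the last
    hops. *)
Definition Tmax := 3 * M + 4.

Definition scale_cost (K : nat -> nat) :=
  J.+1 * pc + (\sum_(t < Tmax) macro_cost mc J K t + (pc + mc N)).

Lemma solves_first_scale : solves (scale_cost (fun=> N))
  (fun G (c : 'I_n -> local_view * ('I_n -> option nat)) =>
     shortcuts G (state_of c) /\ known Q M G (M * l0) e0 (tab c))
  (fun G c => shortcuts G (state_of c) /\ known Q M G D' (e0 + 8) (tab c)).
Proof.
apply: (@solves_scale n W PD prep pc mc eng pd0 local_view (fun _ z => z.1)
  (fun _ _ _ _ => Q) (fun _ _ _ _ => Q) Q A l0 u0 M C J Tmax N e0 (fun=> N) (fun=> 0)
  u00 l0E M4 MJ eC eM WE _ hubs_sources QN Nn _ D' _ id) => //.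
- by move=> _; rewrite /Tmax; lia.
- by move=> G c [sh kn]; split=> //; exact: sh.
- by move=> G c c' [sh _] stE kn; rewrite stE.
Qed.

Variables (m k0 b x : nat).
Hypotheses (m0 : 0 < m) (ME : M = k0 * m).

(** [c0] covers the slack [4 * k0] of [window_complete]; [cw] covers the resulting test at one end
    of an edge followed by the shift of [window_shift] to the other end. *)
Let c0 := 14 * k0 + 8.
Let cw := 2 * c0 + 10.
Definition times := 7 * M + (c0 + 6) * 2 ^ J.
Definition steps := times + M + cw * 2 ^ J.
Definition delayed_load := load M cw N x.
Hypothesis timesE : times.+1 <= n.+1 ^ b.
Hypothesis stepsE : J.+1 * steps * n ^ (b + 6) <= 2 ^ x.

(** The delays are agreed upon once the coarse estimates are known, so every vertex can recognise
    the seeds that would overload it. *)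
Lemma solves_delayed_scale : solves ((b + 6) * (b + 6).+2 + scale_cost delayed_load)
  (fun G (c : 'I_n -> local_view * ('I_n -> option nat)) => [/\ shortcuts G (state_of c),
     coarse G m (state_of c) & known Q M G (M * l0) e0 (tab c)])
  (fun G c => [/\ shortcuts G (state_of c), coarse G m (state_of c) &
     known Q M G D' (e0 + 8) (tab c)]).
Proof.
have M0 : 0 < M by lia.
have l00 : 0 < l0 by rewrite l0E !muln_gt0 u00 /=; lia.
have [f fP] := @delay_family n M _ cw N J _ x b n1 M0 timesE stepsE.
pose tau (z : local_view) s : option 'I_times :=
  if Q s then obind (fun e => insub (e %/ l0)) (z.2 s) else None.
apply: (@solves_agree n _ _ _ (b + 6) _ _ _
  (fun _ (z : local_view * ('I_n -> option nat)) d =>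
     overloaded M cw N J steps x (tau z.1) (fun s => f d s))).
  move=> G c _.
  have small v : n * #|[pred d | overloaded M cw N J steps x (tau (c v).1) (fun s => f d s)]| < n ^ (b + 6).
    apply: fP; apply: leq_trans QN; apply: subset_leq_card; apply/subsetP => s.
    by rewrite !inE /tau unfold_in; case: (Q s).
  have n0 : 0 < n by exact: ltnW.
  rewrite -(ltn_pmul2l n0) big_distrr /=.
  apply: leq_ltn_trans (_ : \sum_(v < n) (n ^ (b + 6)).-1 < _).
    by apply: leq_sum => v _; have := small v; lia.
  rewrite sum_nat_const card_ord ltn_mul2l n0 /=.
  by rewrite prednK // expn_gt0 n0.
move=> d; pose theta s : nat := f d s.
(* [nearf] is the test at the sending end, [supf] the prediction at the receiving end; each uses
   only the local coarse estimates. *)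
pose nearf (_ : 'I_n) (z : local_view) j t s := Q s && if z.2 s is Some e then
  [&& e %/ l0 <= 6 * M, t <= e %/ l0 + 1 + theta s + 4 * 2 ^ j &
      e %/ l0 + theta s <= t + (4 + c0) * 2 ^ j] else false.
pose supf (_ : 'I_n) (z : local_view) j t s := if tau z s is Some k
  then in_window (cw * 2 ^ j) t k (theta s) else false.
have loadN j : delayed_load j <= N by exact: geq_minl.
apply: (@solves_scale n W PD prep pc mc eng pd0 local_view (fun _ z => z.1)
  nearf supf Q A l0 u0 M C J Tmax N e0 delayed_load theta
  u00 l0E M4 MJ eC eM WE _ hubs_sources QN Nn _ D' _ id) => //.
- by move=> j; exact: leq_trans (loadN j) Nn.
- by move=> s; rewrite /Tmax /theta; have := ltn_ord (f d s); lia.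
- move=> G c [[sh [cs ce] kn] no]; split=> //.
  have le_est s y e : Q s -> (state_of c y).2 s = Some e ->
      e * m <= dn G s y * m + 2 * dn G s y.
    move=> Qs E; have [sy _] := cs s y e E; have [e' E' le] := ce s y Qs sy.
    move: E'; rewrite /coarse_of E => -[E']; rewrite -{}E' in le.
    apply: leq_trans (leq_mul le (leqnn m)) _.
    by rewrite mulnDl leq_add2l leq_divM.
  split.
  + move=> y j t jJ; case: (ltnP t steps) => ts.
      have := no y; rewrite /overloaded => /existsPn/(_ (Ordinal (jJ : j < J.+1))).
      by move=> /existsPn/(_ (Ordinal ts)); rewrite -leqNgt; apply.
    rewrite eq_card0 // => s; apply/negbTE; rewrite unfold_in /supf.
    case: (tau _ s) => // k; rewrite /in_window negb_and -!ltnNge; apply/orP; right.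
    have p2 : 2 ^ j <= 2 ^ J by rewrite leq_exp2l.
    have := leq_mul (leqnn cw) p2; move: ts (ltn_ord k) (ltn_ord (f d s)).
    by rewrite /steps /theta; lia.
  + move=> x' y w j t s jJ Qs; rewrite /nearf /supf /tau Qs /=.
    case E: ((state_of c x').2 s) => [e|//] /and3P[h1 h2 h3] awE /andP[wl _].
    have [d1 _ _] := sh l0; have [xy wd] := d1 _ _ _ awE.
    have [sx ge] := cs _ _ _ E; have sy := connected_trans sx xy.
    have [e' E' _] := ce s y Qs sy; have [_ ge'] := cs _ _ _ E'.
    have tri1 := dn_tri sx xy; have tri2 := dn_tri sy (connected_sym xy).
    rewrite [dn G y x']dn_sym in tri2.
    have P0 : 0 < 2 ^ j by rewrite expn_gt0.
    have k00 : 0 < k0 by case: (k0) ME M0 => // ->.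
    have pJ : 2 ^ j <= 2 ^ J by rewrite leq_exp2l.
    have [||||||||w1 w2] := @window_shift l0 m k0 M l00 m0 ME (2 ^ j) (dn G s x') (dn G s y) e e' w k00 P0 => //.
    - by lia.
    - by lia.
    - exact: le_est.
    - exact: le_est.
    rewrite (_ : (state_of c y).2 s = Some e') //=; case: insubP => [k _ kE|/negP[]]; last first.
      have := leq_mul (leqnn k0) (leq_trans P0 pJ); move: w1 h1 pJ; rewrite /times /c0.
      by move: (2 ^ j) (2 ^ J) (e %/ _) (e' %/ _); lia.
    rewrite kE /in_window; move: h2 h3 w1 w2 P0; rewrite /cw /c0.
    move: (2 ^ j) (_ %/ _) (_ %/ _) (theta s) => P k1 k2 th h2 h3 w1 w2 P0.
    by have := leq_mul (leqnn k0) P0; lia.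
  + move=> j t s y Qs sy h1 h2 h3; rewrite /nearf Qs.
    have [e E le] := ce s y Qs sy; rewrite (_ : (state_of c y).2 s = Some e) //.
    have le2 := le_est s y e Qs E; have [_ ge] := cs s y e E.
    have P0 : 0 < 2 ^ j by rewrite expn_gt0.
    have k00 : 0 < k0 by case: (k0) ME M0 => // ->.
    have [|||||-> -> w3] := @window_complete l0 m k0 M l00 m0 ME t (theta s) (2 ^ j) (dn G s y) e k00 P0 => //.
    rewrite /=; move: w3 P0; rewrite /c0; move: (2 ^ j) (_ %/ _) (theta s) => P k th w3 P0.
    by have := leq_mul (leqnn k0) P0; lia.
- by move=> G c c' [[sh co _] _] stE kn; rewrite stE.
Qed.

End DelayedScale.

(** * Successive precisions *)

Section Levels.
Local Open Scope nat_scope.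
Variables (n W : nat) (PD : Type) (prep : ('I_n -> 'I_n -> option 'I_W) -> ('I_n -> PD) -> Prop).
Variables (pc : nat) (mc : nat -> nat).
Hypothesis eng : engine prep pc mc.
Variable pd0 : PD.
Variables (Q A : pred 'I_n) (N : nat).
Hypotheses (n1 : 1 < n) (hubs_sources : forall b, A b -> Q b) (QN : #|Q| <= N) (Nn : N <= n).
Variables (I qm b x : nat).

(** Each of the [I] scales adds 8 to the numerator of the error, so precision [coarseness * 2 ^ q]
    ends with error at most [1 / 2 ^ q]; the summand 4 keeps the precision at least 4. *)
Definition coarseness := 8 * I + 4.
Definition precision q := coarseness * 2 ^ q.
(** [3 ^ i * 2 ^ (I - i)] realises growth by [3 / 2] in integers. When the precision doubles, the
    unit shrinks by 4 and the window by 2, so the range of scale [i] does not depend on [q]. *)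
Definition unit_at q i := 3 ^ i * 2 ^ (I - i) * 4 ^ (qm - q).
Definition window_at q i := 8 * precision q * unit_at q i.
Definition range i := 8 * coarseness * coarseness * 4 ^ qm * (3 ^ i * 2 ^ (I - i)).

Lemma range_at q i : q <= qm -> precision q * window_at q i = range i.
Proof.
move=> qq; rewrite /window_at /precision /unit_at /range.
have -> : 4 ^ qm = 2 ^ q * 2 ^ q * 4 ^ (qm - q).
  by rewrite -expnMn -expnD subnKC.
by lia.
Qed.

Lemma range_step i : i < I -> 2 * range i.+1 = 3 * range i.
Proof.
move=> iI; have E : 2 ^ (I - i) = 2 * 2 ^ (I - i.+1) by rewrite -expnS subnSK.
by rewrite /range E expnS; lia.
Qed.

Hypothesis WE : 8 * (8 * I + 13) * precision qm + 2 <= W.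
Hypothesis timesE : forall q, q <= qm ->
  times (precision q) (lg (precision q)) (2 * coarseness) < n.+1 ^ b.
Hypothesis stepsE : forall q, q <= qm ->
  (lg (precision q)).+1 * steps (precision q) (lg (precision q)) (2 * coarseness) * n ^ (b + 6)
    <= 2 ^ x.

(** The first level has no coarse estimates and treats all roots as relevant; its precision is only
    polylogarithmic. *)
Definition level_load q j :=
  if q is 0 then N else delayed_load N (precision q) (2 * coarseness) x j.

Definition level_cost q := (b + 6) * (b + 6).+2 +
  scale_cost pc mc N (precision q) (lg (precision q)) (level_load q).

Definition local_state : Type := (local_view n * ('I_n -> option nat))%type.

Definition reliable q G (c : 'I_n -> local_state) :=
  shortcuts A G (state_of c) /\ (0 < q -> coarse Q G (2 ^ q.-1) (state_of c)).

Lemma solves_scale_at q i : q <= qm -> i < I ->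
  solves (level_cost q)
    (fun G c => reliable q G c /\ known Q (precision q) G (range i) (8 * i) (tab c))
    (fun G c => reliable q G c /\ known Q (precision q) G (range i.+1) (8 * i.+1) (tab c)).
Proof.
move=> qq iI.
have u0 : 0 < unit_at q i by rewrite /unit_at !muln_gt0 !expn_gt0.
have p0 : 0 < 2 ^ q by rewrite expn_gt0.
have P0 : coarseness <= precision q by rewrite /precision leq_pmulr.
have M4 : 4 <= precision q by apply: leq_trans P0; rewrite /coarseness; lia.
have MJ : precision q <= 2 ^ lg (precision q) by exact/ltnW/ltn_lg.
have eC : 8 * i + 13 <= 8 * I + 13 by lia.
have eM : 8 * i <= precision q by apply: leq_trans P0; rewrite /coarseness; lia.
have We : 8 * (8 * I + 13) * precision q + 2 <= W.
  apply: leq_trans WE; rewrite leq_add2r leq_mul2l /precision leq_mul2l.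
  by rewrite leq_exp2l // qq !orbT.
have D3 : 2 * range i.+1 <= 3 * (precision q * window_at q i).
  by rewrite range_at // range_step.
have e8 : 8 * i.+1 = 8 * i + 8 by lia.
case: (posnP q) => [q0|q0].
  apply: (@solves_pad _ _ _ _ (scale_cost pc mc N (precision q) (lg (precision q)) (fun=> N))).
    apply: solves_conseq (solves_first_scale eng pd0 n1 hubs_sources QN Nn u0 erefl M4 MJ eC eM We D3) _ _.
      by move=> G c [[sh _] kn]; rewrite range_at.
    by move=> G c [sh kn]; rewrite e8; split=> //; split=> //; rewrite q0.
  by rewrite /level_cost q0 leq_addl.
have q1 : precision q = (2 * coarseness) * 2 ^ q.-1.
  by rewrite /precision -{1}(prednK q0) expnS; lia.
have m0 : 0 < 2 ^ q.-1 by rewrite expn_gt0.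
have lE : level_load q = delayed_load N (precision q) (2 * coarseness) x.
  by rewrite /level_load; case: (q) q0.
rewrite /level_cost lE.
apply: solves_conseq (solves_delayed_scale eng pd0 n1 hubs_sources QN Nn u0 erefl M4 MJ eC eM We D3
  m0 q1 (timesE qq) (stepsE qq)) _ _.
  by move=> G c [[sh co] kn]; rewrite range_at //; split=> //; exact: co.
by move=> G c [sh co kn]; rewrite e8.
Qed.

(* All distances are at least [range 0], which is the length of an edge of
   weight one after scaling. *)
Definition scaled_range (G : wgraph n) : Prop :=
  (forall s v, connected G s v -> s != v -> dn G s v <= range 0 ->
     exists2 w, wadj G s v = Some w & w <= dn G s v) /\
  (forall s v, dn G s v <= range I).

(** Every level restarts from single hops, which suffice up to [range 0]; the previous level only
    serves to select the near roots. At the end the new table becomes the coarse estimate. *)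
Lemma solves_level q : q <= qm -> solves (I * level_cost q)
  (fun G c => scaled_range G /\ reliable q G c)
  (fun G c => scaled_range G /\ reliable q.+1 G c).
Proof.
move=> qq.
pose Iv i G c := scaled_range G /\
  (reliable q G c /\ known Q (precision q) G (range i) (8 * i) (tab c)).
have p0 : 0 < 2 ^ q by rewrite expn_gt0.
have -> : I * level_cost q = 0 + ((\sum_(i < I) level_cost q) + 0).
  by rewrite sum_nat_const card_ord addn0.
apply: (@solves_seq _ _ _ _ _ _ _ _ (Iv 0)).
  apply: (@solves_idle _ _ _ _ _ _ _ (fun v (z : local_state) =>
    (z.1, fun s => if s == v then Some 0 else z.1.1 s))).
  move=> G c [sr [sh co]]; split=> //; split=> //; have [d1 d2 _] := sh 0.
  split.
    move=> s y e; rewrite /tab /=; case: eqP => [->|_ E].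
      by move=> [<-]; rewrite dn_self; split=> //; exact: connected_refl.
    exact: d1 E.
  move=> s y Qs sy dsy; rewrite /est /tab /=; case: eqP => [_|/eqP ne]; first by exists 0.
  have [w wE le] := (sr.1 s y sy ne dsy); have [e eE le'] := d2 s y w wE.
  by exists e => //; apply: leq_trans le' (leq_trans le (leq_addr _ _)).
apply: (@solves_seq _ _ _ _ _ _ _ _ (Iv I)).
  apply: (@solves_loop _ _ _ (fun=> level_cost q)) => i iI.
  apply: (solves_lift (f := fun _ z => z) (h := fun _ _ z => z) (solves_scale_at qq iI)).
  by move=> G c [sr h]; exists G; split=> // d hd; split.
apply: (@solves_idle _ _ _ _ _ _ _ (fun v (z : local_state) => ((z.1.1, z.2), z.2))).
move=> G c [sr [[sh co] [so kn]]]; split=> //; split=> // _.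
split=> // s y Qs sy; have [e eE le] := kn s y Qs sy (sr.2 s y).
exists e => //; apply: leq_trans le _; rewrite leq_add2l /precision /coarseness.
have -> : 2 * dn G s y %/ 2 ^ q = ((8 * I + 4) * (2 * dn G s y)) %/ ((8 * I + 4) * 2 ^ q).
  by rewrite divnMl // addn4.
by apply: leq_div2r; rewrite mulnA leq_mul2r; apply/orP; right; lia.
Qed.

Lemma solves_levels : solves (\sum_(q < qm.+1) I * level_cost q)
  (fun G c => scaled_range G /\ shortcuts A G (state_of c))
  (fun G c => coarse Q G (2 ^ qm) (state_of c)).
Proof.
pose Iv q G c := scaled_range G /\ reliable q G c.
refine (@solves_conseq _ _ _ _ _ (Iv 0) _ (Iv qm.+1) _
  (@solves_loop _ _ _ (fun q => I * level_cost q) qm.+1 Iv _) _ _).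
- by move=> q qq; exact: solves_level.
- by move=> G c [sr sh]; split=> //; split.
- by move=> G c [_ [_ co]]; exact: co.
Qed.

End Levels.

(** * Nearest vertices and hubs *)

Section Balls.
Local Open Scope nat_scope.
Variables (n k B : nat).

(** Lexicographic order by distance, then identifier, which breaks ties in the same way for all
    vertices. *)
Definition key (e : nat) (u : 'I_n) := e * n + u.

Lemma key_le e e' u : e <= e' -> key e u <= key e' u.
Proof. by move=> h; rewrite leq_add2r leq_mul2r h orbT. Qed.

Lemma key_dist e e' u u' : key e u < key e' u' -> e <= e'.
Proof.
rewrite /key => h; rewrite leqNgt; apply/negP => lt.
by have := leq_mul lt (leqnn n); move: (ltn_ord u'); rewrite mulSn; lia.
Qed.

Lemma key_lt e e' u u' : e < e' -> key e u < key e' u'.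
Proof. by rewrite /key => h; have := leq_mul h (leqnn n); rewrite mulSn; have := ltn_ord u; lia. Qed.

Lemma key_inj e e' u u' : key e u = key e' u' -> u = u'.
Proof.
rewrite /key => h; apply/val_inj => /=.
by have := congr1 (modn^~ n) h; rewrite !modnMDl !modn_small.
Qed.

Definition before (f : 'I_n -> option 'I_B) m : pred 'I_n :=
  fun x => if f x is Some e then key e x < m else false.

Definition best (f : 'I_n -> option 'I_B) (u : 'I_n) : option 'I_B :=
  if f u is Some e then if #|before f (key e u)| < k then Some e else None else None.

Hypothesis k0 : 0 < k.

Lemma card_best f : #|[pred u | isSome (best f u)]| <= k.
Proof.
rewrite -(prednK k0) -[X in _ <= X]card_ord.
pose r u := if f u is Some e then #|before f (key e u)| else 0.
have rk u : isSome (best f u) -> exists e, [/\ f u = Some e, r u < k & r u = #|before f (key e u)|].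
  by rewrite /best /r; case: (f u) => [e|//]; case: ifP => // h _; exists e.
have mono u u' e e' : f u = Some e -> f u' = Some e' -> key e u < key e' u' ->
    #|before f (key e u)| < #|before f (key e' u')|.
  move=> E E' lt; apply: proper_card; apply/properP; split.
    apply/subsetP => y; rewrite !unfold_in /before; case: (f y) => // e1 h.
    exact: ltn_trans lt.
  by exists u; rewrite !unfold_in /before E ?ltnn.
apply: (leq_card_inj (f := fun u => inord (r u) : 'I_k.-1.+1)) => // u u'.
rewrite !inE => /rk[e [E h rE]] /rk[e' [E' h' rE']] /(congr1 val).
rewrite /= !inordK ?prednK // rE rE' => eq.
case: (ltngtP (key e u) (key e' u')) => [lt|lt|]; last exact: key_inj.
- by have := mono _ _ _ _ E E' lt; rewrite eq ltnn.
- by have := mono _ _ _ _ E' E lt; rewrite eq ltnn.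
Qed.

Lemma best_some f u e : best f u = Some e -> f u = Some e.
Proof. by rewrite /best; case: (f u) => // e'; case: ifP. Qed.

Section Rank.
Variable G : wgraph n.
Implicit Types (L f : 'I_n -> option 'I_B).

Definition closer v u : pred 'I_n :=
  fun y => `[< connected G v y >] && (key (dn G v y) y < key (dn G v u) u).

Definition in_ball v u : Prop := connected G v u /\ #|closer v u| < k.

Definition sound_list v f : Prop :=
  forall u e, f u = Some e -> connected G v u /\ dn G v u <= e.

(** Sound entries can only be too large, so vertices listed before [u] really are closer, and there
    are fewer than [k] of them. *)
Lemma best_ball v f u e : sound_list v f -> in_ball v u -> f u = Some e ->
  e = dn G v u :> nat -> best f u = Some e.
Proof.
move=> sf [vu h] E eE; rewrite /best E.
rewrite (leq_ltn_trans _ h) //; apply: subset_leq_card; apply/subsetP => y.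
rewrite !unfold_in /before /closer; case Ey: (f y) => [e'|//].
have [vy le] := sf _ _ Ey; rewrite eE => lt; apply/andP; split; first exact/asboolP.
by apply: leq_ltn_trans (key_le _ le) lt.
Qed.

Lemma closer_sub v w u y : connected G v w -> connected G w u ->
  dn G v u = dn G v w + dn G w u -> closer w u y -> closer v u y.
Proof.
move=> vw wu E /andP[/asboolP wy lt]; apply/andP; split.
  exact/asboolP/(connected_trans vw wy).
have tri := dn_tri vw wy; have le := key_dist lt.
case: (ltnP (dn G v y) (dn G v u)) => [h|h]; first exact: key_lt.
have e1 : dn G w y = dn G w u by lia.
by have -> : dn G v y = dn G v u; [lia | move: lt; rewrite e1 /key !ltn_add2l].
Qed.

Lemma ball_suffix v w u : connected G v w -> connected G w u ->
  dn G v u = dn G v w + dn G w u -> in_ball v u -> in_ball w u.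
Proof.
move=> vw wu E [_ h]; split=> //; apply: leq_ltn_trans h.
by apply: subset_leq_card; apply/subsetP => y; apply: closer_sub.
Qed.

(** Together with [ball_suffix]: on a shortest path from [v] to a member of its ball, every vertex
    is in the ball of [v] and has the endpoint in its own ball. This is why truncated lists can be
    composed. *)
Lemma ball_prefix v w u : connected G v w -> connected G w u ->
  dn G v u = dn G v w + dn G w u -> in_ball v u -> in_ball v w.
Proof.
move=> vw wu E; case: (eqVneq w u) => [->//|ne] [_ h]; split=> //.
have d0 := dn_gt0 wu ne; apply: leq_ltn_trans h.
apply: subset_leq_card; apply/subsetP => y; rewrite !unfold_in /closer => /andP[-> h].
by apply: ltn_trans h _; apply: key_lt; lia.
Qed.

Definition list_exact h v f : Prop :=
  [/\ sound_list v f, #|[pred u | isSome (f u)]| <= k &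
    forall u, in_ball v u -> (exists p, [/\ shortest G v p, last v p = u & size p <= 2 ^ h]) ->
      exists2 e, f u = Some e & e = dn G v u :> nat].

Hypothesis Bd : forall u v, dn G u v < B.

Definition capped e : option 'I_B := insub e.

Lemma capped_some e (e' : 'I_B) : capped e = Some e' -> e = e' :> nat.
Proof. by rewrite /capped; case: insubP => // y _ <- [->]. Qed.

Lemma capped_dn u v : exists2 e, capped (dn G u v) = Some e & e = dn G u v :> nat.
Proof. by rewrite /capped; case: insubP => [e _ eE|/negP[]]; [exists e | exact: Bd]. Qed.

Definition adjacent_list v (adj : 'I_n -> option nat) (u : 'I_n) : option 'I_B :=
  if u == v then capped 0 else obind capped (adj u).

Lemma initial_list v : list_exact 0 v (best (adjacent_list v (wadj G v))).
Proof.
have sd : sound_list v (adjacent_list v (wadj G v)).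
  move=> u e; rewrite /adjacent_list; case: eqP => [-> /capped_some <-|_].
    by rewrite dn_self; split=> //; exact: connected_refl.
  case E: (wadj G v u) => [w|//] /= /capped_some <-.
  by split; [exact: edge_connected E | exact: edge_dn].
split; last 2 first.
- exact: card_best.
- move=> u bu [p [sp lp]] /=; rewrite expn0 => sp1.
  have [e cE eE] := capped_dn v u; exists e => //; apply: (best_ball (v := v)) => //.
  rewrite /adjacent_list -cE; case: eqP => [->|ne]; first by rewrite dn_self.
  move: sp lp sp1; case: p => [|y [|//]] sp /= lp _; first by rewrite lp in ne.
  by move: sp; rewrite lp => /shortest_edge ->.
- by move=> u e /best_some; exact: sd.
Qed.

Definition least (R : pred 'I_B) : option 'I_B :=
  [pick e | R e && [forall e' : 'I_B, R e' ==> (e <= e')]].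

Lemma least_some (R : pred 'I_B) e : least R = Some e -> R e.
Proof. by rewrite /least; case: pickP => // e' /andP[h _] [<-]. Qed.

Lemma least_le (R : pred 'I_B) e : R e -> exists2 e', least R = Some e' & e' <= e.
Proof.
move=> Re; rewrite /least; case: pickP => [e' /andP[_ /forallP/(_ e)]|no].
  by rewrite Re => le; exists e'.
case: (arg_minnP (fun e : 'I_B => e : nat) Re) => e' Re' h.
have := no e'; rewrite Re' /= => /negP[]; apply/forallP => e2; apply/implyP; exact: h.
Qed.

Definition combine (f : 'I_n -> option 'I_B) (L : 'I_n -> 'I_n -> option 'I_B) (u : 'I_n)
    : option 'I_B :=
  least (fun e => [exists w, exists e1 : 'I_B, exists e2 : 'I_B,
    [&& f w == Some e1, L w u == Some e2 & e1 + e2 == e]]).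

(** A shortest path is cut after [2 ^ h] edges, and both pieces are known by [ball_prefix] and
    [ball_suffix]. Only lists of listed vertices are used, which are those that get fetched. *)
Lemma combine_list h v (L : 'I_n -> 'I_n -> option 'I_B) :
  (forall w, list_exact h w (L w)) ->
  list_exact h.+1 v (best (combine (L v) (fun w u => if L v w then L w u else None))).
Proof.
move=> HL; have [sv _ ev] := HL v.
set L' := fun w u => _.
have L'E w u e1 : L v w = Some e1 -> L' w u = L w u by rewrite /L' => ->.
have sd : sound_list v (combine (L v) L').
  move=> u e /least_some /existsP[w /existsP[e1 /existsP[e2]]].
  move=> /and3P[/eqP E1 + /eqP eE]; rewrite (L'E _ _ _ E1) => /eqP E2.
  have [sw _ _] := HL w; have [vw d1] := sv _ _ E1; have [wu d2] := sw _ _ E2.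
  split; first exact: connected_trans vw wu.
  by have := dn_tri vw wu; lia.
split; last 2 first.
- exact: card_best.
- move=> u bu [p [sp lp szp]]; have [e cE eE] := capped_dn v u; exists e => //.
  apply: (best_ball (v := v)) => //.
  pose p1 := take (2 ^ h) p; pose p2 := drop (2 ^ h) p; pose w := last v p1.
  have spE : shortest G v (p1 ++ p2) by rewrite cat_take_drop.
  have lE : last v (p1 ++ p2) = u by rewrite cat_take_drop.
  have [s1 s2] := shortest_cat spE; have dE := shortest_dist spE; rewrite lE in dE.
  have vw : connected G v w by exists p1; split=> //; case: s1.
  have wu : connected G w u by exists p2; split; [case: s2 | rewrite -lE last_cat].
  have b1 := ball_prefix vw wu dE bu; have b2 := ball_suffix vw wu dE bu.
  have [|e1 E1 d1] := ev w b1; first by exists p1; split=> //; rewrite size_take_min geq_minl.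
  have [_ _ ew] := HL w.
  have [|e2 E2 d2] := ew u b2.
    exists p2; split=> //; first by rewrite -lE last_cat.
    by rewrite size_drop; move: szp; rewrite expnS; lia.
  have [|e' cE' le] := @least_le (fun e => [exists w, exists e1 : 'I_B, exists e2 : 'I_B,
    [&& L v w == Some e1, L' w u == Some e2 & e1 + e2 == e]]) e.
    apply/existsP; exists w; apply/existsP; exists e1; apply/existsP; exists e2.
    by rewrite (L'E _ _ _ E1) E1 E2 !eqxx /= d1 d2 eE dE.
  have [_ ge] := sd _ _ cE'; rewrite /combine cE'; congr Some.
  by apply/val_inj/eqP; rewrite /= eqn_leq le eE ge.
- by move=> u e /best_some; exact: sd.
Qed.

End Rank.

End Balls.

Section DistributedBalls.
Local Open Scope nat_scope.
Variables (n k B bB : nat).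
Hypotheses (n1 : 1 < n) (k0 : 0 < k) (kk : k * k <= n) (BE : (n * B).+1 <= n.+1 ^ bB).

Definition exact_list (G : wgraph n) v (f : 'I_n -> option 'I_B) : Prop :=
  [/\ sound_list G v f, #|[pred u | isSome (f u)]| <= k &
    forall u, in_ball k G v u -> exists2 e, f u = Some e & e = dn G v u :> nat].

Definition entry (f : 'I_n -> option 'I_B) (j : nat) : option ('I_n * 'I_B) :=
  obind (fun u => omap (pair u) (f u)) (onth [seq u <- enum 'I_n | isSome (f u)] j).

Lemma entry_some f u e : #|[pred u | isSome (f u)]| <= k -> f u = Some e ->
  exists2 j, j < k & entry f j = Some (u, e).
Proof.
move=> fk fu; have : u \in [seq u <- enum 'I_n | isSome (f u)].
  by rewrite mem_filter fu mem_enum.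
move=> /onthP[j jE]; exists j; last by rewrite /entry jE /= fu.
apply: leq_trans fk; rewrite -(size_filter_enum (fun u => isSome (f u))).
by rewrite -onthTE jE.
Qed.

Lemma entryP f u e j : entry f j = Some (u, e) -> f u = Some e.
Proof.
rewrite /entry; case: onth => [u'|] //=; case E: (f u') => [e'|] //= [<- <-].
by rewrite E.
Qed.

Definition ball_cost := lg n * route_cost n 1 bB 1.

(** Each doubling fetches the lists of at most [k] vertices, [k * k <= n] items in all, hence one
    routing of load 1. *)
Lemma solves_balls (H X : Type) (gr : H -> wgraph n) (adj : 'I_n -> X -> 'I_n -> option nat)
    (P : H -> ('I_n -> X) -> Prop) :
  (forall g c, P g c -> (forall v, adj v (c v) = wadj (gr g) v) /\
     forall u v, dn (gr g) u v < B) ->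
  solves ball_cost P (fun g (c : 'I_n -> X * ('I_n -> option 'I_B)) =>
    P g (fun v => (c v).1) /\ forall v, exact_list (gr g) v (c v).2).
Proof.
move=> HP.
pose I h g (c : 'I_n -> X * ('I_n -> option 'I_B)) :=
  P g (fun v => (c v).1) /\ forall v, list_exact k (gr g) h v (c v).2.
have -> : ball_cost = 0 + (\sum_(h < lg n) route_cost n 1 bB 1 + 0).
  by rewrite addn0 sum_nat_const card_ord.
apply: (@solves_seq _ _ _ _ _ _ _ _ (I 0)).
  apply: (@solves_idle _ _ _ _ _ _ _ (fun v x => (x, best k (adjacent_list B v (adj v x))))).
  move=> g c Pc; split=> // v; have [aE Bd] := HP _ _ Pc; rewrite /= aE.
  exact: initial_list.
apply: (@solves_seq _ _ _ _ _ _ _ _ (I (lg n))); last first.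
  apply: (@solves_idle _ _ _ _ _ _ _ (fun _ x => x)) => g c [Pc Lc]; split=> // v.
  have [l1 l2 l3] := Lc v; split=> // u bu; apply: l3 => //.
  have [p sp lp] := shortest_walk bu.1; exists p; split=> //.
  exact/ltnW/(ltn_trans (shortest_size sp))/ltn_lg.
apply: (@solves_loop _ _ _ (fun=> route_cost n 1 bB 1)) => h _.
pose got (r : 'I_n -> 'I_k -> option (option ('I_n * 'I_B))) w u : option 'I_B :=
  [pick e | [exists j, r w j == Some (Some (u, e))]].
apply: (@solves_fetch n _ _ _ 'I_k (option ('I_n * 'I_B)) 1 bB 1 _ _
  (fun _ _ _ => true) (fun _ x j => entry x.2 j) (fun _ x u _ => isSome (x.2 u))
  (fun v x r => (x.1, best k (combine x.2 (got r))))) => //.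
- by rewrite card_ord expn1; have := leq_mul k0 (leqnn k); lia.
- by rewrite card_option card_prod !card_ord.
- move=> g c [Pc Lc]; split=> // [u|v].
    rewrite muln1 -[X in X <= _]/#|'I_k| card_ord.
    by have := leq_mul k0 (leqnn k); lia.
  have [_ l2 _] := Lc v; rewrite muln1; apply: leq_trans kk.
  apply: leq_trans (leq_mul l2 (leqnn k)).
  rewrite -[X in _ <= _ * X](card_ord k) -cardX; apply: subset_leq_card.
  by apply/subsetP => -[u j]; rewrite !inE /= andbT.
move=> g c [Pc Lc]; split=> // v; have [aE Bd] := HP _ _ Pc.
have := @combine_list n k B k0 (gr g) Bd h v (fun w => (c w).2) Lc.
congr list_exact; congr (best k (combine _ _)).
apply/funext => w; apply/funext => u; rewrite /got.
case vw: ((c v).2 w) => [d|] /=; last first.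
  by case: pickP => // e /existsP[j].
case: pickP => [e /existsP[j]|no]; first by move=> /eqP[/entryP].
case E: ((c w).2 u) => [e|//]; have [_ l2 _] := Lc w.
have [j jk jE] := entry_some l2 E; have := no e; move=> /negbT/existsPn/(_ (Ordinal jk)).
by rewrite jE eqxx.
Qed.

End DistributedBalls.

(** * A small set hitting all large balls *)

Section Hubs.
Local Open Scope nat_scope.
Variables (n k m y : nat).
Hypotheses (n1 : 1 < n) (k0 : 0 < k) (kn : k <= n) (mk : n <= m * k) (ny : n ^ 5 <= 2 ^ y).

Lemma leq_bernoulli a c q : a ^ q * (a + q * c) <= a * (a + c) ^ q.
Proof.
elim: q => [|q IH]; first by rewrite !expn0; lia.
rewrite !expnS; move: IH; set u := a ^ q; set v := (a + c) ^ q => IH.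
have := leq_mul IH (leqnn (a + c)); have : 0 <= u * q * c * c by [].
by rewrite mulSn; nia.
Qed.

(** Since [m * k >= n], a batch of [m] random draws misses a fixed set of [k] vertices with
    probability at most one half, and [y] batches miss it with probability at most [n ^ (-5)].
    [good_family] then serves all sets at once. *)
Lemma hub_family : exists f : 4.-tuple 'I_n -> {set 'I_n},
  (forall z, #|f z| <= m * y) /\ forall S : {set 'I_n}, k <= #|S| ->
    n * #|[pred z | [disjoint f z & S]]| < n ^ 4.
Proof.
pose Om := {ffun 'I_(m * y) -> 'I_n}.
pose img (w : Om) : {set 'I_n} := [set w i | i in 'I_(m * y)].
pose bad (S : {set 'I_n}) (w : Om) := (k <= #|S|) && [disjoint img w & S].
have n0 : 0 < n by exact: ltnW.
have half : 2 * (n - k) ^ m <= n ^ m.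
  have := leq_bernoulli (n - k) k m; rewrite subnK //.
  case: (posnP (n - k)) => [->|a0] h.
    rewrite exp0n ?muln0 //; case: (m) mk => // ; lia.
  rewrite -(leq_pmul2l a0); apply: leq_trans h; rewrite mulnA [_ * 2]mulnC mulnC leq_mul2l.
  by apply/orP; right; lia.
have [] := @good_family {set 'I_n} Om (4.-tuple 'I_n) bad (n + 5).
- by rewrite card_ffun !card_ord expn_gt0 n0.
- rewrite -cardsT -powersetT card_powerset cardsT card_ord expnD; have := expn_gt0 2 n; move: (2 ^ n) => p; lia.
- move=> S; rewrite card_tuple card_ord card_ffun !card_ord.
  case: (leqP k #|S|) => kS; last first.
    by rewrite eq_card0 // => w; apply/negbTE; rewrite !inE /bad leqNgt kS.
  have -> : #|[pred w | bad S w]| = #|family (fun _ : 'I_(m * y) => [predC S])|.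
    apply: eq_card => w; rewrite [LHS]inE /bad kS /=; apply/idP/familyP => [|h].
      move=> /pred0P h i; rewrite inE; apply/negP => wS; have := h (w i).
      by rewrite /= wS andbT => /negbT/negP[]; apply/imsetP; exists i.
    apply/pred0P => u /=; apply/negbTE/negP => /andP[/imsetP[i _ ->]].
    by have := h i; rewrite inE => /negP.
  rewrite card_family foldrE big_map big_enum /= (eq_bigr (fun=> n - #|S|)); last first.
    move=> i _; have cS := cardC (mem S); rewrite card_ord in cS.
    by rewrite -[X in _ = X - _]cS addKn; apply: eq_card => u; rewrite !inE.
  rewrite prod_nat_const card_ord.
  apply: leq_trans (_ : (n - k) ^ (m * y) * n ^ 4 <= _).
    by rewrite leq_mul2r leq_expl ?orbT // leq_sub2l.
  rewrite !expnM; apply: leq_trans (leq_expl y half); rewrite expnMn mulnC leq_mul2r.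
  by apply/orP; right; apply: leq_trans ny; rewrite leq_exp2l.
move=> f fP; exists (fun z => img (f z)); split=> [z|S kS].
  by rewrite -[X in _ <= X]card_ord leq_imset_card.
apply: leq_ltn_trans (_ : n * (n + 4) < _).
  rewrite leq_mul2l; apply/orP; right; have := fP S; rewrite addnS ltnS; congr (_ <= _).
  by apply: eq_card => z; rewrite !inE /bad kS.
have -> : n ^ 4 = n * (n * (n * n)) by rewrite !expnS expn0 muln1.
by rewrite ltn_pmul2l //; have := leq_mul (leqnn n) (leq_mul n1 n1); lia.
Qed.

End Hubs.

(** * Short-cut weights from balls and hubs *)

Section Shortcuts.
Local Open Scope nat_scope.
Variables (n k B : nat).
Hypothesis k0 : 0 < k.
Variables (G : wgraph n) (lst : 'I_n -> 'I_n -> option 'I_B).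
Hypothesis lists : forall v, exact_list k G v (lst v).

(** The list has at most [k] entries and contains the ball. If an entry were outside, the nearest
    outside vertex [u0] would have at least [k] closer vertices, all in the ball and so filling the
    list; the entry would be closer than [u0]. *)
Lemma list_ball v u e : lst v u = Some e -> in_ball k G v u.
Proof.
have [sv lk ex] := lists v; move=> E; have [vu _] := sv _ _ E.
split=> //; rewrite ltnNge; apply/negP => far.
pose out u := `[< connected G v u >] && (k <= #|closer G v u|).
have outu : out u by rewrite /out far andbT; exact/asboolP.
case: (arg_minnP (fun u => key (dn G v u) u) outu) => u0 /andP[/asboolP vu0 far0] umin.
have sub : closer G v u0 \subset [pred y | isSome (lst v y)].
  apply/subsetP => y; rewrite unfold_in => yc; rewrite inE.
  have /andP[/asboolP vy lt] := yc.
  have [|d -> //] := ex y; split=> //; rewrite ltnNge; apply/negP => fy.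
  have := umin y; rewrite /out fy andbT => /(_ (introT (asboolP _) vy)).
  by rewrite leqNgt lt.
have ce : #|closer G v u0| = #|[pred y | isSome (lst v y)]|.
  by apply/eqP; rewrite eqn_leq subset_leq_card //= (leq_trans lk far0).
have same := elimT (subset_cardP ce) sub.
have : u \in closer G v u0 by rewrite same inE E.
rewrite unfold_in => /andP[_ lt].
by have := umin u outu; rewrite leqNgt lt.
Qed.

Lemma list_all v : #|[pred u | isSome (lst v u)]| < k ->
  forall u, connected G v u -> in_ball k G v u.
Proof.
have [sv _ ex] := lists v; move=> h u vu; split=> //; rewrite ltnNge; apply/negP => far.
pose out u := `[< connected G v u >] && (k <= #|closer G v u|).
have outu : out u by rewrite /out far andbT; exact/asboolP.
case: (arg_minnP (fun u => key (dn G v u) u) outu) => u0 /andP[/asboolP vu0 far0] umin.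
have : #|closer G v u0| <= #|[pred y | isSome (lst v y)]|.
  apply: subset_leq_card; apply/subsetP => y; rewrite unfold_in => yc; rewrite inE.
  have /andP[/asboolP vy lt] := yc.
  have [|d -> //] := ex y; split=> //; rewrite ltnNge; apply/negP => fy.
  have := umin y; rewrite /out fy andbT => /(_ (introT (asboolP _) vy)).
  by rewrite leqNgt lt.
by lia.
Qed.

Variables (A : {set 'I_n}) (L : nat).
Hypothesis L0 : 0 < L.
Hypothesis hit : forall v, k <= #|[pred u | isSome (lst v u)]| ->
  ~~ [disjoint A & [pred u | isSome (lst v u)]].

Definition omin2 (a b : option nat) : option nat := if b is Some e then omin a e else a.

(** Held at [y], but taken from the list of [x], since it describes a hop from [x] into its ball.
    The minimum keeps every edge available at its weight. *)
Definition shortcut (adj : 'I_n -> 'I_n -> option nat) y x : option nat :=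
  omap (muln L) (omin2 (adj y x) (omap (@nat_of_ord B) (lst x y))).

Lemma shortcut_sound x y w : shortcut (wadj G) y x = Some w ->
  connected G x y /\ L * dn G x y <= w.
Proof.
have [sx _ _] := lists x.
rewrite /shortcut /omin2 /omin; case E: (lst x y) => [e|] /=; last first.
  case E2: (wadj G y x) => [e|//] /= [<-]; rewrite wadj_sym in E2.
  by split; [exact: edge_connected E2 | rewrite leq_mul2l (edge_dn E2) orbT].
have [xy le] := sx _ _ E; move=> [<-]; split=> //; rewrite leq_mul2l; apply/orP; right.
case E2: (wadj G y x) => [e2|//]; rewrite wadj_sym in E2.
by rewrite leq_min (edge_dn E2) le.
Qed.

Lemma shortcut_exact x y : in_ball k G x y ->
  shortcut (wadj G) y x = Some (L * dn G x y).
Proof.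
have [_ _ ex] := lists x; move=> /ex[e E eE]; rewrite /shortcut E /= /omin eE.
congr (Some (L * _)); case E2: (wadj G y x) => [e2|//]; rewrite wadj_sym in E2.
by apply/minn_idPr; exact: edge_dn E2.
Qed.

(** A full list contains a hub. Either that hub is within [l], or everything within [l] is closer
    than it and so in the ball; a list that is not full covers the component. The same hubs work for
    every [l]. *)
Lemma shortcutsP (st : 'I_n -> local_view n) :
  (forall y, (st y).1 = shortcut (wadj G) y) -> shortcuts (mem A) (scaled G L0) st.
Proof.
move=> stE l.
have awE x y : weights_of st x y = shortcut (wadj G) y x by rewrite /weights_of stE.
split.
- move=> x y w; rewrite awE => /shortcut_sound[xy le]; rewrite scaled_dn; split=> //.
  exact/scaled_connected.
- move=> x y w /=; case E: (wadj G x y) => [w'|//] /= [<-]; rewrite /est awE /shortcut.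
  rewrite wadj_sym E /omin2 /omin; case: (lst x y) => [e|] /=; last by exists (L * w').
  by exists (L * minn w' e) => //; rewrite leq_mul2l geq_minl orbT.
move=> x; have [sx _ _] := lists x.
case: (leqP k #|[pred u | isSome (lst x u)]|) => kx; last first.
  right=> u /scaled_connected xu ne _; rewrite awE scaled_dn; apply: shortcut_exact.
  exact: list_all.
have /pred0Pn[b /= /andP[bA]] := hit kx; rewrite inE; case E: (lst x b) => [e|//] _.
have bb := list_ball E; have [xb rb] := bb.
case: (leqP (L * dn G x b) l) => lb.
  left; exists b; split=> //; rewrite ?scaled_dn //; first exact/scaled_connected.
  by right; rewrite awE; exact: shortcut_exact.
right=> u /scaled_connected xu ne; rewrite awE scaled_dn => ul; apply: shortcut_exact.
split=> //; apply: leq_ltn_trans rb; apply: subset_leq_card; apply/subsetP => y.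
rewrite !unfold_in /closer => /andP[-> lt]; apply: ltn_trans lt _.
by apply: key_lt; have := leq_ltn_trans ul lb; rewrite (ltn_pmul2l L0).
Qed.

End Shortcuts.

(** * The complete protocol for a given engine *)

Section MainProtocol.
Local Open Scope nat_scope.
Variables (n W : nat) (PD : Type) (prep : ('I_n -> 'I_n -> option 'I_W) -> ('I_n -> PD) -> Prop).
Variables (pc : nat) (mc : nat -> nat).
Hypothesis eng : engine prep pc mc.
Variable pd0 : PD.
Variables (c k m y bB I qm b x NS : nat).
Hypotheses (n1 : 1 < n) (k0 : 0 < k) (kk : k * k <= n) (kn : k <= n) (mk : n <= m * k)
  (ny : n ^ 5 <= 2 ^ y).
Let B := (n * n ^ c).+1.
Hypothesis BE : (n * B).+1 <= n.+1 ^ bB.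
Hypothesis IE : n * n ^ c * 2 ^ I <= 3 ^ I.
Hypothesis WE : 8 * (8 * I + 13) * precision I qm + 2 <= W.
Hypothesis timesE : forall q, q <= qm ->
  times (precision I q) (lg (precision I q)) (2 * coarseness I) < n.+1 ^ b.
Hypothesis stepsE : forall q, q <= qm ->
  (lg (precision I q)).+1 * steps (precision I q) (lg (precision I q)) (2 * coarseness I) * n ^ (b + 6)
    <= 2 ^ x.

Definition hub_sources := minn n (NS + m * y).
Let L := range I qm 0.

Definition main_cost := 1 + (ball_cost n bB + (4 * 6 + (bB +
  \sum_(q < qm.+1) I * level_cost pc mc hub_sources I b x q))).

Definition instance (g : wgraph n * {set 'I_n}) (c0 : 'I_n -> local_input n) : Prop :=
  [/\ c0 = graph_input g.1 g.2, weights_le g.1 (n ^ c) & #|g.2| <= NS].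

Lemma range0_gt0 : 0 < L.
Proof. by rewrite /L /range /coarseness !muln_gt0 !expn_gt0 addn_gt0 orbT. Qed.

Definition estimates (g : wgraph n * {set 'I_n}) (d : 'I_n -> 'I_n -> option nat) : Prop :=
  forall u v, u \in g.2 ->
  (forall e, d v u = Some e -> connected g.1 u v) /\
  (connected g.1 u v -> exists2 e, d v u = Some e &
     L * dn g.1 u v <= e <= L * dn g.1 u v + 2 * (L * dn g.1 u v) %/ 2 ^ qm).

Lemma solves_main : solves main_cost instance estimates.
Proof.
have L0 := range0_gt0.
apply: (@solves_bcast n _ _ _ bool 1 _ _ _ (fun _ z => z.1)).
  by rewrite card_bool expn1; lia.
move=> src; apply: (solves_seq (solves_balls (k := k) (B := B) (bB := bB) n1 k0 kk BE
  (gr := fun g => g.1) (adj := fun _ z => z.2) _)).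
  move=> g c0 [[-> wl _] _]; split=> // u v; rewrite ltnS; exact: dn_le_weights.
have [f [fm fP]] := hub_family n1 k0 kn mk ny.
pose supp (z : local_input n * ('I_n -> option 'I_B)) := [set u | isSome (z.2 u)].
apply: (@solves_agree n _ _ _ 4 _ _ _
  (fun _ z d => (k <= #|supp z|) && [disjoint f d & supp z])).
  move=> g c0 _; have n0 : 0 < n by exact: ltnW.
  rewrite -(ltn_pmul2l n0) big_distrr /=.
  apply: leq_ltn_trans (_ : \sum_(v < n) (n ^ 4).-1 < _).
    apply: leq_sum => v _; case: (leqP k #|supp (c0 v)|) => ks; last first.
      by rewrite eq_card0 ?muln0.
    by rewrite -ltnS prednK ?expn_gt0 ?n0 //; apply: fP.
  by rewrite sum_nat_const card_ord ltn_pmul2l // prednK // expn_gt0 n0.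
move=> d; set A := f d.
pose Q : pred 'I_n := fun s => src s || (s \in A).
(* A protocol is due for every broadcast vector; vectors with too many sources contradict the
   precondition, so an arbitrary output does. *)
case: (leqP #|[pred s | src s]| NS) => srcN; last first.
  apply: (@solves_idle _ _ _ _ _ _ _ (fun _ _ _ => None)) => g c0 [[[[cE _ gN] srcE] _] _].
  exfalso; move: srcN; rewrite ltnNge => /negP; apply; apply: leq_trans gN.
  apply: subset_leq_card; apply/subsetP => s; have := srcE s; have := congr1 (fun h => h s) cE.
  by rewrite inE /= => -> /= ->.
have QN : #|Q| <= hub_sources.
  rewrite leq_min -[X in _ <= X]card_ord max_card /=.
  apply: leq_trans (_ : #|[set s | src s]| + #|A| <= _); last first.
    by rewrite cardsE; exact: leq_add srcN (fm d).
  apply: leq_trans (leq_card_setU _ _); apply: subset_leq_card.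
  by apply/subsetP => s; rewrite unfold_in /Q !inE.
have Nn : hub_sources <= n by exact: geq_minl.
have AQ s : (mem A) s -> Q s by rewrite /Q => sA; apply/orP; right.
pose mid (g : wgraph n * {set 'I_n}) (c0 : 'I_n -> local_state n) :=
  [/\ scaled_range I qm (scaled g.1 L0), shortcuts (mem A) (scaled g.1 L0) (state_of c0) &
      forall u, u \in g.2 -> Q u].
apply: (@solves_seq _ _ _ _ _ _ _ _ mid).
  apply: (@solves_send n _ _ _ (option 'I_B) bB _ _ (fun _ z v => z.2 v)
    (fun v z r => ((fun u => omap (muln L) (omin2 (z.1.2 u) (omap (@nat_of_ord B) (r u))),
       fun=> None), fun=> None))).
    rewrite card_option card_ord; apply: leq_trans BE.
    by rewrite ltnS leq_pmull //; lia.
  move=> g c0 [[[[cE wl gN] srcE] lists] no].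
  have c1 u : (c0 u).1 = graph_input g.1 g.2 u := congr1 (fun h => h u) cE.
  split; last by move=> u uS; have := srcE u; rewrite /Q /= c1 /= uS => <-.
    split=> [s v /scaled_connected sv ne|s v].
      rewrite scaled_dn -[X in _ <= X]muln1 leq_mul2l => /orP[/eqP L00|d1].
        by exfalso; have := range0_gt0; rewrite -/L L00.
      have [[|y0 [|z p]] sp lp] := shortest_walk sv; first by rewrite -lp eqxx in ne.
        have ed := shortest_edge sp; rewrite /= in lp; rewrite lp in ed.
        by exists (L * dn g.1 s v); rewrite //= ed.
      rewrite /= in lp; case: sp => /=; rewrite lp => /andP[+ /walk_weight_gt0 +].
      rewrite /edge; case E: wadj => [w|//] _ /= w0 wE.
      by have := wadj_pos E; move: w0 => /=; lia.
    rewrite scaled_dn; apply: leq_trans (_ : L * (n * n ^ c) <= _).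
      by rewrite leq_mul2l dn_le_weights ?orbT.
    rewrite /L /range subn0 subnn expn0 mul1n muln1 -mulnA leq_mul2l.
    by rewrite [2 ^ I * _]mulnC IE orbT.
  apply: (@shortcutsP n k B k0 g.1 (fun v => (c0 v).2) lists A L L0) => //.
    move=> v ks; have := no v; rewrite negb_and /supp.
    have -> : #|[set u | isSome ((c0 v).2 u)]| = #|[pred u | isSome ((c0 v).2 u)]|.
      by rewrite cardsE.
    rewrite ks /=; congr (~~ _); apply: eq_disjoint_r => u.
    by rewrite !inE.
  by move=> v; apply/funext => u; rewrite /= /shortcut c1.
apply: (solves_lift (f := fun _ z => z) (h := fun v z z' => z'.1.2)
  (solves_levels eng pd0 n1 AQ QN Nn WE timesE stepsE)).
move=> g c0 [sr sh gQ]; exists (scaled g.1 L0); split=> // c1 [so ce] u v uS; split.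
  by move=> e E; have [/scaled_connected] := so u v e E.
move=> uv; have [e E le] := ce u v (gQ u uS) ((@scaled_connected n g.1 L L0 u v).2 uv).
exists e => //; have [_ ge] := so u v e E; rewrite !scaled_dn in le ge.
by apply/andP.
Qed.

End MainProtocol.

(** * Min-plus products from a bilinear algorithm *)

Section EngineInstance.
Local Open Scope nat_scope.
Variables (n W a Cr R d d1 : nat).
Variables (u : 'I_R -> 'I_d1 -> 'I_d -> int) (v : 'I_R -> 'I_d -> 'I_d -> int).
Variable (w : 'I_R -> 'I_d1 -> 'I_d -> int).
Hypothesis bilinear : forall i j i' x x' j',
  (\sum_t w t i j * (u t i' x * v t x' j') =
    ((i' == i) && (x == x') && (j' == j))%:R)%R.
Hypotheses (n1 : 1 < n) (d0 : 0 < d) (d10 : 0 < d1) (d1d : d1 <= d) (dn : d * d <= n)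
  (Rn : R <= Cr * n).
Hypothesis labels :
  (R + d * d + d1 * d) * ((2 * n + 2) * (2 * n + 2) * (2 * W)) <= n.+1 ^ a.

Definition bsize e x := (x %/ e).+1.

Definition prepare_load := Cr.+1 * (bsize d n * bsize d n * W %/ n + 1) + 2 * W.
Definition prepare_cost := route_cost n a 8 prepare_load + route_cost n a 8 prepare_load.

Definition product_load K := Cr.+1 * (bsize d1 K * bsize d n * (2 * W) %/ n + 1) +
  ((K + d1) * (2 * W) %/ n + 1).
Definition product_cost K :=
  route_cost n a 8 (product_load K) + route_cost n a 8 (product_load K) +
  (route_cost n a 8 (product_load K) + route_cost n a 8 (product_load K)).

Lemma bsizeP e x : 0 < e -> x <= e * bsize e x <= x + e.
Proof.
move=> e0; rewrite /bsize mulnC; apply/andP; split; first exact/ltnW/ltn_ceil.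
by rewrite mulSn addnC leq_add2r leq_divM.
Qed.

Lemma bsize_le e x : 0 < e -> bsize e x <= x.+1.
Proof. by move=> e0; rewrite /bsize ltnS leq_div. Qed.

(** The field is ['F_p] with [n < p]: vertices are distinct evaluation points and witness counts do
    not vanish. The bound on [p] gives the 8 in the costs. *)
Lemma engine_instance : exists (PD : Type)
  (prep : ('I_n -> 'I_n -> option 'I_W) -> ('I_n -> PD) -> Prop),
  inhabited PD /\ engine prep prepare_cost product_cost.
Proof.
have [p [pp np pn]] := exists_prime n1.
have n0 : 0 < n by exact: ltnW.
have cF : #|'F_p| <= n.+1 ^ 8 by rewrite card_Fp.
have pchar : p \in [pchar 'F_p] by exact: pchar_Fp.
have natF k : 0 < k <= n -> (k%:R != 0 :> 'F_p)%R.
  move=> /andP[k0 kn]; rewrite -(dvdn_pcharf pchar); apply/negP => /dvdn_leq.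
  by move=> /(_ k0) pk; move: (leq_trans np pk); rewrite ltnNge kn.
have pt_inj : injective (fun s : 'I_n => (s%:R : 'F_p)%R).
  move=> s s'; wlog le : s s' / s <= s'.
    by move=> H; case/orP: (leq_total s s') => [/H|/H h /esym/h].
  move=> E; apply/val_inj/eqP => /=; apply: contraT => ne.
  have lt : s < s' by rewrite ltn_neqAle ne.
  have [] := negP (natF (s' - s) _); first by have := ltn_ord s'; lia.
  by rewrite natrB // -E subrr.
have [iN iNi] : exists iN : 'I_n -> 'I_d * 'I_(bsize d n), injective iN.
  apply: inj_of_card; rewrite card_prod !card_ord.
  by have /andP[] := bsizeP n d0.
have d1dn : d1 * d <= n by apply: leq_trans dn; rewrite leq_mul2r d1d orbT.
have Rn' : R %/ n + 1 <= Cr.+1.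
  by rewrite addn1 ltnS -[X in _ <= X](mulnK _ n0) leq_div2r.
have step (A X t : nat) : A <= Cr.+1 * n -> Cr.+1 * (X %/ n + 1) <= t -> (X %/ n + 1) * A <= n * t.
  move=> hA ht; apply: leq_trans (leq_mul (leqnn n) ht).
  by have := leq_mul (leqnn (X %/ n + 1)) hA; lia.
have step4 (X t : nat) : Cr.+1 * (X %/ n + 1) <= t -> (R %/ n + 1) * X <= n * t.
  move=> ht; apply: leq_trans (leq_mul (leqnn n) ht).
  apply: leq_trans (leq_mul Rn' (leqnn X)) _; rewrite mulnCA leq_mul2l; apply/orP; right.
  by rewrite addn1 mulnC ltnW // ltn_ceil.
have nC : n <= Cr.+1 * n by rewrite leq_pmull.
have RC : R <= Cr.+1 * n by apply: leq_trans Rn _; rewrite leq_mul2r leqnSn orbT.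
have lab e x : 0 < e -> x <= n -> (R + d * d + d1 * d) *
    ((bsize d n + bsize e x) * (bsize d n + bsize e x) * (2 * W)) <= n.+1 ^ a.
  move=> e0 xn; apply: leq_trans labels; rewrite leq_mul2l; apply/orP; right.
  have h : bsize d n + bsize e x <= 2 * n + 2.
    by have := bsize_le n d0; have := bsize_le x e0; lia.
  by rewrite leq_mul2r; apply/orP; right; exact: leq_mul.
exists ('I_R -> 'I_(bsize d n) * 'I_(bsize d n) * 'I_W -> 'F_p)%type.
exists (fun b pd => prepared v n1 iN (indicator 'F_p b) pd); split.
  exact: (inhabits (fun _ _ => 0%R)).
split=> [H X Y P Q b h HQ|K H X Y P Q al pd sup h Kn HQ].
  apply: (solves_prepare cF (lab d1 0 d10 (leq0n n)) (iN := iN) (v := v) _ _ _ _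
    (b := fun y z x k => (b y z x == Some k)%:R%R)).
  - have /andP[_ le] := bsizeP n d0; apply: leq_trans (_ : (n + d) * W <= _).
      by rewrite leq_mul2r le orbT.
    have dn1 : d <= n by apply: leq_trans dn; rewrite leq_pmull.
    apply: leq_trans (_ : n * (2 * W) <= _); last by rewrite leq_mul2l leq_addl orbT.
    by have := leq_mul dn1 (leqnn W); lia.
  - by apply: step; [exact: leq_trans nC | exact: leq_addr].
  - by apply: step => //; exact: leq_addr.
  - by apply: step4; exact: leq_addr.
  - by move=> g c pd Pc; exact: HQ.
have [iK iKi] : exists iK : 'I_K -> 'I_d1 * 'I_(bsize d1 K), injective iK.
  by apply: inj_of_card; rewrite card_prod !card_ord; have /andP[] := bsizeP K d10.
apply: (solves_relax bilinear cF (lab d1 K d10 Kn) iNi iKi _ _ _ _ pt_inj natF HQ).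
- have /andP[_ le] := bsizeP K d10; apply: leq_trans (_ : (K + d1) * (2 * W) <= _).
    by rewrite leq_mul2r le orbT.
  apply: leq_trans (_ : n * ((K + d1) * (2 * W) %/ n + 1) <= _).
    by rewrite addn1 [n * _]mulnC ltnW // ltn_ceil.
  by rewrite leq_mul2l leq_addl orbT.
- by apply: step; [exact: leq_trans nC | exact: leq_addr].
- by apply: step => //; exact: leq_addr.
- by apply: step4; exact: leq_addr.
Qed.

End EngineInstance.

(** * Exact distances *)

Section Exact.
Local Open Scope nat_scope.
Variables (n s c bB : nat).
Hypotheses (n1 : 1 < n) (s0 : 0 < s) (ss : s * s <= n).
Let B := (n * n ^ c).+1.
Hypothesis BE : B.+1 * B.+1 <= n.+1 ^ bB.

Let b := bsize s n.

Lemma block_lt (u : 'I_n) : u %/ b < s.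
Proof. by rewrite ltn_divLR //; have /andP[h _] := bsizeP n s0; apply: leq_trans (ltn_ord u) h. Qed.

Lemma worker_lt (u y : 'I_n) : (u %/ b) * s + y %/ b < n.
Proof.
apply: leq_trans ss; have h1 := block_lt u; have h2 := block_lt y.
by have := leq_mul h1 (leqnn s); rewrite mulSn; lia.
Qed.

(** There are at most [s * s <= n] pairs of blocks, so each pair gets a vertex of its own. *)
Definition worker u y : 'I_n := Ordinal (worker_lt u y).

Lemma card_block i : #|[pred u : 'I_n | u %/ b == i]| <= b.
Proof.
rewrite -[X in _ <= X]card_ord.
apply: (leq_card_inj (f := fun u : 'I_n => inord (u %% b) : 'I_b)) => // u u'.
rewrite !inE => /eqP h /eqP h' /(congr1 val); rewrite /= !inordK ?ltn_mod // => e.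
by apply/val_inj; rewrite /= (divn_eq u b) (divn_eq u' b) h h' e.
Qed.

Lemma worker_block u y : (worker u y %/ s == u %/ b) && (worker u y %% s == y %/ b).
Proof. by rewrite /= divnMDl // modnMDl (modn_small (block_lt y)) (divn_small (block_lt y)) addn0 !eqxx. Qed.

Definition exact_cost := lg n * (bB + (route_cost n 1 bB (2 * b) + route_cost n 2 bB (2 * b))).

Lemma bn_load : b * b <= n * (2 * b).
Proof.
have /andP[_ h] := bsizeP n s0; rewrite mulnCA mulnA leq_mul2r; apply/orP; right.
have : s <= n by apply: leq_trans ss; rewrite leq_pmull.
by have := leq_mul s0 (leqnn b); rewrite -/b in h; lia.
Qed.

(** Repeated squaring by the list machinery at [k = n], where the ball is the whole component. A
    worker reads about [2 * b] rows and columns of length [n], so with [s] near the square root of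
    [n] a squaring takes [O~(n ^ (1/2))] rounds. *)
Lemma solves_exact (G : Type) (gr : G -> wgraph n) (P : G -> ('I_n -> local_input n) -> Prop) :
  (forall g c0, P g c0 -> (forall v, (c0 v).2 = wadj (gr g) v) /\ weights_le (gr g) (n ^ c)) ->
  solves exact_cost P (fun g (d : 'I_n -> 'I_n -> option nat) =>
    forall u v, (forall e, d v u = Some e -> connected (gr g) u v /\ e = dn (gr g) u v) /\
      (connected (gr g) u v -> d v u)).
Proof.
move=> HP; have nn : 0 < n by exact: ltnW.
pose good h g (L : 'I_n -> 'I_n -> option 'I_B) :=
  (forall u v, dn (gr g) u v < B) /\ forall v, list_exact n (gr g) h v (L v).
have -> : exact_cost = 0 + (\sum_(h < lg n)
    (bB + (route_cost n 1 bB (2 * b) + route_cost n 2 bB (2 * b))) + 0).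
  by rewrite addn0 sum_nat_const card_ord.
apply: (@solves_seq _ _ _ _ _ _ _ _ (good 0)).
  apply: (@solves_idle _ _ _ _ _ _ _ (fun v x => best n (adjacent_list B v x.2))).
  move=> g c0 Pc; have [aE wl] := HP _ _ Pc.
  have Bd u v : dn (gr g) u v < B by rewrite ltnS; exact: dn_le_weights.
  by split=> // v; rewrite aE; exact: initial_list.
apply: (@solves_seq _ _ _ _ _ _ _ _ (good (lg n))); last first.
  apply: (@solves_idle _ _ _ _ _ _ _ (fun _ f u => omap (@nat_of_ord B) (f u))) => g L [Bd HL] u v.
  have [l1 _ l3] := HL v.
  have ball : connected (gr g) u v -> exists2 e, L v u = Some e & e = dn (gr g) v u :> nat.
    move=> uv; have vu := connected_sym uv; apply: l3.
      split=> //; rewrite -[X in _ < X]card_ord; apply: proper_card; apply/properP.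
      split; first exact/subsetP.
      by exists u => //; rewrite unfold_in /closer ltnn andbF.
    have [p sp lp] := shortest_walk vu; exists p; split=> //.
    exact/ltnW/(ltn_trans (shortest_size sp))/ltn_lg.
  split=> [e|/ball[e -> _]] //; case E: (L v u) => [e'|//] [<-].
  have [vu _] := l1 _ _ E; have uv := connected_sym vu; split=> //.
  by have [e2] := ball uv; rewrite E => -[<-]; rewrite dn_sym.
apply: (@solves_loop _ _ _
  (fun=> bB + (route_cost n 1 bB (2 * b) + route_cost n 2 bB (2 * b)))) => h _.
(* Every vertex also learns its column, so that it can supply both row and column to the workers. *)
pose M1 g (c0 : 'I_n -> ('I_n -> option 'I_B) * ('I_n -> option 'I_B)) :=
  good h g (fun v => (c0 v).1) /\ forall v u, (c0 v).2 u = (c0 u).1 v.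
apply: (@solves_seq _ _ _ _ _ _ _ _ M1).
  apply: (@solves_send n _ _ _ (option 'I_B) bB _ _ (fun _ f v => f v) (fun _ f r => (f, r))).
    by rewrite card_option card_ord; apply: leq_trans BE; rewrite leq_pmulr.
  by [].
pose val (L : 'I_n -> 'I_n -> option 'I_B) v u := combine (L v) L u.
pose wants (z u : 'I_n) := (u %/ b == z %/ s) || (u %/ b == z %% s).
pose M2 g (c0 : 'I_n -> ('I_n -> option 'I_B) * ('I_n -> 'I_n -> option 'I_B)) :=
  let L v := (c0 v).1 in
  good h g L /\ forall v u, (c0 (worker v u)).2 v u = val L v u.
apply: (@solves_seq _ _ _ _ _ _ _ _ M2).
  apply: (@solves_fetch n _ _ _ 'I_n (option 'I_B * option 'I_B)%type 1 bB (2 * b) _ _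
    (fun _ _ _ => true) (fun _ x j => (x.1 j, x.2 j)) (fun z _ u _ => wants z u)
    (fun z x r => (x.1, fun v u =>
       combine (fun w => obind fst (r v w)) (fun w u => obind snd (r u w)) u))) => //.
  - by rewrite card_ord expn1.
  - by rewrite card_prod card_option card_ord.
  - move=> g c0 [gd _]; split=> // [u|z].
      rewrite -[X in X <= _]/#|'I_n| card_ord leq_pmulr //.
    apply: leq_trans (_ : #|[pred u | wants z u]| * n <= _).
      rewrite -[X in _ <= _ * X](card_ord n) -cardX; apply: subset_leq_card.
      by apply/subsetP => -[u j]; rewrite !inE /= andbT.
    rewrite mulnC leq_mul2l; apply/orP; right.
    have -> : #|[pred u | wants z u]| =
      #|[predU [pred u : 'I_n | u %/ b == z %/ s] & [pred u : 'I_n | u %/ b == z %% s]]|.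
      by apply: eq_card => u; rewrite !inE.
    have UI := cardUI [pred u : 'I_n | u %/ b == z %/ s] [pred u : 'I_n | u %/ b == z %% s].
    rewrite (leq_trans (leq_addr #|predI [pred u : 'I_n | u %/ b == z %/ s] [pred u : 'I_n | u %/ b == z %% s]| _)) // UI mul2n -addnn; apply: leq_add; exact: card_block.
  move=> g c0 [gd tr]; split=> // v u; rewrite /val /combine /=.
  have /andP[/eqP e1 /eqP e2] := worker_block v u.
  have wv : wants (worker v u) v by rewrite /wants e1 eqxx.
  have wu : wants (worker v u) u by rewrite /wants e2 eqxx orbT.
  congr least; apply/funext => e; apply: eq_existsb => w.
  by apply: eq_existsb => e1'; apply: eq_existsb => e2'; rewrite wv wu /= tr.
apply: (@solves_fetch n _ _ _ ('I_n * 'I_n)%type (option 'I_B) 2 bB (2 * b) _ _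
  (fun z _ j => worker j.1 j.2 == z) (fun _ x j => x.2 j.1 j.2)
  (fun v _ z j => (j.1 == v) && (worker j.1 j.2 == z))
  (fun v x r => best n (fun u => obind id (r (worker v u) (v, u))))) => //.
- by rewrite card_prod card_ord leq_mul ?expn1.
- by rewrite card_option card_ord; apply: leq_trans BE; rewrite leq_pmulr.
- move=> g c0 [gd _]; split=> [v z j /andP[]//|z|v].
    apply: leq_trans bn_load.
    apply: leq_trans (leq_mul (card_block (z %/ s)) (card_block (z %% s))).
    rewrite -cardX; apply: subset_leq_card; apply/subsetP => -[v u].
    rewrite !inE /= => /eqP <-; have /andP[/eqP -> /eqP ->] := worker_block v u.
    by rewrite !eqxx.
  apply: leq_trans (_ : n <= _); last by rewrite leq_pmulr.
  rewrite -[X in _ <= X]card_ord.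
  apply: (leq_card_inj (f := fun z => z.2.2)) => //.
  move=> [z [v1 u1]] [z' [v2 u2]]; rewrite !inE /=.
  by move=> /andP[/eqP -> /eqP <-] /andP[/eqP -> /eqP <-] ->.
move=> g c0 [[Bd HL] vE]; split=> // v.
have := @combine_list n n B nn (gr g) Bd h v (fun w => (c0 w).1) HL.
congr list_exact; congr best; apply/funext => u; rewrite /= !eqxx /= vE /val /combine.
congr least; apply/funext => e; apply: eq_existsb => w.
apply: eq_existsb => e1; apply: eq_existsb => e2.
by case: ((c0 v).1 w).
Qed.

End Exact.

(** * The exponent of matrix multiplication *)

Section Exponent.
Variables (R d d1 : nat).
Variables (u : 'I_R -> 'I_d1 -> 'I_d -> int) (v : 'I_R -> 'I_d -> 'I_d -> int).
Variable (w : 'I_R -> 'I_d1 -> 'I_d -> int).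
Hypothesis bilinear : forall i j i' x x' j',
  \sum_t w t i j * (u t i' x * v t x' j') =
    ((i' == i) && (x == x') && (j' == j))%:R.

(* For a fixed row [i0] the identity exhibits the identity matrix of size
   [d * d] as a product through a space of dimension [R]. *)
Lemma bilinear_rank (i0 : 'I_d1) : (d * d <= R)%N.
Proof.
pose P := \matrix_(z < #|{: 'I_d * 'I_d}|, t < R)
  (w t i0 (enum_val z).2 * u t i0 (enum_val z).1).
pose Q := \matrix_(t < R, z < #|{: 'I_d * 'I_d}|) v t (enum_val z).1 (enum_val z).2.
have : P *m Q = 1%:M.
  apply/matrixP => z z'; rewrite !mxE.
  under eq_bigr => t _ do rewrite !mxE -mulrA.
  rewrite bilinear eqxx /=; congr (_%:R : int); rewrite -(inj_eq enum_val_inj) -pair_eqE /=.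
  by rewrite /pair_eq /= [X in _ && X]eq_sym.
by move=> /mulmx1_min; rewrite card_prod !card_ord.
Qed.

End Exponent.

Section Bounds.
Variable R : realType.
Implicit Types (n : nat) (s w x : R).

Lemma natr_ge1 n : (0 < n)%N -> 1 <= n%:R :> R.
Proof. by rewrite ler1n. Qed.

Lemma powR_ge1 x s : 1 <= x -> 0 <= s -> 1 <= x `^ s.
Proof. by move=> x1 s0; rewrite -[X in X <= _](powRr0 x); exact: ler_powR. Qed.

Lemma ceil_pow_bounds n s : (0 < n)%N -> 0 <= s ->
  n%:R `^ s <= (ceil_pow n s)%:R <= 2 * n%:R `^ s.
Proof.
move=> n0 s0; have x1 := powR_ge1 (natr_ge1 n0) s0.
have c0 : (0 <= Num.ceil (n%:R `^ s : R)) by rewrite ceil_ge0; lra.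
have E : (ceil_pow n s)%:R = (Num.ceil (n%:R `^ s : R))%:~R :> R.
  by rewrite /ceil_pow natr_absz ger0_norm.
have /andP[h1 h2] := ceil_itv (n%:R `^ s : R).
rewrite E h2 /=; move: h1; rewrite intrB => h1; lra.
Qed.

Lemma truncn_bounds x : 1 <= x ->
  [/\ (0 < Num.truncn x)%N, (Num.truncn x)%:R <= x & x <= 2 * (Num.truncn x)%:R].
Proof.
move=> x1; have x0 : 0 <= x by lra.
have t0 : (0 < Num.truncn x)%N by rewrite truncn_gt0.
have /andP[h1 h2] := truncn_itv x0; split=> //.
by move: h2 (natr_ge1 t0); rewrite -[_.+1]addn1 natrD => *; lra.
Qed.

(** The rank bound gives [n ^ 2 <= 2 * C * n ^ w] for all [n > 0], which keeps [n ^ (2 - w)]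
    bounded; this is absurd if [w < 2]. *)
Lemma exponent_ge2 s w : 0 <= s -> mulmx_exponent s w -> 2 <= w.
Proof.
move=> s0 [C HC]; rewrite leNgt; apply/negP => w2.
have small n : (0 < n)%N -> n%:R `^ (2 - w) <= 2 * C.
  move=> n0; have [p [out [/slp_bilinear[N [u [v [z [Np bil]]]]] pC]]] := HC n.
  have c0 : (0 < ceil_pow n s)%N.
    rewrite -(ltr_nat R); have /andP[+ _] := ceil_pow_bounds n0 s0.
    by have := powR_ge1 (natr_ge1 n0) s0; lra.
  have := bilinear_rank bil (Ordinal c0); move=> nN.
  have h : n%:R ^+ 2 <= 2 * (C * n%:R `^ w).
    apply: le_trans (_ : (2 * size p)%:R <= _); last by rewrite natrM ler_pM2l //; lra.
    by rewrite -natrX ler_nat; apply: leq_trans Np; rewrite -mulnn.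
  rewrite powRB; last by rewrite pnatr_eq0 -lt0n n0 implybT.
  rewrite ler_pdivrMr ?powR_gt0 ?ltr0n // powR_mulrn // ?ler0n //.
  by apply: le_trans h _; rewrite mulrA.
have C0 : 0 <= C by have := small 1%N isT; rewrite powR1; lra.
pose y := (2 * C + 1) `^ (2 - w)^-1.
have := small (Num.truncn y).+1 isT.
have e0 : 0 < 2 - w by lra.
have : y `^ (2 - w) <= (Num.truncn y).+1%:R `^ (2 - w).
  apply: ge0_ler_powR; rewrite ?nnegrE ?powR_ge0 ?ler0n //; first lra.
  exact/ltW/truncnS_gt.
rewrite /y -powRrM mulVf ?powRr1; lra.
Qed.

End Bounds.

(** * Accounting *)

Section SoftBounds.
Variables (R : realType).

Section Calculus.
Variables (Z : Type) (D : Z -> Prop) (L : Z -> R).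
Implicit Types f g h : Z -> R.

(** Soft-O over a domain of parameters, [L] being the logarithm: one constant and one power serve
    all points of [D], hence all [n] and [eps]. Nonnegativity is included so that bounds can be
    multiplied. *)
Definition soft f g : Prop := exists C p : nat, forall z, D z ->
  [/\ 0 <= f z, 0 <= g z & f z <= C%:R * L z ^+ p * g z].

Hypothesis L1 : forall z, D z -> 1 <= L z.

Lemma soft_le f f' g : (forall z, D z -> 0 <= f z <= f' z) -> soft f' g -> soft f g.
Proof.
move=> h [C [p H]]; exists C, p => z Dz; have [_ g0 le] := H z Dz.
by have /andP[f0 ff'] := h z Dz; split=> //; apply: le_trans le.
Qed.

Lemma soft_weaken f g g' : (forall z, D z -> g z <= g' z) -> soft f g -> soft f g'.
Proof.
move=> h [C [p H]]; exists C, p => z Dz; have [f0 g0 le] := H z Dz.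
have gg' := h z Dz; split=> //; first exact: le_trans gg'.
apply: le_trans le _; apply: ler_wpM2l => //.
by rewrite mulr_ge0 ?exprn_ge0 ?ler0n //; have := L1 Dz; lra.
Qed.

Lemma soft_refl g : (forall z, D z -> 0 <= g z) -> soft g g.
Proof. by move=> h; exists 1%N, 0%N => z Dz; rewrite expr0 !mul1r; split; rewrite ?h. Qed.

Lemma soft_L : soft L (fun=> 1).
Proof. by exists 1%N, 1%N => z Dz; rewrite expr1 mul1r mulr1; have := L1 Dz; split=> //; lra. Qed.

Lemma soft_const (k : nat) : soft (fun=> k%:R) (fun=> 1).
Proof. by exists k, 0%N => z Dz; rewrite expr0 !mulr1 ler0n ler01 lexx. Qed.

Lemma soft_add f1 f2 g : soft f1 g -> soft f2 g -> soft (fun z => f1 z + f2 z) g.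
Proof.
move=> [C1 [p1 H1]] [C2 [p2 H2]]; exists (C1 + C2)%N, (p1 + p2)%N => z Dz.
have [f1p g0 le1] := H1 z Dz; have [f2p _ le2] := H2 z Dz; have l1 := L1 Dz.
split=> //; first lra.
have e1 : 1 <= L z ^+ p1 by exact: exprn_ege1.
have e2 : 1 <= L z ^+ p2 by exact: exprn_ege1.
rewrite natrD exprD; move: e1 e2 le1 le2.
set a := L z ^+ p1; set b := L z ^+ p2 => e1 e2 le1 le2.
have c1 : 0 <= C1%:R * g z by rewrite mulr_ge0.
have c2 : 0 <= C2%:R * g z by rewrite mulr_ge0.
have h1 : C1%:R * a * g z <= C1%:R * (a * b) * g z.
  by rewrite mulrAC [_ * (a * b) * _]mulrAC ler_wpM2l // ler_peMr //; lra.
have h2 : C2%:R * b * g z <= C2%:R * (a * b) * g z.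
  by rewrite mulrAC [_ * (a * b) * _]mulrAC ler_wpM2l // ler_peMl //; lra.
by rewrite !mulrDl; lra.
Qed.

Lemma soft_mul f1 f2 g1 g2 : soft f1 g1 -> soft f2 g2 ->
  soft (fun z => f1 z * f2 z) (fun z => g1 z * g2 z).
Proof.
move=> [C1 [p1 H1]] [C2 [p2 H2]]; exists (C1 * C2)%N, (p1 + p2)%N => z Dz.
have [f1p g1p le1] := H1 z Dz; have [f2p g2p le2] := H2 z Dz.
split; rewrite ?mulr_ge0 //; apply: le_trans (ler_pM f1p f2p le1 le2) _.
by rewrite natrM exprD le_eqVlt; apply/orP; left; apply/eqP; ring.
Qed.

Lemma soft_scale f1 f2 g : soft f1 (fun=> 1) -> soft f2 g -> soft (fun z => f1 z * f2 z) g.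
Proof.
move=> h1 h2; apply: soft_weaken (soft_mul h1 h2) => z _; rewrite mul1r //.
Qed.

Lemma soft_trans f g h : soft f g -> soft g h -> soft f h.
Proof.
move=> [C1 [p1 H1]] [C2 [p2 H2]]; exists (C1 * C2)%N, (p1 + p2)%N => z Dz.
have [f0 g0 le1] := H1 z Dz; have [_ h0 le2] := H2 z Dz; split=> //.
apply: le_trans le1 _; have l1 := L1 Dz.
have c : 0 <= C1%:R * L z ^+ p1 by rewrite mulr_ge0 ?exprn_ge0 ?ler0n //; lra.
apply: le_trans (ler_wpM2l c le2) _.
by rewrite natrM exprD le_eqVlt; apply/orP; left; apply/eqP; ring.
Qed.

Lemma soft_addn (F1 F2 : Z -> nat) g : soft (fun z => (F1 z)%:R) g ->
  soft (fun z => (F2 z)%:R) g -> soft (fun z => (F1 z + F2 z)%N%:R) g.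
Proof.
move=> h1 h2; apply: soft_le (soft_add h1 h2) => z _.
by rewrite -natrD ler0n lexx.
Qed.

Lemma soft_muln (F1 F2 : Z -> nat) g : soft (fun z => (F1 z)%:R) (fun=> 1) ->
  soft (fun z => (F2 z)%:R) g -> soft (fun z => (F1 z * F2 z)%N%:R) g.
Proof.
move=> h1 h2; apply: soft_le (soft_scale h1 h2) => z _.
by rewrite -natrM ler0n lexx.
Qed.

Lemma soft_constn (k : nat) g : (forall z, D z -> 1 <= g z) -> soft (fun=> k%:R) g.
Proof. by move=> h; apply: soft_weaken (soft_const k). Qed.

Lemma soft_leqn (F F' : Z -> nat) g : (forall z, D z -> (F z <= F' z)%N) ->
  soft (fun z => (F' z)%:R) g -> soft (fun z => (F z)%:R) g.
Proof. by move=> h; apply: soft_le => z Dz; rewrite ler0n ler_nat h. Qed.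

End Calculus.

Section Sums.
Variables (Z : Type) (D : Z -> Prop) (L : Z -> R) (J : Z -> nat).
Hypothesis L1 : forall z, D z -> 1 <= L z.

(** The index of a sum becomes a further parameter, which forces the bound on the terms to be
    uniform in the index. *)
Definition below (y : Z * nat) : Prop := D y.1 /\ (y.2 < J y.1)%N.

Lemma soft_below f g : soft D L f g ->
  soft below (fun y => L y.1) (fun y => f y.1) (fun y => g y.1).
Proof. by move=> [C [p H]]; exists C, p => -[z j] [Dz _]; exact: H. Qed.

Lemma soft_sum (F : Z * nat -> nat) g : soft D L (fun z => (J z)%:R) (fun=> 1) ->
  soft below (fun y => L y.1) (fun y => (F y)%:R) (fun y => g y.1) ->
  (forall z, D z -> 0 <= g z) ->
  soft D L (fun z => (\sum_(j < J z) F (z, j : nat))%N%:R) g.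
Proof.
move=> hJ [C [p H]] g0.
have h2 : soft D L (fun z => C%:R * L z ^+ p * g z) g.
  exists C, p => z Dz; split; rewrite ?g0 //; rewrite mulr_ge0 ?g0 // mulr_ge0 ?ler0n // exprn_ge0 //.
  by have := L1 Dz; lra.
apply: soft_le (soft_scale L1 hJ h2) => z Dz; rewrite ler0n natr_sum /=.
apply: le_trans (_ : \sum_(j < J z) (C%:R * L z ^+ p * g z) <= _).
  by apply: ler_sum => j _; have [] := H (z, j : nat) (conj Dz (ltn_ord j)).
by rewrite sumr_const card_ord -[X in X <= _]mulr_natl.
Qed.

End Sums.

End SoftBounds.

Section Polynomial.
Local Open Scope nat_scope.
Variables (Z : Type) (D : Z -> Prop) (n : Z -> nat).
Hypothesis n1 : forall z, D z -> 1 < n z.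

Definition poly_bounded (F : Z -> nat) := exists a, forall z, D z -> F z <= (n z).+1 ^ a.

Lemma poly_le F F' : (forall z, D z -> F z <= F' z) -> poly_bounded F' -> poly_bounded F.
Proof. by move=> h [a H]; exists a => z Dz; apply: leq_trans (H z Dz); exact: h. Qed.

Lemma poly_const k : poly_bounded (fun=> k).
Proof. by exists k => z Dz; apply/ltnW/ltn_expl; rewrite ltnS ltnW ?n1. Qed.

Lemma poly_n : poly_bounded n.
Proof. by exists 1 => z _; rewrite expn1. Qed.

Lemma poly_add F F' : poly_bounded F -> poly_bounded F' -> poly_bounded (fun z => F z + F' z).
Proof.
move=> [a H] [b H']; exists (a + b).+1 => z Dz.
have h1 : (n z).+1 ^ a <= (n z).+1 ^ (a + b) by rewrite leq_pexp2l // leq_addr.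
have h2 : (n z).+1 ^ b <= (n z).+1 ^ (a + b) by rewrite leq_pexp2l // leq_addl.
rewrite expnS; have := leq_mul (n1 Dz) (leqnn ((n z).+1 ^ (a + b))).
by have := H z Dz; have := H' z Dz; rewrite mulSn; lia.
Qed.

Lemma poly_mul F F' : poly_bounded F -> poly_bounded F' -> poly_bounded (fun z => F z * F' z).
Proof. by move=> [a H] [b H']; exists (a + b) => z Dz; rewrite expnD leq_mul ?H ?H'. Qed.

Lemma poly_exp F k : poly_bounded F -> poly_bounded (fun z => F z ^ k).
Proof. by move=> [a H]; exists (a * k) => z Dz; rewrite expnM leq_expl ?H. Qed.

End Polynomial.

(** * The parameters as functions of [n] and [eps] *)

Section MainQuantities.
Variables (R : realType) (w r r' : R).
Hypotheses (w2 : 2 <= w) (Hr : 0 < r < 1) (Hr' : 0 <= r' <= 1).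
Implicit Type n : nat.

(** Chosen so that its power of exponent [w] is at most [n]: the program for this format then has
    [O(n)] instructions. *)
Definition dim n : nat := Num.truncn (n%:R `^ (1 / w)).
Definition dim1 n : nat := ceil_pow (dim n) r'.
Definition ball_size n : nat := Num.truncn (n%:R `^ (1 - r)).
Definition cover n : nat := (n %/ ball_size n).+1.

Lemma iw_bounds : 0 < 1 / w <= 2^-1.
Proof.
have w2' := w2; have w0 : 0 < w by lra.
rewrite div1r invr_gt0 w0 /=; rewrite lef_pV2 ?posrE //; lra.
Qed.

Lemma powD n (a b : R) : (0 < n)%N -> n%:R `^ (a + b) = n%:R `^ a * n%:R `^ b :> R.
Proof. by move=> n0; rewrite powRD // pnatr_eq0 -lt0n n0 implybT. Qed.

Lemma pow_le n (a b : R) : (0 < n)%N -> a <= b -> n%:R `^ a <= n%:R `^ b :> R.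
Proof. by move=> n0; apply: ler_powR; rewrite ler1n. Qed.

Lemma square_le n (k : nat) (a : R) : (0 < n)%N -> a <= 2^-1 -> k%:R <= n%:R `^ a :> R ->
  (k * k <= n)%N.
Proof.
move=> n0 a2 h; rewrite -(ler_nat R) natrM.
apply: le_trans (ler_pM (ler0n _ k) (ler0n _ k) h h) _; rewrite -powD //.
by rewrite -[X in _ <= X]powRr1 ?ler0n //; apply: pow_le => //; lra.
Qed.

Lemma dimP n : (0 < n)%N ->
  [/\ (0 < dim n)%N, (dim n * dim n <= n)%N, (dim n)%:R <= n%:R `^ (1 / w) :> R &
      n%:R `^ (1 / w) <= 2 * (dim n)%:R :> R].
Proof.
move=> n0; have /andP[iw0 iw2] := iw_bounds.
have [h1 h2 h3] := truncn_bounds (powR_ge1 (natr_ge1 R n0) (ltW iw0)).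
by split=> //; exact: square_le h2.
Qed.

Lemma dim1P n : (0 < n)%N ->
  [/\ (0 < dim1 n)%N, (dim1 n <= dim n)%N & n%:R `^ (r' / w) <= 2 * (dim1 n)%:R :> R].
Proof.
move=> n0; have [d0 _ _ d2] := dimP n0; have /andP[r0 r1] := Hr'.
have d1 : 1 <= (dim n)%:R :> R by rewrite ler1n.
have /andP[c1 _] := ceil_pow_bounds d0 r0.
have p1 := powR_ge1 d1 r0; split.
- by rewrite -(ltr_nat R); apply: lt_le_trans c1; lra.
- rewrite -(ler_nat R) /dim1 /ceil_pow natr_absz ger0_norm; last by rewrite ceil_ge0; lra.
  rewrite [X in _ <= X]pmulrn ler_int ceil_le_int -pmulrn; apply: le_trans (_ : (dim n)%:R `^ 1 <= _).
    exact: ler_powR.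
  by rewrite powRr1 ?ler0n.
have -> : r' / w = (1 / w) * r' by rewrite div1r mulrC.
rewrite powRrM; apply: le_trans (_ : (2 * (dim n)%:R) `^ r' <= _).
  by apply: ge0_ler_powR; rewrite ?nnegrE ?powR_ge0 // mulr_ge0 // ler0n.
rewrite powRM ?ler0n //; apply: ler_pM; rewrite ?powR_ge0 //.
by rewrite -[X in _ <= X](@powRr1 _ 2) //; apply: ler_powR => //; lra.
Qed.

(** The balls must satisfy [k * k <= n], that is [1 - r <= 1/2]; this follows from
    [1 - r = (1 - r') / w] and [w >= 2]. *)
Lemma ball_sizeP n : r = 1 - (1 - r') / w -> (0 < n)%N ->
  [/\ (0 < ball_size n)%N, (ball_size n * ball_size n <= n)%N,
      (n <= cover n * ball_size n)%N & (cover n)%:R <= 3 * n%:R `^ r :> R].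
Proof.
move=> rE n0; have /andP[iw0 iw2] := iw_bounds; have /andP[r0 r1] := Hr.
have /andP[s0 s1] := Hr'.
have e0 : 0 <= 1 - r by lra.
have e1 : 1 - r <= 2^-1.
  rewrite rE (_ : 1 - (1 - (1 - r') / w) = (1 - r') * (1 / w)); last by rewrite div1r; ring.
  apply: le_trans iw2; rewrite -[X in _ <= X]mul1r; clear rE; apply: ler_wpM2r; lra.
clear rE.
have [h1 h2 h3] := truncn_bounds (powR_ge1 (natr_ge1 R n0) e0).
split=> //; first exact: square_le h2.
  by rewrite /cover; exact/ltnW/ltn_ceil.
have b0 : 0 < (ball_size n)%:R :> R by rewrite ltr0n.
have p1 := powR_ge1 (natr_ge1 R n0) (ltW r0).
have q0 : 0 < n%:R `^ (1 - r) :> R by rewrite powR_gt0 // ltr0n.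
have nE : n%:R `^ r * n%:R `^ (1 - r) = n%:R :> R.
  by rewrite -powD // (_ : r + (1 - r) = 1) ?powRr1 ?ler0n //; ring.
have le : (n %/ ball_size n)%:R * (ball_size n)%:R <= n%:R :> R.
  by rewrite -natrM ler_nat leq_divM.
have le2 : (n %/ ball_size n)%:R <= 2 * n%:R `^ r :> R.
  rewrite -(ler_pM2r b0); apply: le_trans le _; rewrite -[X in X <= _]nE.
  rewrite -mulrA [2 * _]mulrC -mulrA; apply: ler_wpM2l; first by lra.
  by rewrite mulrC.
by rewrite /cover -addn1 natrD; lra.
Qed.

Definition delta (z : nat * R) : R := z.2^-1.
Definition target (z : nat * R) : R := z.1%:R `^ (1 - 2 / w) / z.2.
Definition eceil (z : nat * R) : nat := (Num.truncn (delta z)).+1.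
(** The last level has relative error [2 / 2 ^ levels], which this choice makes at most [eps] while
    the power stays of order [1 / eps]. *)
Definition levels (z : nat * R) : nat := (lg (eceil z)).+1.

(* Larger values of [1 / eps] are cheaper to treat exactly. *)
Definition moderate (z : nat * R) : Prop :=
  [/\ (1 < z.1)%N, 0 < z.2 < 1 & delta z <= z.1%:R `^ (1 - 1 / w)].

Definition logn (z : nat * R) : R := (lg z.1)%:R.

Lemma delta_ge1 z : moderate z -> 1 <= delta z.
Proof.
move=> [_ /andP[e0 e1] _]; rewrite /delta -[X in X <= _]invr1 lef_pV2 ?posrE //; lra.
Qed.

Lemma logn_ge1 z : moderate z -> 1 <= logn z.
Proof. by move=> _; rewrite /logn ler1n. Qed.

Lemma delta_le_n z : moderate z -> delta z <= z.1%:R.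
Proof.
move=> [n1 _ h]; have /andP[iw0 iw2] := iw_bounds; apply: le_trans h _.
by rewrite -[X in _ <= X]powRr1 ?ler0n //; apply: pow_le; [exact: ltnW | lra].
Qed.

Lemma eceilP z : moderate z -> [/\ delta z <= (eceil z)%:R, (eceil z)%:R <= 2 * delta z &
  (eceil z <= 2 * z.1)%N].
Proof.
move=> mz; have d1 := delta_ge1 mz; have [t0 t1 t2] := truncn_bounds d1.
have e1 := truncnS_gt (delta z).
have e2 : (eceil z)%:R <= 2 * delta z.
  by rewrite /eceil -addn1 natrD; lra.
split=> //; first exact: ltW.
by rewrite -(ler_nat R) natrM; apply: le_trans e2 _; have := delta_le_n mz; lra.
Qed.

Lemma levelsP z : moderate z ->
  2 * delta z <= (2 ^ levels z)%:R /\ (2 ^ levels z <= 4 * eceil z)%N.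
Proof.
move=> mz; have [h1 h2 h3] := eceilP mz; rewrite /levels expnS; split.
  by rewrite natrM ler_pM2l //; apply: le_trans h1 _; rewrite ler_nat ltnW // ltn_lg.
have : (2 ^ trunc_log 2 (eceil z) <= eceil z)%N by rewrite trunc_logP.
by rewrite /lg expnS; lia.
Qed.

Lemma target_ge z : moderate z -> delta z <= target z.
Proof.
move=> mz; have [n1 /andP[e0 e1] _] := mz; have /andP[iw0 iw2] := iw_bounds.
rewrite /target -[delta z]mul1r; apply: ler_wpM2r; first by rewrite invr_ge0 ltW.
apply: powR_ge1; first by rewrite ler1n ltnW.
by rewrite (_ : 1 - 2 / w = 1 - 2 * (1 / w)); [lra | rewrite div1r].
Qed.

(** The share of the cost independent of the number of roots: [1 / eps] steps with entries of size
    [1 / eps], divided by the block dimension. The restriction to moderate [eps] is used here. *)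
Lemma target_square z : moderate z -> delta z * delta z * z.1%:R `^ (- (1 / w)) <= target z.
Proof.
move=> mz; have [n1 /andP[e0 e1] dn] := mz; have d1 := delta_ge1 mz.
have n0 : (0 < z.1)%N by exact: ltnW.
have q0 : 0 < z.1%:R `^ (- (1 / w)) :> R by rewrite powR_gt0 // ltr0n.
have -> : target z = delta z * (z.1%:R `^ (1 - 1 / w) * z.1%:R `^ (- (1 / w))).
  by rewrite -powD // /target mulrC; congr (_ * _ `^ _); rewrite div1r; ring.
rewrite -mulrA; apply: ler_wpM2l; first lra.
by apply: ler_wpM2r; [exact: ltW | exact: dn].
Qed.

(** The share proportional to the [n ^ r] roots; the exponents balance exactly by the equation for
    [r']. *)
Lemma target_sources z : r = 1 - (1 - r') / w -> moderate z ->
  delta z * z.1%:R `^ r * (z.1%:R `^ (- (r' / w)) * z.1%:R `^ (- (1 / w))) = target z.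
Proof.
move=> rE [n1 _ _]; have n0 : (0 < z.1)%N by exact: ltnW.
rewrite -mulrA -!powD // /target mulrC; congr (_ `^ _ * _); rewrite rE div1r; ring.
Qed.

End MainQuantities.

Section RouteCost.
Local Open Scope nat_scope.

Definition route_factor (e f : nat) : nat :=
  (2 * e + 5) * (2 * e + 5).+2 + 3 * ((2 * e + 10) * (e + f).+2).

Lemma route_cost_le n e f t : route_cost n e f t <= route_factor e f * (lg n * (t + 1)).
Proof.
rewrite /route_cost /route_factor; have l0 : 0 < lg n by [].
move: (lg _) l0 => l l0; set u := 2 * e + 5; set v := (e + f).+2.
have h1 := leq_mul (leqnn (u * u.+2)) (leq_mul l0 (leqnn (t + 1))).
have h2 : 4 * t + (2 * e + 6) * l <= (2 * e + 10) * (l * (t + 1)).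
  have := leq_mul l0 (leqnn t).
  have := leq_mul (leqnn ((2 * e + 6) * l)) (isT : 1 <= t.+1); lia.
have h3 := leq_mul h2 (leqnn v).
by rewrite mulnDl; have := leq_mul (leqnn (u * u.+2)) (isT : 1 <= t.+1); lia.
Qed.

End RouteCost.

Section Accounting.
Variables (R : realType) (w r r' : R) (c a b X bB Cr : nat).
Hypotheses (w2 : 2 <= w) (Hr : 0 < r < 1) (Hr' : 0 <= r' <= 1).
Hypothesis rE : r = 1 - (1 - r') / w.

(** Since [(3 / 2) ^ 2 >= 2], this many scales stretch the range by at least [n ^ c.+1], which
    bounds all distances. *)
Definition scales (z : nat * R) : nat := 2 * c.+1 * lg z.1.
Definition slices (z : nat * R) : nat :=
  8 * (8 * scales z + 13) * precision (scales z) (levels z) + 2.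
Definition rank_bits (z : nat * R) : nat := X * lg z.1.
Definition source_count (z : nat * R) : nat :=
  hub_sources z.1 (cover r z.1) (5 * lg z.1) (ceil_pow z.1 r).
Definition pcost (z : nat * R) : nat := prepare_cost z.1 (slices z) a Cr (dim w z.1).
Definition mcost (z : nat * R) : nat -> nat :=
  product_cost z.1 (slices z) a Cr (dim w z.1) (dim1 w r' z.1).

Section Over.
Variables (Z : Type) (D : Z -> Prop) (pi : Z -> nat * R).
Hypothesis Dpi : forall z, D z -> moderate w (pi z).
Let L z := logn (pi z).

Lemma L_ge1 z : D z -> 1 <= L z.
Proof. by move=> Dz; exact: logn_ge1 (Dpi Dz). Qed.

Lemma soft_lg : soft D L (fun z => (lg (pi z).1)%:R) (fun=> 1).
Proof. exact: soft_L L_ge1. Qed.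

Lemma soft1n (k : nat) : soft D L (fun=> k%:R) (fun=> 1).
Proof. exact: soft_const. Qed.

Lemma soft_scales : soft D L (fun z => (scales (pi z))%:R) (fun=> 1).
Proof. by apply: soft_muln; [exact: L_ge1 | exact: soft1n | exact: soft_lg]. Qed.

Lemma soft_coarseness : soft D L (fun z => (coarseness (scales (pi z)))%:R) (fun=> 1).
Proof.
apply: soft_addn; [exact: L_ge1 | | exact: soft1n].
by apply: soft_muln; [exact: L_ge1 | exact: soft1n | exact: soft_scales].
Qed.

Lemma soft_levels : soft D L (fun z => (levels (pi z))%:R) (fun=> 1).
Proof.
apply: soft_leqn (_ : soft D L (fun z => (lg (pi z).1 + 2)%N%:R) _).
  move=> z Dz; have [_ _ h] := eceilP w2 (Dpi Dz).
  rewrite /levels /lg addn2 !ltnS -ltnS -(ltn_exp2l _ _ (isT : (1 < 2)%N)).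
  apply: leq_ltn_trans (trunc_logP _ _) _ => //.
  apply: leq_ltn_trans h _; rewrite expnS ltn_pmul2l //; exact: ltn_lg.
by apply: soft_addn; [exact: L_ge1 | exact: soft_lg | exact: soft1n].
Qed.

Lemma delta_ge0 z : D z -> 0 <= delta (pi z).
Proof. by move=> /Dpi/(delta_ge1 (w := w)); lra. Qed.

Lemma soft_delta_const (k : nat) : soft D L (fun=> k%:R) (fun z => delta (pi z)).
Proof. by apply: (soft_constn L_ge1) => z /Dpi; exact: delta_ge1. Qed.

Lemma soft_pow2 : soft D L (fun z => (2 ^ levels (pi z))%:R) (fun z => delta (pi z)).
Proof.
apply: soft_le (soft_scale L_ge1 (soft1n 8) (soft_refl L delta_ge0)) => z Dz.
have [_ h] := levelsP w2 Hr Hr' (Dpi Dz); have [_ h2 _] := eceilP w2 (Dpi Dz).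
rewrite ler0n /=; move: h; rewrite -(ler_nat R) natrM; lra.
Qed.

Lemma soft_precision : soft D L (fun z => (precision (scales (pi z)) (levels (pi z)))%:R)
  (fun z => delta (pi z)).
Proof. by apply: soft_muln; [exact: L_ge1 | exact: soft_coarseness | exact: soft_pow2]. Qed.

Lemma soft_slices : soft D L (fun z => (slices (pi z))%:R) (fun z => delta (pi z)).
Proof.
have l1 := L_ge1.
apply: soft_addn => //; last exact: soft_delta_const.
apply: soft_muln => //; last exact: soft_precision.
apply: soft_muln => //; first exact: soft1n.
apply: soft_addn => //; last exact: soft1n.
by apply: soft_muln => //; [exact: soft1n | exact: soft_scales].
Qed.

Lemma soft_dim : soft D L (fun z => (dim w (pi z).1)%:R^-1) (fun z => (pi z).1%:R `^ (- (1 / w))).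
Proof.
apply: soft_le (soft_scale L_ge1 (soft1n 2) (soft_refl L _)) => z Dz; last by rewrite powR_ge0.
have [n1 _ _] := Dpi Dz; have n0 : (0 < (pi z).1)%N by exact: ltnW.
have [d0 _ _ h] := dimP w2 n0; rewrite invr_ge0 ler0n powRN /=.
have p0 : 0 < (pi z).1%:R `^ (1 / w) :> R by rewrite powR_gt0 // ltr0n.
by rewrite ler_pdivlMr // mulrC ler_pdivrMr // ltr0n.
Qed.

Lemma soft_dim1 : soft D L (fun z => (dim1 w r' (pi z).1)%:R^-1)
  (fun z => (pi z).1%:R `^ (- (r' / w))).
Proof.
apply: soft_le (soft_scale L_ge1 (soft1n 2) (soft_refl L _)) => z Dz; last by rewrite powR_ge0.
have [n1 _ _] := Dpi Dz; have n0 : (0 < (pi z).1)%N by exact: ltnW.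
have [d0 _ h] := dim1P w2 Hr' n0; rewrite invr_ge0 ler0n powRN /=.
have p0 : 0 < (pi z).1%:R `^ (r' / w) :> R by rewrite powR_gt0 // ltr0n.
by rewrite ler_pdivlMr // mulrC ler_pdivrMr // ltr0n.
Qed.

Lemma soft_source_count : soft D L (fun z => (source_count (pi z))%:R)
  (fun z => (pi z).1%:R `^ r).
Proof.
have l1 := L_ge1.
have rf : soft D L (fun z => (pi z).1%:R `^ r) (fun z => (pi z).1%:R `^ r).
  by apply: soft_refl => z _; exact: powR_ge0.
have /andP[r0 _] := Hr.
apply: (soft_leqn (F' := fun z => ceil_pow (pi z).1 r + 5 * lg (pi z).1 * cover r (pi z).1)%N).
  by move=> z Dz; rewrite /source_count /hub_sources mulnC geq_minr.
apply: soft_addn => //.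
  apply: soft_le (soft_scale l1 (soft1n 2) rf) => z Dz; rewrite ler0n /=.
  have [n1 _ _] := Dpi Dz.
  by have /andP[_] := ceil_pow_bounds (R := R) (ltnW n1 : (0 < (pi z).1)%N) (ltW r0).
apply: soft_muln => //; first by apply: soft_muln => //; [exact: soft1n | exact: soft_lg].
apply: soft_le (soft_scale l1 (soft1n 3) rf) => z Dz; rewrite ler0n /=.
have [n1 _ _] := Dpi Dz.
by have [_ _ _ h] := ball_sizeP w2 Hr Hr' rE (ltnW n1 : (0 < (pi z).1)%N).
Qed.

Lemma target_ge1 z : D z -> 1 <= target w (pi z).
Proof. by move=> Dz; have := target_ge w2 (Dpi Dz); have := delta_ge1 (Dpi Dz); lra. Qed.

Lemma target_ge0 z : D z -> 0 <= target w (pi z).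
Proof. by move=> /target_ge1; lra. Qed.

Lemma soft_target_const (k : nat) : soft D L (fun=> k%:R) (fun z => target w (pi z)).
Proof. exact: (soft_constn L_ge1 k target_ge1). Qed.

Lemma soft_target_delta f : soft D L f (fun z => delta (pi z)) ->
  soft D L f (fun z => target w (pi z)).
Proof.
move=> h; apply: (soft_weaken L_ge1 _ h) => z Dz; exact: (target_ge w2 (Dpi Dz)).
Qed.

Lemma soft_route (e f : nat) (t : Z -> nat) g : (forall z, D z -> 1 <= g z) ->
  soft D L (fun z => (t z)%:R) g -> soft D L (fun z => (route_cost (pi z).1 e f (t z))%:R) g.
Proof.
move=> g1 st; have l1 := L_ge1.
apply: (soft_leqn (F' := fun z => route_factor e f * (lg (pi z).1 * (t z + 1)))%N).
  by move=> z _; exact: route_cost_le.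
apply: soft_muln => //; first exact: soft1n.
apply: soft_muln => //; first exact: soft_lg.
by apply: soft_addn => //; exact: soft_constn.
Qed.

End Over.

End Accounting.

Section CostSums.
Local Open Scope nat_scope.

Lemma card_multiples T d : 0 < d -> #|[pred t : 'I_T | d %| t]| <= T %/ d + 1.
Proof.
move=> d0; rewrite addn1 -[X in _ <= X]card_ord.
apply: (leq_card_inj (f := fun t : 'I_T => inord (t %/ d) : 'I_(T %/ d).+1)) => // t t'.
have lt (u : 'I_T) : u %/ d < (T %/ d).+1 by rewrite ltnS leq_div2r // ltnW.
rewrite !inE => /dvdnP[q qE] /dvdnP[q' qE'] /(congr1 val); rewrite /= !inordK //.
by rewrite qE qE' !mulnK // => E; apply/val_inj; rewrite /= qE qE' E.
Qed.

(** Class [j] is due only at multiples of [2 ^ j]; the factor 2 covers the two relaxations of class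
    0 per step. *)
Lemma sum_macro_cost mc J K T : \sum_(t < T) macro_cost mc J K t <=
  \sum_(j < J.+1) 2 * (T %/ 2 ^ j + 1) * mc (K j).
Proof.
rewrite /macro_cost big_split big_split /= !sum_nat_const card_ord exchange_big /=.
rewrite big_ord_recl expn0 divn1 addnA; apply: leq_add; first by set k := mc _; lia.
apply: leq_sum => i _; rewrite -big_mkcond /= sum_nat_const.
rewrite leq_mul2r; apply/orP; right.
by rewrite /bump add1n; apply: leq_trans (card_multiples T _) (leq_pmull _ _); rewrite ?expn_gt0.
Qed.

End CostSums.

Section ProductLoad.
Variables (R : realType) (n W Cr d d1 : nat).
Hypotheses (d0 : (0 < d)%N) (dn : (d * d <= n)%N).

Lemma natr_divn_le (x y : nat) : (x %/ y)%:R <= x%:R / y%:R :> R.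
Proof.
case: (posnP y) => [->|y0]; first by rewrite divn0 invr0 mulr0.
by rewrite ler_pdivlMr ?ltr0n // -natrM ler_nat leq_divM.
Qed.

Lemma bsize_n_le : (bsize d n)%:R <= 2 * n%:R / d%:R :> R.
Proof.
have dn' : (d <= n)%N by apply: leq_trans dn; rewrite leq_pmulr.
rewrite ler_pdivlMr ?ltr0n // -!natrM ler_nat mulnC.
by have /andP[_ h] := bsizeP n d0; apply: leq_trans h _; lia.
Qed.

Hypotheses (n0 : (0 < n)%N) (d10 : (0 < d1)%N) (d1d : (d1 <= d)%N).

(** A vertex owns [O(1)] products, each on a block of about [K / d1] by [n / d] entries with [2 * W]
    layers, and exchanges [n] messages per round. *)
Lemma product_load_le K : (product_load n W Cr d d1 K)%:R <=
  (4 * Cr + 10)%:R * ((K%:R / d1%:R + 1) * (W%:R / d%:R) + 1) :> R.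
Proof.
have nR : 0 < n%:R :> R by rewrite ltr0n.
have dR : 0 < d%:R :> R by rewrite ltr0n.
have d1R : 0 < d1%:R :> R by rewrite ltr0n.
set al := K%:R / d1%:R; set be := W%:R / d%:R.
have al0 : 0 <= al by rewrite divr_ge0 ?ler0n.
have be0 : 0 <= be by rewrite divr_ge0 ?ler0n.
have T0 : 0 <= (al + 1) * be by rewrite mulr_ge0 //; lra.
have bK : (bsize d1 K)%:R <= al + 1.
  by rewrite /bsize -addn1 natrD lerD2r natr_divn_le.
have x1 : (bsize d1 K * bsize d n * (2 * W) %/ n)%:R <= 4 * ((al + 1) * be).
  apply: le_trans (natr_divn_le _ _) _; rewrite ler_pdivrMr //.
  rewrite !natrM; apply: le_trans (_ : (al + 1) * (2 * n%:R / d%:R) * (2 * W%:R) <= _).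
    apply: ler_wpM2r; first by rewrite mulr_ge0 ?ler0n.
    by apply: ler_pM; rewrite ?ler0n ?bsize_n_le.
  by rewrite /be le_eqVlt; apply/orP; left; apply/eqP; ring.
have x2 : ((K + d1) * (2 * W) %/ n)%:R <= 2 * ((al + 1) * be).
  apply: le_trans (natr_divn_le _ _) _; rewrite ler_pdivrMr //.
  have -> : (((K + d1) * (2 * W))%N%:R : R) = 2 * ((al + 1) * be) * (d1%:R * d%:R).
    rewrite !natrM natrD /al /be; field; apply/andP; split; exact: lt0r_neq0.
  apply: ler_wpM2l; first lra.
  rewrite -natrM ler_nat; apply: leq_trans dn; rewrite leq_mul2r d1d orbT //.
rewrite /product_load -addn1 !(natrD, natrM); move: x1 x2; rewrite ?(natrD, natrM).
set x := (_ %/ _)%:R; set y := (_ %/ _)%:R; set T := (al + 1) * be in T0 * => x1 x2.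
have C0 : 0 <= Cr%:R :> R by rewrite ler0n.
have h : (Cr%:R + 1) * (x + 1) <= (Cr%:R + 1) * (4 * T + 1) by apply: ler_wpM2l; lra.
have := mulr_ge0 C0 T0; lra.
Qed.

End ProductLoad.

Section Totals.
Variables (R : realType) (w r r' : R) (c a b X bB Cr : nat).
Hypotheses (w2 : 2 <= w) (Hr : 0 < r < 1) (Hr' : 0 <= r' <= 1).
Hypothesis rE : r = 1 - (1 - r') / w.

Section Over.
Variables (Z : Type) (D : Z -> Prop) (pi : Z -> nat * R).
Hypothesis Dpi : forall z, D z -> moderate w (pi z).
Let L z := logn (pi z).
Let L1 z : D z -> 1 <= L z.
Proof. exact: L_ge1 Dpi z. Qed.
Let goal z := target w (pi z).

Lemma soft_half f : soft D L f (fun z => 2 * goal z) -> soft D L f goal.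
Proof.
move=> h; apply: (soft_trans L1 h).
by apply: (soft_scale L1 (soft1n D pi 2) (soft_refl L _)) => z; exact: (target_ge0 w2 Dpi).
Qed.

Lemma soft_slice_ratio : soft D L (fun z => (slices c (pi z))%:R / (dim w (pi z).1)%:R)
  (fun z => delta (pi z) * (pi z).1%:R `^ (- (1 / w))).
Proof. apply: (soft_mul (soft_slices c w2 Hr Hr' Dpi) (soft_dim w2 Dpi)). Qed.

(** For [s] relaxations with [K] rows the main terms are [s * K * W / (d1 * d)] and [s * W / d]. The
    bound on [s * K] is what the delays provide; [target_sources] and [target_square] do the
    rest. *)
Lemma soft_term (s K : Z -> nat) : soft D L (fun z => (s z)%:R) (fun z => delta (pi z)) ->
  soft D L (fun z => (s z * K z)%N%:R) (fun z => (pi z).1%:R `^ r + delta (pi z)) ->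
  soft D L (fun z => (s z * mcost w r' c a Cr (pi z) (K z))%N%:R) goal.
Proof.
move=> ss sK.
pose t z := product_load (pi z).1 (slices c (pi z)) Cr (dim w (pi z).1) (dim1 w r' (pi z).1) (K z).
apply: (soft_leqn (F' := fun z => 4 * (route_factor a 8 * (lg (pi z).1 * (s z * t z + s z))))%N).
  move=> z _; rewrite /mcost /product_cost -/(t z).
  have := leq_mul (leqnn (s z)) (route_cost_le (pi z).1 a 8 (t z)).
  by set rc := route_cost _ _ _ _; lia.
apply: soft_muln => //; first exact: soft1n.
apply: soft_muln => //; first exact: soft1n.
apply: soft_muln => //; first exact: soft_lg Dpi.
have st := soft_target_delta w2 Dpi ss.
apply: soft_addn => //.
pose W' z : R := (slices c (pi z))%:R / (dim w (pi z).1)%:R.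
apply: (soft_le (f' := fun z => (4 * Cr + 10)%:R * (((s z * K z)%N%:R * (dim1 w r' (pi z).1)%:R^-1 * W' z
   + (s z)%:R * W' z) + (s z)%:R))).
  move=> z Dz; rewrite ler0n /=; have [n1 _ _] := Dpi Dz; have n0 : (0 < (pi z).1)%N by exact: ltnW.
  have [d0 dd _ _] := dimP w2 n0; have [d10 d1d _] := dim1P w2 Hr' n0.
  have := product_load_le R (slices c (pi z)) Cr d0 dd n0 d10 d1d (K z).
  rewrite -/(t z) -/(W' z) => h; rewrite natrM.
  apply: le_trans (ler_wpM2l (ler0n _ (s z)) h) _.
  by rewrite natrM le_eqVlt; apply/orP; left; apply/eqP; ring.
apply: soft_scale => //; first exact: soft1n.
apply: soft_add => //; apply: soft_add => //; last first.
  apply: soft_weaken (soft_mul ss soft_slice_ratio) => // z Dz; rewrite mulrA.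
  exact: (target_square (Dpi Dz)).
apply: soft_half.
apply: (soft_weaken L1 _ (soft_mul (soft_mul sK (soft_dim1 w2 Hr' Dpi)) soft_slice_ratio)) => z Dz.
have mz := Dpi Dz; have d1 := delta_ge1 mz; have [n1 _ _] := mz.
have h1 := target_sources rE mz; have h2 := target_square mz.
have p0 : 0 <= (pi z).1%:R `^ (- (1 / w)) :> R by exact: powR_ge0.
have q1 : (pi z).1%:R `^ (- (r' / w)) <= 1 :> R.
  rewrite -[X in _ <= X](powRr0 (pi z).1%:R); apply: pow_le; first exact: ltnW.
  have /andP[r0 _] := Hr'; rewrite oppr_le0 divr_ge0 //; have := w2; lra.
rewrite /goal; move: h1 h2 p0 q1 d1.
set A := _ `^ r; set B := _ `^ _; set E := _ `^ _; set d := delta _.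
move=> h1 h2 p0 q1 d1.
have h3 : d * d * E * B <= d * d * E * 1 by apply: ler_wpM2l => //; rewrite !mulr_ge0 //; lra.
rewrite mulr1 in h3.
have -> : (A + d) * B * (d * E) = d * A * (B * E) + d * d * E * B by ring.
lra.
Qed.

Lemma soft_pcost : soft D L (fun z => (pcost w c a Cr (pi z))%:R) goal.
Proof.
have g1 := target_ge1 w2 Dpi.
suff st : soft D L (fun z => (prepare_load (pi z).1 (slices c (pi z)) Cr (dim w (pi z).1))%:R) goal.
  by apply: (soft_addn L1); apply: (soft_route Dpi a 8 g1 st).
have sW := soft_slices c w2 Hr Hr' Dpi.
apply: soft_addn => //; last by apply: soft_muln => //; [exact: soft1n | exact: soft_target_delta].
apply: soft_muln => //; first exact: soft1n.
apply: soft_addn => //; last exact: soft_target_const.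
pose D' z : R := (dim w (pi z).1)%:R^-1.
apply: (soft_le (f' := fun z => 4 * ((pi z).1%:R * (D' z * ((slices c (pi z))%:R / (dim w (pi z).1)%:R))))).
  move=> z Dz; rewrite ler0n /=; have [n1 _ _] := Dpi Dz; have n0 : (0 < (pi z).1)%N by exact: ltnW.
  have [d0 dd _ _] := dimP w2 n0; have h := bsize_n_le R d0 dd.
  apply: le_trans (natr_divn_le R _ _) _; rewrite ler_pdivrMr ?ltr0n // !natrM.
  apply: le_trans (_ : (2 * (pi z).1%:R / (dim w (pi z).1)%:R) * (2 * (pi z).1%:R / (dim w (pi z).1)%:R) * _ <= _).
    by apply: ler_wpM2r; [exact: ler0n | apply: ler_pM; rewrite ?ler0n].
  by rewrite /D' le_eqVlt; apply/orP; left; apply/eqP; ring.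
apply: soft_scale => //; first exact: soft1n.
have sn : soft D L (fun z => (pi z).1%:R) (fun z => (pi z).1%:R) by apply: soft_refl => z _; exact: ler0n.
apply: (soft_weaken L1 _ (soft_mul sn (soft_mul (soft_dim w2 Dpi) soft_slice_ratio))) => z Dz.
have [n1 _ _] := Dpi Dz; have n0 : (0 < (pi z).1)%N by exact: ltnW.
rewrite le_eqVlt; apply/orP; left; apply/eqP.
have -> : goal z = ((pi z).1%:R `^ 1 * ((pi z).1%:R `^ (- (1 / w)) * (pi z).1%:R `^ (- (1 / w)))) * delta (pi z).
  by rewrite -!powD // /goal /target; congr (_ `^ _ * _); rewrite div1r; ring.
by rewrite powRr1 ?ler0n //; ring.
Qed.

End Over.

End Totals.

Section Schedule.
Local Open Scope nat_scope.

Lemma slowdown_le (M J j : nat) : 4 <= M -> 2 ^ J <= 2 * M -> j <= J ->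
  (Tmax M %/ 2 ^ j + 1) * 2 ^ j <= 6 * M.
Proof.
move=> M4 JM jJ; have := leq_divM (Tmax M) (2 ^ j); rewrite mulnDl mul1n.
have : 2 ^ j <= 2 ^ J by rewrite leq_exp2l.
have : Tmax M <= 4 * M by rewrite /Tmax; lia.
by move: (Tmax M %/ 2 ^ j * 2 ^ j) => u; lia.
Qed.

(** Rare relaxations compensate high loads: [s] is about [M / P] and the load about [N * P / M + x],
    so every class handles [O~(N + M)] rows in total. *)
Lemma scaled_load_le s P M N x cw : 0 < M -> 0 < P -> 0 < cw -> s * P <= 6 * M ->
  s * minn N ((4 * (2 * (cw * P) + 1) * N) %/ M + 1 + x) <= 72 * cw * N + 6 * (M * (1 + x)).
Proof.
move=> M0 P0 c0 sP; set A := 4 * _ * N.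
have s6 : s <= 6 * M by apply: leq_trans sP; rewrite leq_pmulr.
apply: leq_trans (_ : s * (A %/ M) + s * (1 + x) <= _).
  by rewrite -mulnDr addnA leq_mul2l geq_minr orbT.
apply: leq_add; last by rewrite mulnA leq_mul2r s6 orbT.
rewrite -(leq_pmul2r M0) -mulnA; apply: leq_trans (leq_mul (leqnn s) (leq_divM A M)) _.
have cP : 2 * (cw * P) + 1 <= 3 * (cw * P) by have := leq_mul c0 P0; lia.
have h1 : A <= 12 * cw * N * P.
  have := leq_mul cP (leqnn (4 * N)); rewrite /A; lia.
have := leq_mul (leqnn (12 * cw * N)) sP; have := leq_mul (leqnn s) h1; lia.
Qed.

(** [56 * k + 26] is the constant [cw] at [k0 = 2 * k]; the term [6 * k] serves the first level,
    where the precision is [k] and the load [N]. *)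
Definition schedule_bound (k N x M : nat) : nat :=
  (72 * (56 * k + 26) + 6 * k) * N + 6 * (M * (1 + x)).

Lemma schedule_le (N I x q j : nat) : j <= lg (precision I q) ->
  (Tmax (precision I q) %/ 2 ^ j + 1) * level_load N I x q j <=
    schedule_bound (coarseness I) N x (precision I q).
Proof.
move=> jJ; set k := coarseness I; set M := precision I q in jJ *.
have k4 : 4 <= k by rewrite /k /coarseness; lia.
have kM : k <= M by rewrite /M /precision -/k leq_pmulr // expn_gt0.
have M4 : 4 <= M by lia.
have JM : 2 ^ lg M <= 2 * M.
  by rewrite /lg expnS leq_mul2l trunc_logP //; lia.
have := slowdown_le M4 JM jJ; set s := _ %/ _ + 1 => sP.
have p0 : 0 < 2 ^ j by rewrite expn_gt0.
have s6 : s <= 6 * M by apply: leq_trans sP; rewrite leq_pmulr.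
rewrite /schedule_bound /level_load; case qE: q => [|q'].
  have Mk : M = k by rewrite /M qE /precision expn0 muln1.
  by have := leq_mul s6 (leqnn N); rewrite Mk; lia.
rewrite /delayed_load /load -qE -/M -/k; set cw := 2 * _ + 10.
have cwE : cw = 56 * k + 26 by rewrite /cw; lia.
have M0 : 0 < M by lia.
have c0 : 0 < cw by lia.
by apply: leq_trans (scaled_load_le N x M0 p0 c0 sP) _; rewrite cwE; lia.
Qed.

End Schedule.

Section LevelTotals.
Variables (R : realType) (w r r' : R) (c a b X bB Cr : nat).
Hypotheses (w2 : 2 <= w) (Hr : 0 < r < 1) (Hr' : 0 <= r' <= 1).
Hypothesis rE : r = 1 - (1 - r') / w.

Let D := @moderate R w.
Let L := @logn R.
Let level_domain := below D (fun z => (levels z).+1).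
Let prec (y : nat * R * nat) := precision (scales c y.1) y.2.
Let class_domain := below level_domain (fun y => (lg (prec y)).+1).
Let D1 z : D z -> moderate w z. Proof. by []. Qed.
Let D2 y : level_domain y -> moderate w y.1. Proof. by case. Qed.
Let D3 y : class_domain y -> moderate w y.1.1. Proof. by case=> /D2. Qed.

Let cost_at (y : nat * R * nat) := level_cost (pcost w c a Cr y.1) (mcost w r' c a Cr y.1)
  (source_count r y.1) (scales c y.1) b (rank_bits X y.1) y.2.

Lemma prec_le y : level_domain y -> (prec y <= precision (scales c y.1) (levels y.1))%N.
Proof. by case=> _ h; rewrite /prec /precision leq_mul2l leq_exp2l // -ltnS h orbT. Qed.

Lemma lg_le k : (0 < k)%N -> (lg k <= k)%N.
Proof. by move=> k0; apply: leq_trans (trunc_logP (isT : (1 < 2)%N) k0); exact: ltn_expl. Qed.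

Lemma soft_lg_prec : soft level_domain (fun y => L y.1) (fun y => (lg (prec y)).+1%:R) (fun=> 1).
Proof.
have l1 y : level_domain y -> 1 <= L y.1 by exact: (L_ge1 D2).
apply: (soft_leqn (F' := fun y => (coarseness (scales c y.1) + levels y.1) + 1)%N); last first.
  apply: soft_addn => //; last exact: soft1n.
  by apply: soft_addn => //; [exact: (soft_coarseness c D2) | exact: (soft_levels w2 D2)].
move=> y Dy; rewrite addn1 ltnS; have [_ yq] := Dy.
set k := coarseness _; have k0 : (0 < k)%N by rewrite /k /coarseness addn_gt0 orbT.
rewrite /lg -(ltn_exp2l _ _ (isT : (1 < 2)%N)).
apply: leq_ltn_trans (_ : prec y < _)%N.
  by rewrite trunc_logP // /prec /precision muln_gt0 k0 expn_gt0.
rewrite /prec /precision -/k expnD; apply: leq_trans (_ : 2 ^ k * 2 ^ y.2 <= _)%N.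
  by rewrite ltn_pmul2r ?expn_gt0 //; exact: ltn_expl.
by rewrite leq_mul2l leq_exp2l // -ltnS yq orbT.
Qed.

Lemma soft_slowdown : soft class_domain (fun y => L y.1.1)
  (fun y => (2 * (Tmax (prec y.1) %/ 2 ^ y.2 + 1))%N%:R) (fun y => delta y.1.1).
Proof.
have l1 y : class_domain y -> 1 <= L y.1.1 by exact: (L_ge1 D3).
have dc k := soft_delta_const D3 k.
apply: soft_muln => //; first exact: soft1n.
apply: soft_addn => //.
apply: (soft_leqn (F' := fun y => 3 * precision (scales c y.1.1) (levels y.1.1) + 4)%N).
  move=> y [Dy _]; apply: leq_trans (leq_div _ _) _.
  by rewrite /Tmax leq_add2r leq_mul2l prec_le.
apply: soft_addn => //; apply: soft_muln => //; first exact: soft1n.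
exact: (soft_precision c w2 Hr Hr' D3).
Qed.

Lemma soft_scheduled : soft class_domain (fun y => L y.1.1)
  (fun y => (2 * (Tmax (prec y.1) %/ 2 ^ y.2 + 1) * level_load (source_count r y.1.1)
     (scales c y.1.1) (rank_bits X y.1.1) y.1.2 y.2)%N%:R)
  (fun y => y.1.1.1%:R `^ r + delta y.1.1).
Proof.
have l1 y : class_domain y -> 1 <= L y.1.1 by exact: (L_ge1 D3).
have sk := soft_coarseness c D3.
apply: (soft_leqn (F' := fun y => 2 * schedule_bound (coarseness (scales c y.1.1))
  (source_count r y.1.1) (rank_bits X y.1.1) (precision (scales c y.1.1) (levels y.1.1)))%N).
  move=> y [Dy yj]; rewrite -mulnA leq_mul2l; apply/orP; right.
  have := schedule_le (source_count r y.1.1) (rank_bits X y.1.1) (yj : (y.2 <= lg (precision (scales c y.1.1) y.1.2))%N).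
  move/leq_trans; apply.
  by rewrite /schedule_bound leq_add2l leq_mul2l leq_mul2r prec_le ?orbT.
apply: soft_muln => //; first exact: soft1n.
apply: soft_addn => //.
  apply: (soft_weaken l1 _ (_ : soft _ _ _ (fun y => y.1.1.1%:R `^ r))).
    by move=> y /D3 h; rewrite lerDl; have := delta_ge1 h; lra.
  apply: soft_muln => //; last exact: (soft_source_count w2 Hr Hr' rE D3).
  apply: soft_addn => //; last by apply: soft_muln => //; exact: soft1n.
  apply: soft_muln => //; first exact: soft1n.
  apply: soft_addn => //; last exact: soft1n.
  by apply: soft_muln => //; exact: soft1n.
apply: (soft_weaken l1 _ (_ : soft _ _ _ (fun y => delta y.1.1))).
  by move=> y _; rewrite lerDr powR_ge0.
apply: soft_muln => //; first exact: soft1n.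
apply: (soft_leqn (F' := fun y => (1 + rank_bits X y.1.1) *
    precision (scales c y.1.1) (levels y.1.1))%N); first by move=> y _; rewrite mulnC.
apply: soft_muln => //; last exact: (soft_precision c w2 Hr Hr' D3).
apply: soft_addn => //; first exact: soft1n.
by apply: soft_muln => //; [exact: soft1n | exact: (soft_lg D3)].
Qed.

Lemma soft_hub_product : soft D L (fun z => (mcost w r' c a Cr z (source_count r z))%:R) (target w).
Proof.
have l1 z : D z -> 1 <= L z by exact: (L_ge1 D1).
apply: (soft_leqn (F' := fun z => 1 * mcost w r' c a Cr z (source_count r z))%N).
  by move=> z _; rewrite mul1n.
apply: (soft_term c a Cr w2 Hr Hr' rE D1 (s := fun=> 1%N)); first exact: (soft_delta_const D1 1).
apply: (soft_weaken l1 _ (_ : soft _ _ _ (fun z => z.1%:R `^ r))).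
  by move=> z Dz; rewrite lerDl; have := delta_ge1 Dz; lra.
by apply: soft_muln => //; [exact: soft1n | exact: (soft_source_count w2 Hr Hr' rE D1)].
Qed.

Lemma soft_level_cost : soft level_domain (fun y => L y.1) (fun y => (cost_at y)%:R)
  (fun y => target w y.1).
Proof.
have l1 y : level_domain y -> 1 <= L y.1 by exact: (L_ge1 D2).
have tc k := soft_target_const w2 D2 k.
have pcs := soft_pcost c a Cr w2 Hr Hr' D2.
apply: soft_addn => //; apply: soft_addn => //.
  apply: (soft_leqn (F' := fun y => (lg (prec y)).+1 * pcost w c a Cr y.1)%N) => //.
  by apply: soft_muln => //; exact: soft_lg_prec.
apply: soft_addn => //; last by apply: soft_addn => //; exact: (soft_below _ soft_hub_product).
apply: (soft_leqn (F' := fun y => \sum_(j < (lg (prec y)).+1)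
  2 * (Tmax (prec y) %/ 2 ^ j + 1) * mcost w r' c a Cr y.1 (level_load (source_count r y.1)
     (scales c y.1) (rank_bits X y.1) y.2 j))%N).
  by move=> y _; exact: sum_macro_cost.
apply: (soft_sum l1 (J := fun y => (lg (prec y)).+1) (F := fun yj =>
  2 * (Tmax (prec yj.1) %/ 2 ^ yj.2 + 1) * mcost w r' c a Cr yj.1.1 (level_load (source_count r yj.1.1)
     (scales c yj.1.1) (rank_bits X yj.1.1) yj.1.2 yj.2))%N).
- exact: soft_lg_prec.
- exact: (soft_term c a Cr w2 Hr Hr' rE D3 soft_slowdown soft_scheduled).
- by move=> y; exact: (target_ge0 w2 D2).
Qed.

Definition total_cost (z : nat * R) : nat :=
  main_cost z.1 (pcost w c a Cr z) (mcost w r' c a Cr z) (cover r z.1) (5 * lg z.1) bB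
    (scales c z) (levels z) b (rank_bits X z) (ceil_pow z.1 r).

Lemma soft_total_cost : soft D L (fun z => (total_cost z)%:R) (target w).
Proof.
have l1 z : D z -> 1 <= L z by exact: (L_ge1 D1).
have tc k := soft_target_const w2 D1 k.
apply: soft_addn => //; apply: soft_addn => //.
  apply: soft_muln => //; first exact: (soft_lg D1).
  exact: (soft_route D1 1 bB (target_ge1 w2 D1) (tc 1%N)).
apply: soft_addn => //; apply: soft_addn => //.
apply: (soft_sum l1 (J := fun z => (levels z).+1) (F := fun y => scales c y.1 * cost_at y)%N).
- apply: (soft_leqn (F' := fun z => levels z + 1)%N) => [z _|]; first by rewrite addn1.
  by apply: soft_addn => //; [exact: (soft_levels w2 D1) | exact: soft1n].
- by apply: soft_muln; [exact: (L_ge1 D2) | exact: (soft_scales c D2) | exact: soft_level_cost].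
- by move=> z; exact: (target_ge0 w2 D1).
Qed.

End LevelTotals.

(** * Exponents fixed independently of [n] and [eps] *)

Section Constants.
Variables (R : realType) (w r r' : R) (c Cr : nat).
Hypotheses (w2 : 2 <= w) (Hr : 0 < r < 1) (Hr' : 0 <= r' <= 1).
Implicit Types (z : nat * R) (q : nat).
Let D := @moderate R w.
Let n1 z : D z -> (1 < z.1)%N. Proof. by case. Qed.
Let top (z : nat * R) := precision (scales c z) (levels z).
Let coarse_z (z : nat * R) := coarseness (scales c z).

Lemma poly_lg : poly_bounded D fst (fun z => lg z.1).
Proof.
apply: (poly_le (F' := fst)); last exact: poly_n.
by move=> z Dz; apply: lg_le; exact/ltnW/n1.
Qed.

Lemma poly_coarseness : poly_bounded D fst coarse_z.
Proof.
apply: (poly_add n1); last exact: (poly_const n1).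
apply: poly_mul; first exact: (poly_const n1).
by apply: poly_mul; [exact: (poly_const n1) | exact: poly_lg].
Qed.

Lemma poly_top : poly_bounded D fst top.
Proof.
apply: poly_mul; first exact: poly_coarseness.
apply: (poly_le (F' := fun z => 4 * (2 * z.1))%N) => [z Dz|].
  have [_ h] := levelsP w2 Hr Hr' Dz; have [_ _ h2] := eceilP w2 Dz.
  by apply: leq_trans h _; rewrite leq_mul2l h2.
by do 2 ! [apply: poly_mul; first exact: (poly_const n1)]; exact: poly_n.
Qed.

Let times_bound z := (7 * top z + (28 * coarse_z z + 14) * (2 * top z))%N.

Lemma precision_le z q : (q <= levels z)%N -> (precision (scales c z) q <= top z)%N.
Proof. by move=> h; rewrite /top /precision leq_mul2l leq_exp2l ?h ?orbT. Qed.

Lemma pow_lg_le k : (0 < k)%N -> (2 ^ lg k <= 2 * k)%N.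
Proof. by move=> k0; rewrite /lg expnS leq_mul2l trunc_logP. Qed.

Lemma precision_gt0 z q : (0 < precision (scales c z) q)%N.
Proof. by rewrite /precision muln_gt0 expn_gt0 /coarseness addn_gt0 orbT. Qed.

Lemma times_le z q : (q <= levels z)%N ->
  (times (precision (scales c z) q) (lg (precision (scales c z) q)) (2 * coarse_z z) <= times_bound z)%N.
Proof.
move=> h; have h1 := precision_le h; have h2 := pow_lg_le (precision_gt0 z q).
rewrite /times /times_bound; apply: leq_add; first by rewrite leq_mul2l h1.
by apply: leq_mul; lia.
Qed.

Lemma poly_times : poly_bounded D fst times_bound.
Proof.
have pt := poly_top; have pk k := poly_const n1 k.
apply: (poly_add n1); first exact: poly_mul.
apply: poly_mul; last exact: poly_mul.
by apply: (poly_add n1) => //; apply: poly_mul => //; exact: poly_coarseness.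
Qed.

Lemma times_constant : exists b, forall z q, D z -> (q <= levels z)%N ->
  (times (precision (scales c z) q) (lg (precision (scales c z) q)) (2 * coarse_z z) < z.1.+1 ^ b)%N.
Proof.
have [b H] := poly_add n1 poly_times (poly_const n1 1); exists b => z q Dz h.
by apply: leq_trans (H z Dz); rewrite addn1 ltnS times_le.
Qed.

(** [X] is chosen after [b]: the failure probability of the delays must beat the number
    [n ^ (b + 6)] of seeds. *)
Lemma steps_constant b : exists X, forall z q, D z -> (q <= levels z)%N ->
  ((lg (precision (scales c z) q)).+1 *
    steps (precision (scales c z) q) (lg (precision (scales c z) q)) (2 * coarse_z z) *
    z.1 ^ (b + 6) <= 2 ^ rank_bits X z)%N.
Proof.
have pk k := poly_const n1 k.
have p1 : poly_bounded D fst (fun z => (top z + 1) * (times_bound z + top z +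
    (56 * coarse_z z + 26) * (2 * top z)) * z.1 ^ (b + 6))%N.
  have pt := poly_top.
  apply: poly_mul; last exact/poly_exp/poly_n.
  apply: poly_mul; first exact: (poly_add n1).
  apply: (poly_add n1); first by apply: (poly_add n1) => //; exact: poly_times.
  apply: poly_mul; last exact: poly_mul.
  by apply: (poly_add n1) => //; apply: poly_mul => //; exact: poly_coarseness.
have [X H] := p1; exists X => z q Dz h.
apply: leq_trans (_ : z.1.+1 ^ X <= _)%N.
  apply: leq_trans (H z Dz); rewrite leq_mul2r; apply/orP; right.
  have h1 := precision_le h; have h2 := pow_lg_le (precision_gt0 z q).
  apply: leq_mul.
    by rewrite addn1 ltnS; apply: leq_trans h1; apply: lg_le; exact: precision_gt0.
  rewrite /steps; apply: leq_add; first by apply: leq_add => //; exact: times_le.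
  by apply: leq_mul; lia.
rewrite /rank_bits mulnC expnM; apply: leq_expl; exact: ltn_lg.
Qed.

Lemma slices_constant : exists a, forall z, D z ->
  ((Cr * z.1 + z.1 + z.1) * ((2 * z.1 + 2) * (2 * z.1 + 2) * (2 * slices c z)) <= z.1.+1 ^ a)%N.
Proof.
have pk k := poly_const n1 k; have pn := @poly_n _ D (@fst nat R).
have p2 : poly_bounded D fst (fun z => 2 * z.1 + 2)%N.
  by apply: (poly_add n1) => //; apply: poly_mul.
apply: poly_mul.
  by apply: (poly_add n1) => //; apply: (poly_add n1) => //; apply: poly_mul.
apply: poly_mul; first by apply: poly_mul.
apply: poly_mul => //; apply: (poly_add n1) => //.
apply: poly_mul; last exact: poly_top.
apply: poly_mul => //; apply: (poly_add n1) => //; apply: poly_mul => //.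
by apply: poly_mul => //; exact: poly_lg.
Qed.

Lemma weights_constant : exists bB, forall n, (1 < n)%N ->
  ((n * (n * n ^ c).+1).+1 <= n.+1 ^ bB)%N /\
  ((n * n ^ c).+2 * (n * n ^ c).+2 <= n.+1 ^ bB)%N.
Proof.
pose D0 n := (1 < n)%N; have m1 n : D0 n -> (1 < id n)%N by [].
have pk k := poly_const m1 k; have pn := @poly_n _ D0 id.
have pc : poly_bounded D0 id (fun n => n * n ^ c)%N by apply: poly_mul => //; exact: poly_exp.
have [bB H] : poly_bounded D0 id (fun n => (n * (n * n ^ c + 1) + 1) +
    (n * n ^ c + 2) * (n * n ^ c + 2))%N.
  apply: (poly_add m1).
    by apply: (poly_add m1) => //; apply: poly_mul => //; exact: (poly_add m1).
  by apply: poly_mul; exact: (poly_add m1).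
exists bB => n hn; have := H n hn; rewrite addn1 addn2 => le.
by split; apply: leq_trans le; [rewrite addn1 leq_addr | exact: leq_addl].
Qed.

End Constants.

(** * Assembling the algorithm *)

Section SmallError.
Variables (R : realType) (w : R) (c bB : nat).
Hypothesis w2 : 2 <= w.

Definition root n : nat := Num.truncn (n%:R `^ 2^-1 : R).

Definition fine_error (z : nat * R) : Prop :=
  [/\ (1 < z.1)%N, 0 < z.2 < 1 & z.1%:R `^ (1 - 1 / w) <= delta z].

Lemma rootP n : (0 < n)%N -> [/\ (0 < root n)%N, (root n * root n <= n)%N &
  n%:R `^ 2^-1 <= 2 * (root n)%:R :> R].
Proof.
move=> n0; have [h1 h2 h3] := truncn_bounds (powR_ge1 (natr_ge1 R n0) (ltac:(lra) : 0 <= 2^-1 :> R)).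
by split=> //; exact: square_le h2.
Qed.

(** Here [1 / eps >= n ^ (1 - 1 / w)] makes the target at least [n ^ (2 - 3 / w)], and
    [2 - 3 / w >= 1/2] because [w >= 2]. *)
Lemma fine_target z : fine_error z -> z.1%:R `^ 2^-1 <= target w z.
Proof.
move=> [n1 /andP[e0 e1] h]; have n0 : (0 < z.1)%N by exact: ltnW.
have /andP[iw0 iw2] := iw_bounds w2.
apply: le_trans (_ : z.1%:R `^ (1 - 2 / w) * z.1%:R `^ (1 - 1 / w) <= _).
  rewrite -powD //; apply: pow_le => //.
  by rewrite (_ : 2 / w = 2 * (1 / w)); [lra | rewrite div1r].
by apply: ler_wpM2l; [exact: powR_ge0 | exact: h].
Qed.

Lemma soft_exact_cost : soft fine_error (@logn R)
  (fun z => (exact_cost z.1 (root z.1) bB)%:R) (target w).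
Proof.
have l1 z : fine_error z -> 1 <= logn z by move=> _; rewrite /logn ler1n.
have pge z : fine_error z -> 1 <= z.1%:R `^ 2^-1 :> R.
  by move=> [n1 _ _]; apply: powR_ge1; [rewrite ler1n ltnW | lra].
apply: (soft_weaken l1 fine_target).
have sl : soft fine_error (@logn R) (fun z => (lg z.1)%:R) (fun=> 1) by exact: soft_L l1.
have kc k : soft fine_error (@logn R) (fun=> k%:R) (fun z => z.1%:R `^ 2^-1).
  exact: (soft_constn l1 k pge).
have k1 k : soft fine_error (@logn R) (fun=> k%:R) (fun=> 1) by exact: soft_const.
have st : soft fine_error (@logn R) (fun z => (2 * bsize (root z.1) z.1)%N%:R) (fun z => z.1%:R `^ 2^-1).
  apply: soft_muln => //.
  apply: (soft_le (f' := fun z => 4 * z.1%:R `^ 2^-1)); last first.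
    by apply: soft_scale => //; apply: soft_refl => z _; exact: powR_ge0.
  move=> z [n1 _ _]; rewrite ler0n /=; have n0 : (0 < z.1)%N by exact: ltnW.
  have [s0 ss h] := rootP n0; apply: le_trans (bsize_n_le R s0 ss) _.
  rewrite ler_pdivrMr ?ltr0n //.
  have nE : z.1%:R = z.1%:R `^ 2^-1 * z.1%:R `^ 2^-1 :> R.
    by rewrite -powD // (_ : 2^-1 + 2^-1 = 1) ?powRr1 ?ler0n //; lra.
  have := ler_wpM2l (powR_ge0 z.1%:R 2^-1) h; move: nE.
  by set p := _ `^ _; set s := _%:R; set n := _%:R; lra.
have rt e f : soft fine_error (@logn R)
    (fun z => (route_cost z.1 e f (2 * bsize (root z.1) z.1))%:R) (fun z => z.1%:R `^ 2^-1).
  apply: (soft_leqn (F' := fun z => route_factor e f * (lg z.1 * (2 * bsize (root z.1) z.1 + 1)))%N).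
    by move=> z _; exact: route_cost_le.
  by apply: soft_muln => //; apply: soft_muln => //; exact: soft_addn.
apply: soft_muln => //; apply: soft_addn => //.
exact: soft_addn.
Qed.

End SmallError.

Section Output.
Variable R : realType.

(** Division by [L] undoes the scaling of the weights; a missing estimate stands for disconnected
    vertices. *)
Definition extended (L : nat) (o : option nat) : \bar R :=
  if o is Some e then (e%:R / L%:R)%:E else +oo%E.

Lemma approx_extended n (G : wgraph n) (S : {set 'I_n}) (eps : R) (L : nat)
    (d : 'I_n -> 'I_n -> option nat) : 0 < eps -> (0 < L)%N ->
  (forall u v, u \in S -> (forall e, d v u = Some e -> connected G u v) /\
    (connected G u v -> exists e, [/\ d v u = Some e, (L * dn G u v <= e)%N &
       e%:R <= (1 + eps) * (L * dn G u v)%:R])) ->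
  approx_distances G S eps (fun u v => extended L (d v u)).
Proof.
move=> e0 L0 H u v uS; have [h1 h2] := H u v uS.
case: (pselect (connected G u v)) => [uv|no].
  have [e [-> le1 le2]] := h2 uv; rewrite (dist_dn R uv) /extended !lee_fin.
  have LR : 0 < L%:R :> R by rewrite ltr0n.
  rewrite ler_pdivlMr // -natrM ler_nat mulnC le1; split=> //.
  by rewrite ler_pdivrMr //; move: le2; rewrite natrM; lra.
rewrite (dist_infty R no); case E: (d v u) => [e|]; first by have := h1 e E.
by split=> //=; rewrite gt0_muley // lte_fin; lra.
Qed.

End Output.

Section Key.
Variables (R : realType) (omega : R -> R) (r r' : R) (c : nat).
Hypotheses (Homega : forall s : R, 0 <= s <= 1 -> mulmx_exponent s (omega s))
  (Hr : 0 < r < 1) (Hr' : 0 <= r' <= 1) (Hrr' : r' = 1 - (1 - r) * omega r').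
Let w := omega r'.

Definition valid_input n (g : wgraph n * {set 'I_n}) (c0 : 'I_n -> local_input n) : Prop :=
  [/\ c0 = graph_input g.1 g.2, weights_le g.1 (n ^ c) & #|g.2| = ceil_pow n r].

Definition valid_output n (eps : R) (g : wgraph n * {set 'I_n}) (out : 'I_n -> 'I_n -> \bar R) :=
  approx_distances g.1 g.2 eps (fun u v => out v u).

Lemma w_ge2 : 2 <= w.
Proof. by have /andP[h _] := Hr'; apply: exponent_ge2 h (Homega Hr'). Qed.

Lemma r_eq : r = 1 - (1 - r') / w.
Proof.
have w0 : w != 0 by apply: lt0r_neq0; have := w_ge2; lra.
rewrite {1}Hrr' -/w; field; exact: w0.
Qed.

Lemma lg_ln : exists k : nat, forall n, (0 < n)%N -> (lg n)%:R <= k%:R * (1 + ln n%:R) :> R.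
Proof.
have l2 : 0 < ln 2 :> R by rewrite ln_gt0 // ltr1n.
exists (Num.truncn (ln 2 : R)^-1).+2 => n n0.
have h : (trunc_log 2 n)%:R * ln 2 <= ln n%:R :> R.
  rewrite mulr_natl -lnXn // -natrX ler_ln ?posrE ?ltr0n ?expn_gt0 //.
  by rewrite ler_nat trunc_logP.
have k0 := truncnS_gt (ln 2 : R)^-1; set k := (Num.truncn _).+1 in k0 *.
have ln0 : 0 <= ln n%:R :> R by rewrite ln_ge0 // ler1n.
have h2 : (trunc_log 2 n)%:R <= k%:R * ln n%:R :> R.
  rewrite -(ler_pM2r l2); apply: le_trans h _.
  have : 1 <= k%:R * ln 2 :> R by rewrite -ler_pdivrMr // div1r ltW.
  by move=> h1; rewrite mulrAC; apply: ler_peMl.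
have k1 : 0 <= k%:R :> R by rewrite ler0n.
by rewrite /lg -addn1 natrD -[k.+1]addn1 natrD; lra.
Qed.

Lemma lg_pow5 n : (n ^ 5 <= 2 ^ (5 * lg n))%N.
Proof. by rewrite mulnC expnM leq_exp2r //; exact/ltnW/ltn_lg. Qed.

(** The inequality [2 ^ 3 <= 3 ^ 2], raised to the power [lg n * c.+1]. *)
Lemma scales_enough n (eps : R) : (n * n ^ c * 2 ^ scales c (n, eps) <= 3 ^ scales c (n, eps))%N.
Proof.
rewrite /scales /= -expnS; set l := lg n.
rewrite (_ : 2 * c.+1 * l = (2 * l) * c.+1)%N; last by lia.
rewrite ![(_ ^ (2 * l * c.+1))%N]expnM -expnMn; apply: leq_expl.
apply: leq_trans (_ : 2 ^ l * 2 ^ (2 * l) <= _)%N; first by rewrite leq_mul2r ltnW ?orbT ?ltn_lg.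
by rewrite -expnD (_ : l + 2 * l = 3 * l)%N ?[(2 ^ _)%N]expnM ?[(3 ^ _)%N]expnM ?leq_expl //; lia.
Qed.


Lemma solves_moderate : exists a b X bB Cr : nat, forall z : nat * R, moderate w z ->
  solves (total_cost w r r' c a b X bB Cr z) (@valid_input z.1) (@valid_output z.1 z.2).
Proof.
have [C HC] := Homega Hr'; pose Cr := (Num.truncn (2 * C)).+1.
have [a aP] := slices_constant c Cr w_ge2 Hr Hr'.
have [b bP] := times_constant c w_ge2 Hr Hr'.
have [X XP] := steps_constant c w_ge2 Hr Hr' b.
have [bB BP] := weights_constant c.
exists a, b, X, bB, Cr => -[n eps] mz; have [n1 /andP[e0 e1] _] := mz; rewrite /= in n1 e0 e1.
have n0 : (0 < n)%N by exact: ltnW.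
have [d0 dd dle _] := dimP w_ge2 n0; have [d10 d1d _] := dim1P w_ge2 Hr' n0.
have [k0 kk mk _] := ball_sizeP w_ge2 Hr Hr' r_eq n0.
have kn : (ball_size r n <= n)%N by apply: leq_trans kk; rewrite leq_pmulr.
have [p [out [/slp_bilinear[N [fu [fv [fw [Np bil]]]]] pC]]] := HC (dim w n).
have w0 : 0 < w by have := w_ge2; lra.
have dw : (dim w n)%:R `^ w <= n%:R :> R.
  apply: le_trans (_ : (n%:R `^ (1 / w)) `^ w <= _).
    by apply: ge0_ler_powR; rewrite ?nnegrE ?powR_ge0 ?ler0n // ltW.
  by rewrite -powRrM div1r mulVf ?powRr1 ?ler0n // lt0r_neq0.
have dw0 : 0 < (dim w n)%:R `^ w :> R by rewrite powR_gt0 // ltr0n.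
have C0 : 0 <= C.
  by rewrite -(pmulr_lge0 _ dw0); apply: le_trans pC; exact: ler0n.
(* The program has at most [C * n] instructions, each giving at most two bilinear products. *)
have Nn : (N <= Cr * n)%N.
  rewrite -(ler_nat R) natrM; apply: le_trans (_ : 2 * C * n%:R <= _).
    apply: le_trans (_ : (2 * size p)%:R <= _); first by rewrite ler_nat.
    rewrite natrM -mulrA ler_wpM2l //; apply: le_trans pC _; exact: ler_wpM2l.
  by apply: ler_wpM2r; [exact: ler0n | exact/ltW/truncnS_gt].
have lab : ((N + dim w n * dim w n + dim1 w r' n * dim w n) *
    ((2 * n + 2) * (2 * n + 2) * (2 * slices c (n, eps))) <= n.+1 ^ a)%N.
  apply: leq_trans (aP _ mz); rewrite leq_mul2r; apply/orP; right.
  apply: leq_add; first exact: leq_add.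
  by apply: leq_trans dd; rewrite leq_mul2r d1d orbT.
have [PD [prep [[pd0] eng]]] := engine_instance bil n1 d0 d10 d1d dd Nn lab.
have [BE _] := BP n n1.
have main := solves_main eng pd0 (ceil_pow n r) n1 k0 kk kn mk (lg_pow5 n) BE
  (scales_enough n eps) (leqnn _) (fun q => bP _ q mz) (fun q => XP _ q mz).
pose L := range (scales c (n, eps)) (levels (n, eps)) 0.
have L0 : (0 < L)%N by exact: range0_gt0.
apply: (solves_lift (f := fun _ y => y) (h := fun _ _ d u => extended R L (d u)) main).
move=> g c0 [cE gc gS]; exists g; split; first by split=> //; rewrite gS.
move=> d est; apply: approx_extended => // u v uS; have [h1 h2] := est u v uS.
split=> // uv; have [e eE /andP[le1 le2]] := h2 uv; exists e; split=> //.
have [lev _] := levelsP w_ge2 Hr Hr' mz; rewrite /delta /= in lev.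
have P0 : 0 < (2 ^ levels (n, eps))%:R :> R by rewrite ltr0n expn_gt0.
rewrite -(ler_nat R) natrD in le2; apply: le_trans le2 _; rewrite mulrDl mul1r lerD2l.
apply: le_trans (natr_divn_le R _ _) _; rewrite ler_pdivrMr // natrM -/L.
have : 2 <= eps * (2 ^ levels (n, eps))%:R.
  by rewrite mulrC -ler_pdivrMr.
by move=> h; rewrite mulrAC; apply: ler_wpM2r; rewrite ?ler0n.
Qed.

Lemma solves_fine bB : (forall n, (1 < n)%N -> ((n * n ^ c).+2 * (n * n ^ c).+2 <= n.+1 ^ bB)%N) ->
  forall z : nat * R, fine_error w z ->
  solves (exact_cost z.1 (root R z.1) bB) (@valid_input z.1) (@valid_output z.1 z.2).
Proof.
move=> BP [n eps] [n1 /andP[e0 e1] _]; rewrite /= in n1 e0 e1.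
have n0 : (0 < n)%N by exact: ltnW.
have [s0 ss _] := rootP R n0.
have ex := @solves_exact n (root R n) c bB n1 s0 ss (BP n n1) _ fst (@valid_input n).
apply: (solves_lift (f := fun _ y => y) (h := fun _ _ d u => extended R 1 (d u)) (ex _)).
  by move=> g c0 [-> gc _]; split.
move=> g c0 vg; exists g; split=> // d H; apply: approx_extended => // u v uS.
have [h1 h2] := H u v; split=> [e /h1[]//|uv].
case E: (d v u) (h2 uv) => [e|//] _; have [_ eE] := h1 e E; exists e; split=> //.
  by rewrite mul1n eE.
by rewrite mul1n -eE; apply: ler_peMl; [exact: ler0n | rewrite lerDl ltW].
Qed.

Lemma solves_small n eps : (n <= 1)%N -> 0 < eps ->
  solves 0 (@valid_input n) (@valid_output n eps).
Proof.
move=> n1 e0; apply: (@solves_idle _ _ _ _ _ _ _ (fun _ _ _ => extended R 1 (Some 0%N))) => g c0 _.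
apply: (@approx_extended _ _ _ _ _ _ (fun _ _ => Some 0%N)) => // u v _.
have uv : u = v by apply/val_inj; have := ltn_ord u; have := ltn_ord v; move=> /=; lia.
rewrite uv; split=> [e _|_]; first exact: connected_refl.
by exists 0%N; rewrite dn_self muln0 mulr0.
Qed.

Lemma solves_valid : exists (C k : nat), forall n (eps : R), 0 < eps < 1 -> exists T,
  solves T (@valid_input n) (@valid_output n eps) /\
  T%:R <= C%:R * (1 + ln n%:R) ^+ k * (n%:R `^ (1 - 2 / w) / eps).
Proof.
have [a [b [X [bB1 [Cr main]]]]] := solves_moderate.
have [bB BP] := weights_constant c.
have ex := solves_fine (fun n h => (BP n h).2).
have [C1 [p1 H1]] := soft_total_cost c a b X bB1 Cr w_ge2 Hr Hr' r_eq.
have [C2 [p2 H2]] := soft_exact_cost bB w_ge2.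
have [l Hl] := lg_ln.
exists (C1 * l ^ p1 + C2 * l ^ p2)%N, (p1 + p2)%N => n eps /[dup] e01 /andP[e0 e1].
have ln0 : 0 <= ln n%:R :> R.
  by case: (posnP n) => [->|n0]; [rewrite ln0 | rewrite ln_ge0 // ler1n].
have ge1 p : 1 <= (1 + ln n%:R) ^+ p :> R by apply: exprn_ege1; lra.
have tg0 : 0 <= n%:R `^ (1 - 2 / w) / eps :> R by rewrite divr_ge0 ?powR_ge0 // ltW.
(* The moderate and the fine regime come with their own constants and powers; the sums serve
   both. *)
have bound Ci pi (T : nat) : (1 < n)%N -> (pi <= p1 + p2)%N ->
    (Ci * l ^ pi <= C1 * l ^ p1 + C2 * l ^ p2)%N ->
    T%:R <= Ci%:R * logn (n, eps) ^+ pi * target w (n, eps) ->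
    T%:R <= (C1 * l ^ p1 + C2 * l ^ p2)%:R * (1 + ln n%:R) ^+ (p1 + p2) *
      (n%:R `^ (1 - 2 / w) / eps).
  move=> n1 pp hC le; apply: le_trans le _; apply: ler_wpM2r => //.
  apply: le_trans (_ : (Ci * l ^ pi)%:R * (1 + ln n%:R) ^+ pi <= _).
    rewrite natrM -mulrA; apply: ler_wpM2l; first exact: ler0n.
    rewrite natrX -exprMn; apply: lerXn2r; rewrite ?nnegrE ?ler0n //; last exact: Hl (ltnW n1).
    by rewrite mulr_ge0 ?ler0n //; lra.
  apply: ler_pM; rewrite ?ler0n ?ler_nat //; first by have := ge1 pi; lra.
  by apply: ler_weXn2l => //; lra.
case: (leqP n 1) => n1.
  exists 0%N; split; first exact: solves_small.
  by rewrite mulr_ge0 // mulr_ge0 ?ler0n //; have := ge1 (p1 + p2)%N; lra.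
case: (lerP (delta (n, eps)) (n%:R `^ (1 - 1 / w))) => de.
  have mz : moderate w (n, eps) by [].
  exists (total_cost w r r' c a b X bB1 Cr (n, eps)); split; first exact: main mz.
  have [_ _ le] := H1 _ mz; apply: (bound C1 p1) le => //; [exact: leq_addr | exact: leq_addr].
have fz : fine_error w (n, eps) by split=> //; exact: ltW.
exists (exact_cost n (root R n) bB); split; first exact: ex fz.
by have [_ _ le] := H2 _ fz; apply: (bound C2 p2) le => //; [exact: leq_addl | exact: leq_addl].
Qed.

End Key.

Theorem theorem6 (R : realType) (omega : R -> R)
    (Homega : forall s : R, 0 <= s <= 1 -> mulmx_exponent s (omega s))
    (r r' : R) (c : nat) (Hr : 0 < r < 1) (Hr' : 0 <= r' <= 1)
    (Hrr' : r' = 1 - (1 - r) * omega r') :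
  exists (K : nat) (A : forall n : nat, R -> mssp_algorithm R K n)
         (T : nat -> R -> nat),
    soft_O T (fun n eps => n%:R `^ (1 - 2 / omega r') / eps) /\
    forall (n : nat) (eps : R) (G : wgraph n) (S : {set 'I_n}),
      0 < eps < 1 ->
      weights_le G (n ^ c)%N ->
      #|S| = ceil_pow n r ->
      approx_distances G S eps
        (fun u v => cc_run (A n eps) (graph_input G S) (T n eps) v u).
Proof.
have [C [k H]] := solves_valid c Homega Hr Hr' Hrr'.
(* One algorithm is chosen per pair [n], [eps]; outside [0 < eps < 1] a dummy is supplied, about
   which nothing is claimed. *)
have choose n eps : exists TA : nat * mssp_algorithm R 1 n, 0 < eps < 1 ->
    (TA.1)%:R <= C%:R * (1 + ln n%:R) ^+ k * (n%:R `^ (1 - 2 / omega r') / eps) /\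
    forall g c0, valid_input r c g c0 -> valid_output eps g (cc_run TA.2 c0 TA.1).
  case: (boolP (0 < eps < 1)) => [he|_].
    by have [T [[A HA] le]] := H n eps he; exists (T, A).
  by exists (0%N, @CCAlgorithm n (bandwidth 1 n) _ _ unit (fun _ _ => tt) (fun _ _ _ => [bseq])
    (fun _ _ _ => tt) (fun _ _ _ => +oo%E)).
pose TA n eps := projT1 (cid (choose n eps)).
have TAP n eps := projT2 (cid (choose n eps)).
exists 1%N, (fun n eps => (TA n eps).2), (fun n eps => (TA n eps).1); split.
  by exists C%:R, k => n eps e01; have [] := TAP n eps e01.
move=> n eps G S e01 wG cS; have [_ correct] := TAP n eps e01; exact: (correct (G, S)).
Qed.
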